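(* Let $\alpha\in(\frac12,\frac32)\setminus\{1\}$. There is a constant $C$ depending only on $\alpha$ such that for any periodic function $f$ with vanishing average in $x_1$, $$[Rf]_\alpha\le C\,\big[(-\partial_1^2-|\partial_1|^{-1}\partial_2^2)f\big]_{\alpha-2}\qquad\text{and}\qquad[f]_\alpha\le C\,\big[(-\partial_1^2-|\partial_1|^{-1}\partial_2^2)f\big]_{\alpha-2}.$$
   Context: ''Periodic'' means $1$-periodic in each of the two variables $x=(x_1,x_2)\in\mathbb R^2$; periodic distributions are the dual of $C^\infty$ functions on the torus $[0,1)^2$, with Fourier coefficients $f(k)=\int_{[0,1)^2}e^{-ik\cdot x}f\,dx$, $k\in(2\pi\mathbb Z)^2$. ''Vanishing average in $x_1$'' means $\int_0^1f(x_1,x_2)\,dx_1=0$ for all $x_2$. $R=\partial_1/|\partial_1|$ is the Fourier multiplier $i\,\mathrm{sgn}(k_1)$ for $k_1\neq0$ and $0$ for $k_1=0$. The operator $-\partial_1^2-|\partial_1|^{-1}\partial_2^2$, acting in the distributional sense on periodic functions of vanishing average in $x_1$, is the Fourier multiplier $k_1^2+|k_1|^{-1}k_2^2$, $k_1\neq0$. Anisotropic distance: $d(x,y)=|x_1-y_1|+|x_2-y_2|^{2/3}$. For a periodic function $f$ and $\alpha\in(0,1]$, $[f]_\alpha=\sup_{x\ne y}\frac{|f(y)-f(x)|}{d^\alpha(y,x)}$; for $\alpha\in(1,\frac32)$, $[f]_\alpha=\sup_{x\neq y}\frac{|f(y)-f(x)-\partial_1f(x)(y_1-x_1)|}{d^\alpha(y,x)}$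 (supremum over $x,y\in\mathbb R^2$). For a periodic distribution $f$: if $\beta\in(-1,0)$, $[f]_\beta=\inf\{|c|+[g]_{\beta+1}+[h]_{\beta+\frac32}: f=c+\partial_1g+\partial_2h\}$; if $\beta\in(-\frac32,-1]$, $[f]_\beta=\inf\{|c|+[g]_{\beta+2}+[h]_{\beta+\frac32}: f=c+\partial_1^2g+\partial_2h\}$, with $c$ constant and $g,h$ periodic functions ($+\infty$ if no such representation exists). If the right-hand side of the estimate is finite, it is implicitly understood that $f$ and $Rf$ are (represented by) continuous functions, continuously differentiable in $x_1$ when $\alpha>1$. *)

(* Defs.v *)
From HB Require Import structures.
From mathcomp Require Import all_boot all_order all_algebra.
From mathcomp Require Import complex.
From mathcomp Require Import all_classical all_reals all_analysis.

Set Implicit Arguments.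
Unset Strict Implicit.
Unset Printing Implicit Defensive.

Import Order.TTheory GRing.Theory Num.Theory.
Import numFieldNormedType.Exports.

Local Open Scope classical_set_scope.
Local Open Scope ring_scope.

Section Periodic.
Context {R : realType}.
Implicit Types (F G phi : R * R -> R) (T S : (R * R -> R) -> R).

Definition periodic2 F : Prop :=
  forall x, F (x.1 + 1, x.2) = F x /\ F (x.1, x.2 + 1) = F x.

Definition e1 : R * R := (1, 0).
Definition e2 : R * R := (0, 1).

Definition pderiv (i : bool) F : R * R -> R := 'D_(if i then e1 else e2) F.

(* A word in {1, 2}, encoded by [true] (for 1) and [false] (for 2), denotes an
   iterated partial derivative; the last letter is differentiated first. *)
Definition pderivs (w : seq bool) F : R * R -> R := foldr pderiv F w.

Definition smooth F : Prop :=
  forall w, continuous (pderivs w F) /\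
    forall x, derivable (pderivs w F) x e1 /\ derivable (pderivs w F) x e2.

Definition test phi : Prop := periodic2 phi /\ smooth phi.

(* Distributions are real-valued and are given by a functional on all
   functions, of which only the values at test functions are meaningful.
   Continuity is stated with the seminorms sup |d^w phi| defining the topology
   of the space of test functions. *)
Definition periodic_distribution T : Prop :=
  (forall a phi psi, test phi -> test psi ->
     T (fun x => a * phi x + psi x) = a * T phi + T psi) /\
  exists (K : R) (N : nat), forall phi (M : R), test phi ->
    (forall w x, (size w <= N)%N -> `|pderivs w phi x| <= M) ->
    `|T phi| <= K * M.

Definition eq_dist T S : Prop := forall phi, test phi -> T phi = S phi.

Definition cell : set (R * R) := `[0, 1[ `*` `[0, 1[.

Definition dist_of_fun F : (R * R -> R) -> R := fun phi =>
  \int[(lebesgue_measure \x lebesgue_measure)%E]_(x in cell) (F x * phi x).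

Definition dderiv (i : bool) T : (R * R -> R) -> R :=
  fun phi => - T (pderiv i phi).

(* Distributional form of: the integral over x_1 vanishes for all x_2. *)
Definition vanishing_x1_average T : Prop :=
  forall phi, test phi -> (forall x y, x.2 = y.2 -> phi x = phi y) ->
    T phi = 0.

(* The frequency k = freq n.1, freq n.2 is indexed by n in Z^2. *)
Definition freq (n : int) : R := 2 * pi * n%:~R.

Definition phase (n : int * int) (x : R * R) : R :=
  freq n.1 * x.1 + freq n.2 * x.2.

(* The pairing of T with exp(- i k.x) = cos(k.x) - i sin(k.x). *)
Definition fourier T (n : int * int) : R[i] :=
  (T (fun x => cos (phase n x)) -i* T (fun x => sin (phase n x)))%C.

(* S is the image of T under the Fourier multiplier m. *)
Definition fourier_mult (m : int * int -> R[i]) T S : Prop :=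
  forall n, fourier S n = m n * fourier T n.

Definition symbol_R (n : int * int) : R[i] :=
  if n.1 == 0 then 0 else (0 +i* Num.sg (freq n.1))%C.

(* The value for n.1 = 0 is immaterial: the operator is only applied to
   distributions of vanishing average in x_1, and yields such a distribution. *)
Definition symbol_L (n : int * int) : R[i] :=
  if n.1 == 0 then 0
  else real_complex R (freq n.1 ^+ 2 + `|freq n.1|^-1 * freq n.2 ^+ 2).

Definition adist (x y : R * R) : R :=
  `|x.1 - y.1| + `|x.2 - y.2| `^ (2 / 3).

Definition remainder (alpha : R) F (x y : R * R) : R :=
  if alpha <= 1 then F y - F x
  else F y - F x - pderiv true F x * (y.1 - x.1).

(* [F]_alpha for a function F and 0 < alpha < 3/2.  If alpha > 1, finiteness
   entails that the partial derivative exists everywhere, so its conventional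
   value elsewhere plays no role. *)
Definition holder (alpha : R) F : \bar R :=
  ereal_sup [set r | exists x y, x != y /\
    r = (`|remainder alpha F x y| / adist y x `^ alpha)%:E].

(* [T]_beta for a distribution T and -3/2 < beta < 0. *)
Definition neg_holder (beta : R) T : \bar R :=
  if -1 < beta then
    ereal_inf [set r | exists (c : R) G H, [/\ periodic2 G, periodic2 H,
      eq_dist T (fun phi => dist_of_fun (cst c) phi
        + dderiv true (dist_of_fun G) phi
        + dderiv false (dist_of_fun H) phi) &
      r = (`|c|%:E + holder (beta + 1) G + holder (beta + 3 / 2) H)%E]]
  else
    ereal_inf [set r | exists (c : R) G H, [/\ periodic2 G, periodic2 H,
      eq_dist T (fun phi => dist_of_fun (cst c) phi
        + dderiv true (dderiv true (dist_of_fun G)) phi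
        + dderiv false (dist_of_fun H) phi) &
      r = (`|c|%:E + holder (beta + 2) G + holder (beta + 3 / 2) H)%E]].

Definition regular (alpha : R) F : Prop :=
  continuous F /\
  (1 < alpha -> (forall x, derivable F x e1) /\ continuous (pderiv true F)).

(* F is the continuous periodic function, continuously differentiable in x_1
   if alpha > 1, that represents the distribution T. *)
Definition represents (alpha : R) F T : Prop :=
  [/\ periodic2 F, regular alpha F & eq_dist T (dist_of_fun F)].

End Periodic.

(* Main.v *)
Require Import Defs.
From HB Require Import structures.
From mathcomp Require Import all_boot all_order all_algebra.
From mathcomp Require Import complex ring lra.
From mathcomp Require Import all_classical all_reals all_analysis.

(** Write A for the positive operator with symbol |k_1|^3 + k_2^2 and L for the
    operator of the theorem. On functions of vanishing average in x_1, A is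
    the product of L and |D_1|, hence f = A^(-1) |D_1| Lf is the integral over
    T > 0 of exp(- T A) |D_1| Lf. If Lf = c + D_1^m G + D_2 H, with m = 2 for
    alpha < 1 and m = 1 for alpha > 1, then f and Rf are sums of two integrals
    over T of exp(- T A) D_1^a D_2^b G, up to signs and to Hilbert transforms
    in x_1, where (a, b) is (m + 1, 0) for G and (1, 1) for H. Hilbert
    transforms merely exchange sines and cosines in x_1, and the bounds for the
    kernels hold for both.

    The kernel of exp(- T A) is the product of a kernel in x_1, concentrated at
    scale T^(1/3), and of a kernel in x_2, concentrated at scale T^(1/2)
    ([kernel_peak], by two summations by parts in the Fourier series); these
    are the proportions of the anisotropic distance. As a > 0, the kernel in
    x_1 has mean zero, so that only the Hoelder regularity of order beta of G
    in x_1 enters, and exp(- T A) D_1^a D_2^b G is bounded by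
    T^((beta - a)/3 - b/2) ([tconv_bound], [semigroup_bounds]). In all cases
    the exponent is alpha/3 - 1. Each further derivative costs T^(-1/3) in x_1
    and T^(-1/2) in x_2.

    For a step h in x_1, the sup bound is integrated over the times T < |h|^3
    and the bound on the first or, if alpha > 1, the second derivative over
    T > |h|^3; for a step in x_2 the critical time is h^2
    ([heat_interpolation]). This yields the powers |h|^alpha and
    |h|^(2 alpha/3) of the Hoelder seminorm ([pot_x1_holder],
    [pot_x1_taylor], [pot_x2_holder]).

    For distributions, the integral is started at a time tau > 0 and the
    Fourier series is truncated at a frequency of order 1/tau. The result is a
    trigonometric polynomial, namely the truncation of exp(- tau A) f
    ([reg_pot]), and the bounds hold for it uniformly in tau. By an
    approximate identity argument, these regularizations converge uniformly to
    a function which represents f and inherits the bounds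
    ([density_regularity]). This function depends on f alone, and not on G and
    H, so that the bound passes to the infimum over all representations of
    Lf. *)

Set Implicit Arguments.
Unset Strict Implicit.
Unset Printing Implicit Defensive.

Import Order.TTheory GRing.Theory Num.Theory.
Import numFieldNormedType.Exports.

Local Open Scope classical_set_scope.
Local Open Scope ring_scope.

(** * Calculus on the line *)

Section Calculus.
Context {R : realType}.
Implicit Types (f g df : R -> R) (a b x y h z s t : R).

Lemma is_derive_continuous f (d : R) x : is_derive x 1 f d -> {for x, continuous f}.
Proof. by move=> [dfx _]; exact/differentiable_continuous/derivable1_diffP. Qed.

Lemma is_derive_addr (c : R) x : is_derive x 1 (fun t => t + c) 1.
Proof. by have := is_deriveD (is_derive_id x 1) (is_derive_cst c x 1); rewrite addr0. Qed.

Lemma is_derive_addl (c : R) x : is_derive x 1 (fun t => c + t) 1.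
Proof. by have := is_deriveD (is_derive_cst c x 1) (is_derive_id x 1); rewrite add0r. Qed.

Lemma is_derive_subl (c : R) x : is_derive x 1 (fun t => c - t) (-1).
Proof. by have := is_deriveB (is_derive_cst c x 1) (is_derive_id x 1); rewrite sub0r. Qed.

Lemma is_derive_mull (c : R) x : is_derive x 1 (fun t => c * t) c.
Proof. by have := is_deriveZ c (is_derive_id x 1); rewrite /GRing.scale /= mulr1. Qed.

Lemma is_derive_comp f g (x df dg : R) : is_derive (g x) 1 f df ->
  is_derive x 1 g dg -> is_derive x 1 (fun t => f (g t)) (df * dg).
Proof. by move=> ? ?; exact: (@is_derive1_comp _ f g). Qed.

Lemma is_derive_scale f (x c d : R) : is_derive x 1 f d -> is_derive x 1 (fun t => c * f t) (c * d).
Proof. by move=> fd; exact: is_deriveZ. Qed.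

Lemma mean_value f df a b : a <= b ->
  (forall x, a <= x <= b -> is_derive x 1 f (df x)) ->
  exists2 c, a <= c <= b & f b - f a = df c * (b - a).
Proof.
move=> ab fdf; have [||c /itvP cab e] := MVT_segment (f := f) (df := df) ab.
- by move=> x xab; apply: fdf; rewrite !ltW ?(itvP xab).
- apply: continuous_in_subspaceT => x; rewrite inE /= in_itv /= => xab.
  exact: is_derive_continuous (fdf _ xab).
- by exists c; rewrite ?cab.
Qed.

(** Stated for increments of either sign, at the price of the symmetric
    interval. *)
Lemma mean_value_abs f df x h : (forall y, is_derive y 1 f (df y)) ->
  exists2 k, `|k| <= `|h| & f (x + h) - f x = df (x + k) * h.
Proof.
move=> fdf; have [h0|h0] := leP 0 h.
  have xh : x <= x + h by lra.
  have [c xc e] := mean_value xh (fun y _ => fdf y).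
  exists (c - x); last by rewrite e addrCA subrr addr0; ring.
  by rewrite !ger0_norm //; lra.
have xh : x + h <= x by lra.
have [c xc e] := mean_value xh (fun y _ => fdf y).
exists (c - x); first by rewrite !ler0_norm //; lra.
by rewrite -opprB e addrCA subrr addr0; ring.
Qed.

Lemma taylor2_abs f df ddf x h : (forall y, is_derive y 1 f (df y)) ->
  (forall y, is_derive y 1 df (ddf y)) ->
  exists2 k, `|k| <= `|h| & `|f (x + h) - f x - h * df x| <= `|ddf (x + k)| * h ^+ 2.
Proof.
move=> fdf dfddf; have [k kh ->] := mean_value_abs x h fdf.
have [l lk] := mean_value_abs x k dfddf.
move=> e; exists l; first exact: le_trans kh.
rewrite (_ : _ - _ = h * (df (x + k) - df x)); last by ring.
rewrite e !normrM mulrCA ler_wpM2l // -[leRHS]real_normK ?num_real //.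
by rewrite expr2 ler_wpM2l.
Qed.

Lemma second_difference f df ddf x h : 0 <= h ->
  (forall y, is_derive y 1 f (df y)) -> (forall y, is_derive y 1 df (ddf y)) ->
  exists2 c, x - h <= c <= x + h & f (x + h) - 2 * f x + f (x - h) = ddf c * h ^+ 2.
Proof.
move=> h0 fdf dfddf.
have dg y : is_derive y 1 (fun t => f (t + h) - f t) (df (y + h) - df y).
  have := fdf (y + h).
  have -> : df (y + h) = df (y + h) * 1 by rewrite mulr1.
  move=> fyh; apply: is_deriveB; apply: (@is_derive1_comp _ f (fun t => t + h)).
  by apply: is_derive_eq; rewrite addr0.
have xh : x - h <= x by lra.
have [c /andP[c1 c2] e] := mean_value xh (fun y _ => dg y).
have ch : c <= c + h by lra.
have [d d12 e'] := mean_value ch (fun y _ => dfddf y).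
exists d; first by lra.
have -> : f (x + h) - 2 * f x + f (x - h) =
  f (x + h) - f x - (f (x - h + h) - f (x - h)) by rewrite subrK; ring.
by rewrite e e'; ring.
Qed.

(** Both [g - v] and [g + v] are nondecreasing. *)
Lemma variation_le (v dv g dg : R -> R) a b : a <= b ->
  (forall x, a <= x <= b -> is_derive x 1 v (dv x)) ->
  (forall x, a <= x <= b -> is_derive x 1 g (dg x)) ->
  (forall x, a <= x <= b -> `|dv x| <= dg x) ->
  `|v b - v a| <= g b - g a.
Proof.
move=> ab dv' dg' le.
have [|c cab e] := mean_value (f := g \- v) (df := fun x => dg x - dv x) ab.
  by move=> x xab; apply: is_deriveB; [exact: dg'|exact: dv'].
have [|c' cab' e'] := mean_value (f := g \+ v) (df := fun x => dg x + dv x) ab.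
  by move=> x xab; apply: is_deriveD; [exact: dg'|exact: dv'].
have := le _ cab; have := le _ cab'; rewrite !ler_norml => /andP[u1 u2] /andP[u3 u4].
move: e e' => /= e e'.
have : 0 <= (dg c - dv c) * (b - a) by rewrite mulr_ge0 // subr_ge0.
have : 0 <= (dg c' + dv c') * (b - a) by rewrite mulr_ge0 //; lra.
by rewrite -e -e' => w1 w2; apply/andP; split; lra.
Qed.

End Calculus.

(** * Exponential weights and trigonometric sums *)

Section PolyExp.
Context {R : realType}.
Implicit Types (P : {poly R}) (s y z t : R) (a p m n M : nat).

Lemma poly_growth P : exists2 Cm : R * nat, 0 < Cm.1 &
  forall y, 0 <= y -> `|P.[y]| <= Cm.1 * (1 + y) ^+ Cm.2.
Proof.
elim/poly_ind: P => [|P c [[C m] /= C0 PC]].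
  by exists (1, 0%N) => //= y y0; rewrite horner0 normr0 mulr1.
exists (C + `|c|, m.+1) => /= [|y y0]; first by rewrite ltr_wpDr.
have y1 : 1 <= (1 + y) ^+ m.+1 by rewrite exprn_ege1 // lerDl.
rewrite hornerMXaddC (le_trans (ler_normD _ _)) // mulrDl lerD //.
  rewrite normrM (ger0_norm y0) exprS mulrCA mulrC.
  by rewrite ler_pM // ?PC // lerDr.
by rewrite ler_peMr.
Qed.

Lemma exp_decay m p y : (0 < m)%N -> (0 < p)%N -> 0 <= y ->
  (1 + y) ^+ m * expR (- y ^+ p) <= 2 ^+ m * m`!%:R.
Proof.
case: m => // m _ p0 y0; rewrite expRN ler_pdivrMr ?expR_gt0 // -mulrA.
have fac1 : 1 <= (m.+1)`!%:R :> R by rewrite ler1n fact_gt0.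
have [y1|y1] := leP y 1.
  apply: le_trans (_ : 2 ^+ m.+1 <= _).
    by rewrite lerXn2r ?nnegrE; lra.
  rewrite ler_peMr ?exprn_ge0 //.
  by rewrite -[leLHS]mulr1 ler_pM // -[leLHS]expR0 ler_expR exprn_ge0.
apply: le_trans (_ : (2 * y) ^+ m.+1 <= _).
  by rewrite lerXn2r ?nnegrE; lra.
rewrite exprMn ler_wpM2l ?exprn_ge0 // mulrC -ler_pdivrMr; last by lra.
have := @expR_ge1Dxn R y m y0; set u := y ^+ m.+1 / _ => ule.
apply: (@le_trans _ _ (expR y)); first by lra.
by rewrite ler_expR ler_eXnr // ltW.
Qed.

(** With P = 'X^a, the dilates of this profile are the Fourier weights of the
    heat kernels. The profiles are stable under differentiation, which acts on
    P as [dpoly]. *)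
Definition polyexp P p y : R := P.[y] * expR (- y ^+ p).

Definition dpoly p P : {poly R} := P^`() - p%:R *: 'X^(p.-1) * P.

Lemma is_derive_polyexp P p y :
  is_derive y 1 (polyexp P p) (polyexp (dpoly p P) p y).
Proof.
have d : is_derive y 1 (fun t => expR (- t ^+ p))
    ((- (p%:R * y ^+ p.-1)) * expR (- y ^+ p)).
  rewrite mulrC; apply: (@is_derive1_comp _ expR (fun t => - t ^+ p)).
  apply: is_deriveN; have := is_derive_poly 'X^p y.
  rewrite derivXn hornerMn hornerXn -mulr_natl.
  by rewrite (_ : horner _ = fun t => t ^+ p) //; apply/funext => t; rewrite hornerXn.
have dM := is_deriveM (is_derive_poly P y) d.
rewrite (_ : polyexp P p = horner P * (fun t => expR (- t ^+ p))) //.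
apply: (@is_derive_eq _ _ _ _ _ _ _ _ dM).
rewrite /polyexp /dpoly !hornerE /= /GRing.scale /=; ring.
Qed.

Lemma polyexp_bound P p : (0 < p)%N -> exists2 C : R, 0 < C &
  forall y, 0 <= y -> `|polyexp P p y| <= C / (1 + y ^+ 2).
Proof.
move=> p0; have [[C m] /= C0 PC] := poly_growth P.
have c0 : 0 < 2 ^+ m.+2 * (m.+2)`!%:R :> R.
  by rewrite mulr_gt0 ?exprn_gt0 // ltr0n fact_gt0.
exists (C * (2 ^+ m.+2 * (m.+2)`!%:R)) => [|y y0]; first by rewrite mulr_gt0.
rewrite ler_pdivlMr; last by rewrite ltr_wpDr ?sqr_ge0.
rewrite /polyexp normrM (gtr0_norm (expR_gt0 _)).
apply: le_trans (_ : C * ((1 + y) ^+ m.+2 * expR (- y ^+ p)) <= _); last first.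
  by rewrite ler_pM2l // exp_decay.
have le2 : 1 + y ^+ 2 <= (1 + y) ^+ 2 by nra.
have {PC} := PC _ y0; rewrite -[m.+2]addn2 exprD; set u := _ ^+ m; set e := expR _.
set q := `|_| => PC; have e0 : 0 <= e by rewrite expR_ge0.
apply: (@le_trans _ _ ((1 + y ^+ 2) * (C * u * e))); last first.
  rewrite [leRHS](_ : _ = (1 + y) ^+ 2 * (C * u * e)); last by ring.
  by rewrite ler_wpM2r // mulr_ge0 // mulr_ge0 ?exprn_ge0 ?addr_ge0 // ltW.
rewrite [leLHS]mulrC ler_wpM2l ?addr_ge0 ?sqr_ge0 //.
by rewrite ler_wpM2r.
Qed.

(** By the mean value theorem, a term is at most the increment of atan over
    the step that ends there. *)
Lemma sum_lorentz s M : 0 < s ->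
  \sum_(i < M) 1 / (1 + (s * i.+1%:R) ^+ 2) <= pi / 2 / s.
Proof.
move=> s0; apply: (@le_trans _ _ (atan (s * M%:R) / s)); last first.
  by rewrite ler_wpM2r ?invr_ge0 1?ltW // atan_ltpi2.
rewrite ler_pdivlMr //; elim: M => [|M IH].
  by rewrite big_ord0 mul0r mulr0 atan0.
rewrite big_ord_recr /= mulrDl.
have le : s * M%:R <= s * M.+1%:R by rewrite ler_pM2l // ler_nat.
have [c /andP[c1 c2] e] := mean_value le (fun y _ => is_derive1_atan y).
rewrite -lerBrDl; apply: (@le_trans _ _ (atan (s * M.+1%:R) - atan (s * M%:R))).
  rewrite e -mulrBr -natrB // subSnn mulr1 ler_wpM2r ?(ltW s0) //.
  rewrite mul1r lef_pV2 ?posrE ?ltr_wpDr ?sqr_ge0 // lerD2l lerXn2r ?nnegrE //.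
    by rewrite (le_trans _ c1) // mulr_ge0 // ltW.
  by rewrite mulr_ge0 // ltW.
by rewrite lerB.
Qed.

End PolyExp.

Section Trig.
Context {R : realType}.
Implicit Types (s t y z : R) (a p m n M : nat) (b : bool).

(** The parity [b] treats sines and cosines at once: differentiation flips it,
    up to the sign [tsgn]. *)
Definition trig b t : R := if b then sin t else cos t.
Definition tsgn b : R := if b then 1 else -1.
Definition kap n : R := 2 * pi * n%:R.

Lemma trig_le1 b t : `|trig b t| <= 1.
Proof. by case: b; rewrite /= ?sin_max ?cos_max. Qed.

Lemma is_derive_trig b t : is_derive t 1 (trig b) (tsgn b * trig (~~ b) t).
Proof.
case: b; rewrite /tsgn /= ?mul1r ?mulN1r.
  exact: is_derive_sin.
exact: is_derive_cos.
Qed.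

Lemma trig_cosine b s t : trig b (s + t) + trig b (s - t) = 2 * cos t * trig b s.
Proof. by case: b; rewrite /= ?sinB ?sinD ?cosB ?cosD; ring. Qed.

Lemma kapS n : kap n.+1 = kap n + pi *+ 2.
Proof. by rewrite /kap -[n.+1%:R]natr1 mulrDr mulr1 [pi *+ 2]mulr2n; ring. Qed.

Lemma trig_periodic b n z : trig b (kap n * (z + 1)) = trig b (kap n * z).
Proof.
rewrite mulrDr mulr1; move: (kap n * z) => w.
elim: n w => [|n IH] w; first by rewrite /kap mulr0 addr0.
rewrite kapS addrA -[RHS]IH.
by case: b {IH}; rewrite /= ?sinD2pi ?cosD2pi.
Qed.

(** Summation by parts, applied twice. *)
Lemma abel_twice b (F : nat -> R) t M :
  2 * (1 - cos t) * (\sum_(i < M) F i.+1 * trig b (i.+1%:R * t)) =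
  \sum_(i < M) (2 * F i.+1 - F i - F i.+2) * trig b (i.+1%:R * t)
  + F 0%N * trig b t - F 1%N * trig b 0
  + F M.+1 * trig b (M%:R * t) - F M * trig b (M.+1%:R * t).
Proof.
elim: M => [|M IH]; first by rewrite !big_ord0 mul0r mul1r; ring.
rewrite !big_ord_recr /= mulrDr IH.
have := trig_cosine b (M.+1%:R * t) t.
have -> : M.+1%:R * t + t = M.+2%:R * t by rewrite -[M.+2%:R]natr1 mulrDl mul1r.
have -> : M.+1%:R * t - t = M%:R * t by rewrite -[M.+1%:R]natr1 mulrDl mul1r addrK.
move=> e; rewrite (_ : 2 * (1 - cos t) * (F M.+1 * _) =
  F M.+1 * (2 * trig b (M.+1%:R * t) - 2 * cos t * trig b (M.+1%:R * t))); last by ring.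
by rewrite -e; ring.
Qed.

(** A nonzero frequency occurs with both signs. *)
Definition mult n : R := if n is 0 then 1 else 2.

(** Up to a sign, the derivative of order [a] of the kernel of exp(- s |D|^p),
    or its Hilbert transform, truncated to the frequencies up to [M]. One more
    derivative increases [a] and flips the parity. *)
Definition kernel b a p s M z : R :=
  \sum_(n < M.+1) mult n * (kap n ^+ a * expR (- (s * kap n ^+ p))) * trig b (kap n * z).

(** A periodic bump at scale [s], of integral bounded above independently of
    [s]; the chordal distance |sin (pi z)| stands for the distance of z to the
    integers. *)
Definition peak s z : R := s / (s + `|sin (pi * z)|) ^+ 2.

End Trig.

(** * Concentration of the heat kernels *)

Section KernelBound.
Context {R : realType}.
Implicit Types (s t y z : R) (a p m n M : nat) (b : bool).

Lemma sin_half_angle z : 2 * (1 - cos (2 * pi * z)) = 4 * `|sin (pi * z)| ^+ 2 :> R.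
Proof.
rewrite real_normK ?num_real // (_ : 2 * pi * z = (pi * z) *+ 2).
  by rewrite cos_mulr2n sin2cos2; ring.
by rewrite mulr2n; ring.
Qed.

Lemma pi_ge1 : 1 <= pi :> R.
Proof. by have := @pi_ge2 R; lra. Qed.

Lemma kap0 : kap 0 = 0 :> R. Proof. by rewrite /kap mulr0. Qed.

Definition wt a p s n : R := kap n ^+ a * expR (- (s * kap n ^+ p)).

Lemma wt_polyexp a p s n : 0 < s ->
  wt a p (s ^+ p) n = polyexp 'X^a p (2 * pi * s * n%:R) / s ^+ a.
Proof.
move=> s0; rewrite /wt /polyexp hornerXn -exprMn (_ : 2 * pi * s * n%:R = s * kap n).
  set E := expR _; rewrite [(s * _) ^+ a]exprMn; set u := s ^+ a; set v := kap n ^+ a.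
  rewrite (_ : u * v * E = v * E * u); last by ring.
  by rewrite mulfK // expf_neq0 // gt_eqF.
by rewrite /kap; ring.
Qed.

Lemma kernel_split b a p s M z : kernel b a p s M z =
  wt a p s 0 * trig b 0 + 2 * \sum_(i < M) wt a p s i.+1 * trig b (i.+1%:R * (2 * pi * z)).
Proof.
rewrite /kernel big_ord_recl /= kap0 mul0r mul1r; congr (_ + _).
  by rewrite /wt kap0.
rewrite big_distrr; apply: eq_bigr => i _; rewrite /bump /= add1n -mulrA.
by congr (2 * (_ * trig b _)); rewrite /kap; ring.
Qed.

(** After rescaling, the weights are samples of an integrable profile at step
    [2 pi s], so that their sum is of order [1 / s]. *)
Lemma kernel_sup a p : (0 < p)%N -> exists2 C : R, 0 < C &
  forall b s M z, 0 < s -> `|kernel b a p (s ^+ p) M z| <= (a == 0)%:R + C / s ^+ a.+1.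
Proof.
move=> p0; have [C C0 PC] := polyexp_bound ('X^a : {poly R}) p0.
have pi0 := @pi_gt0 R.
exists C => // b s M z s0; rewrite kernel_split.
have sa0 : 0 < s ^+ a by rewrite exprn_gt0.
rewrite (le_trans (ler_normD _ _)) // lerD //.
  rewrite /wt kap0 !normrM normrX normr0 expr0n -mulrA ler_piMr //.
  rewrite mulr_ile1 ?normr_ge0 // ?trig_le1 // ger0_norm ?expR_ge0 //.
  by rewrite -expR0 ler_expR oppr_le0 mulr_ge0 ?exprn_ge0 ?(ltW s0).
rewrite normrM (@ger0_norm _ 2) //.
apply: (@le_trans _ _ (2 * (C / s ^+ a * \sum_(i < M) 1 / (1 + (2 * pi * s * i.+1%:R) ^+ 2)))).
  rewrite ler_pM2l // (le_trans (ler_norm_sum _ _ _)) // mulr_sumr ler_sum // => i _.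
  rewrite normrM -[leRHS]mulr1 ler_pM ?trig_le1 // wt_polyexp // normrM mul1r.
  rewrite [leRHS]mulrAC normfV (gtr0_norm sa0) ler_wpM2r ?invr_ge0 ?(ltW sa0) // PC //.
  by rewrite !mulr_ge0 // ltW.
have s20 : 0 < 2 * pi * s by rewrite !mulr_gt0.
have := sum_lorentz M s20; set S := \sum_(i < M) _ => lS.
apply: (@le_trans _ _ (2 * (C / s ^+ a * (pi / 2 / (2 * pi * s))))).
  by rewrite ler_pM2l // ler_pM2l // divr_gt0.
rewrite exprS; set w := s ^+ a.
have w0 : w != 0 by rewrite gt_eqF.
have s00 : s != 0 by rewrite gt_eqF.
have pi00 : pi != 0 :> R by rewrite gt_eqF.
rewrite [leRHS](_ : _ = C / w / s); last by field; rewrite ?w0 ?s00.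
rewrite [leLHS](_ : _ = (C / w / s) * 2^-1); last first.
  move: (pi : R) pi00 => q q00; field; by rewrite w0 s00 q00.
by rewrite ler_piMr ?invf_le1 ?ler1n // !divr_ge0 // ltW.
Qed.

(** Two summations by parts gain the factor 1 - cos (2 pi z), and the second
    differences of the weights are second derivatives of the profile times the
    square of the step. The truncation leaves boundary terms, which are small
    as the profile has decayed when M s^2 >= 1. For sines, the boundary term
    at the origin vanishes because a > 0. *)
Lemma kernel_decay a p : (0 < p)%N -> exists2 C : R, 0 < C &
  forall b s M z, (b -> (0 < a)%N) -> 0 < s -> s <= 1 -> 1 <= M%:R * s ^+ 2 ->
  4 * `|sin (pi * z)| ^+ 2 * `|kernel b a p (s ^+ p) M z| <= C * s / s ^+ a.
Proof.
move=> p0; pose P : {poly R} := 'X^a.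
have [C0 C00 PC0] := polyexp_bound P p0.
have [C1 C10 PC1] := polyexp_bound (dpoly p P) p0.
have [C2 C20 PC2] := polyexp_bound (dpoly p (dpoly p P)) p0.
have pi0 := @pi_gt0 R; have pi1 := pi_ge1.
pose q : R := 2 * pi.
have q1 : 1 <= q by rewrite /q; lra.
have q0 : 0 < q by lra.
exists (2 * (C1 * q + C2 * (q ^+ 2 + q * pi / 2) + 2 * C0)).
  have h1 : 0 < C1 * q by rewrite mulr_gt0.
  have h2 : 0 < q ^+ 2 + q * pi / 2.
    by rewrite addr_gt0 ?exprn_gt0 // divr_gt0 // mulr_gt0.
  have h3 : 0 < C2 * (q ^+ 2 + q * pi / 2) by rewrite mulr_gt0.
  by rewrite mulr_gt0 //; lra.
move=> b s M z ba s0 s1 Ms; rewrite -sin_half_angle.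
have sa0 : 0 < s ^+ a by rewrite exprn_gt0.
have M0 : (0 < M)%N by rewrite lt0n; apply/eqP => M0; move: Ms; rewrite M0 mul0r; lra.
set t := 2 * pi * z; set F := wt a p (s ^+ p).
have qs0 : 0 < q * s by rewrite mulr_gt0.
have FE n : F n = polyexp P p (q * s * n%:R) / s ^+ a by rewrite /F wt_polyexp.
have tail n : (M <= n)%N -> `|F n| <= C0 * s / s ^+ a.
  move=> Mn; rewrite FE normrM normfV (gtr0_norm sa0) ler_wpM2r ?invr_ge0 ?(ltW sa0) //.
  have y0 : 0 <= q * s * n%:R by rewrite !mulr_ge0 // ltW.
  rewrite (le_trans (PC0 _ y0)) // ler_wpM2l ?(ltW C00) //.
  rewrite invf_ple ?posrE // ?ltr_wpDr ?sqr_ge0 //.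
  have : s^-1 <= q * s * n%:R.
    rewrite -[leLHS]mul1r ler_pdivrMr //.
    have : M%:R * s ^+ 2 <= n%:R * s ^+ 2 by rewrite ler_wpM2r ?sqr_ge0 // ler_nat.
    set u := n%:R * s ^+ 2 => lu.
    rewrite (_ : q * s * n%:R * s = q * u); last by rewrite /u; ring.
    by apply: (le_trans Ms); rewrite (le_trans lu) // ler_peMl // (le_trans _ lu) // mulr_ge0 ?sqr_ge0.
  by set y := q * s * n%:R => ?; nra.
have first : `|F 0%N - F 1%N| <= C1 * q * s / s ^+ a.
  rewrite !FE mulr0 mulr1 -mulrBl normrM normfV (gtr0_norm sa0).
  rewrite ler_wpM2r ?invr_ge0 ?(ltW sa0) // distrC.
  have [c /andP[c0 _] ->] := mean_value (ltW qs0) (fun y _ => is_derive_polyexp P p y).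
  rewrite subr0 normrM (gtr0_norm qs0) -mulrA ler_wpM2r ?(ltW qs0) //.
  rewrite (le_trans (PC1 _ c0)) // ler_piMr ?(ltW C10) //.
  by rewrite invf_le1 ?lerDl ?ltr_wpDr ?sqr_ge0.
have mid i : `|2 * F i.+1 - F i - F i.+2| <=
    C2 * (q * s) ^+ 2 / s ^+ a * (1 / (1 + (q * s * i%:R) ^+ 2)).
  have [c /andP[c1 _] e] := second_difference (q * s * i.+1%:R) (ltW qs0)
    (is_derive_polyexp P p) (is_derive_polyexp (dpoly p P) p).
  have -> : 2 * F i.+1 - F i - F i.+2 =
      - (polyexp (dpoly p (dpoly p P)) p c * (q * s) ^+ 2 / s ^+ a).
    rewrite -e !FE -[i.+2%:R]natr1 mulrDr mulr1.
    rewrite (_ : q * s * i.+1%:R - q * s = q * s * i%:R); first by ring.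
    by rewrite -natr1; ring.
  have ci : q * s * i%:R <= c.
    by move: c1; rewrite -[i.+1%:R]natr1 mulrDr mulr1 addrK.
  have i0 : 0 <= q * s * i%:R by rewrite mulr_ge0 // ltW.
  have qs20 : 0 < (q * s) ^+ 2 by rewrite exprn_gt0.
  rewrite normrN normrM [`|_ * (q * s) ^+ 2|]normrM normfV (gtr0_norm sa0) (gtr0_norm qs20).
  rewrite [leRHS](_ : _ = C2 * (1 / (1 + (q * s * i%:R) ^+ 2)) * (q * s) ^+ 2 / s ^+ a); last by ring.
  rewrite !ler_wpM2r ?invr_ge0 ?sqr_ge0 ?(ltW sa0) //.
  rewrite (le_trans (PC2 _ (le_trans i0 ci))) // ler_wpM2l ?(ltW C20) // mul1r.
  by rewrite lef_pV2 ?posrE ?ltr_wpDr ?sqr_ge0 // lerD2l lerXn2r ?nnegrE // (le_trans i0).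
have sum : \sum_(i < M) `|2 * F i.+1 - F i - F i.+2| <=
    C2 * (q ^+ 2 + q * pi / 2) * s / s ^+ a.
  apply: (@le_trans _ _ (C2 * (q * s) ^+ 2 / s ^+ a * (1 + pi / 2 / (q * s)))).
    apply: (@le_trans _ _ (\sum_(i < M) C2 * (q * s) ^+ 2 / s ^+ a *
        (1 / (1 + (q * s * i%:R) ^+ 2)))); first by apply: ler_sum.
    rewrite -mulr_sumr.
    have k0 : 0 <= C2 * (q * s) ^+ 2 / s ^+ a.
      by rewrite divr_ge0 ?(ltW sa0) // mulr_ge0 ?sqr_ge0 // ltW.
    rewrite ler_wpM2l //; case: (M) M0 => // m _.
    rewrite big_ord_recl /= mulr0 expr0n addr0 divr1 lerD2l.
    exact: sum_lorentz.
  rewrite [leLHS](_ : _ = C2 / s ^+ a * ((q * s) ^+ 2 * (1 + pi / 2 / (q * s)))); last by ring.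
  rewrite [leRHS](_ : _ = C2 / s ^+ a * ((q ^+ 2 + q * pi / 2) * s)); last by ring.
  rewrite ler_pM2l ?divr_gt0 //.
  have -> : (q * s) ^+ 2 * (1 + pi / 2 / (q * s)) = q ^+ 2 * s ^+ 2 + q * pi / 2 * s.
    move: (q) q0 (pi : R) => r r0 w; field.
    by rewrite !gt_eqF.
  rewrite mulrDl lerD2r ler_wpM2l ?sqr_ge0 //.
  by rewrite expr2 ler_piMr // ltW.
have -> : 2 * (1 - cos t) * `|kernel b a p (s ^+ p) M z| =
    `|2 * (1 - cos t) * kernel b a p (s ^+ p) M z|.
  by rewrite normrM ger0_norm // mulr_ge0 // subr_ge0 cos_le1.
rewrite kernel_split -/F -/t mulrDr [2 * (1 - cos t) * (2 * _)]mulrCA abel_twice.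
set S := \sum_(i < M) _.
have -> : 2 * (1 - cos t) * (F 0%N * trig b 0) +
   2 * (S + F 0%N * trig b t - F 1%N * trig b 0 + F M.+1 * trig b (M%:R * t)
        - F M * trig b (M.+1%:R * t)) =
   2 * ((F 0%N - F 1%N) * trig b 0 + S + F M.+1 * trig b (M%:R * t)
        - F M * trig b (M.+1%:R * t)).
  have F0 : 2 * (1 - cos t) * (F 0%N * trig b 0) + 2 * (F 0%N * trig b t) = 2 * (F 0%N * trig b 0).
    case: b ba @S => ba S /=; last first.
      by rewrite cos0 !mulr1; move: (cos t) (F 0%N) => c f; ring.
    by rewrite /F /wt kap0 expr0n gtn_eqF ?ba // !(mul0r, mulr0) addr0.
  move: F0; move: (2 * (1 - cos t) * (F 0%N * trig b 0)) => u.
  move: (trig b 0) (trig b t) (trig b (M%:R * t)) (trig b (M.+1%:R * t)) S => c0 c c1 c2 S.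
  by move: (F 0%N) (F 1%N) (F M) (F M.+1) => f0 f1 f2 f3; lra.
have lS : `|S| <= C2 * (q ^+ 2 + q * pi / 2) * s / s ^+ a.
  rewrite (le_trans _ sum) // (le_trans (ler_norm_sum _ _ _)) // ler_sum // => i _.
  by rewrite normrM ler_piMr // trig_le1.
move: lS {sum}; move: (q ^+ 2 + q * pi / 2) => Q lS.
rewrite [leRHS](_ : _ = 2 * (C1 * q * s / s ^+ a + C2 * Q * s / s ^+ a
   + C0 * s / s ^+ a + C0 * s / s ^+ a)); last by ring.
rewrite normrM (@ger0_norm _ 2) // ler_pM2l //.
have tr x y c : `|x| <= c -> `|x * trig b y| <= c.
  by move=> xc; rewrite normrM (le_trans _ xc) // ler_piMr // trig_le1.
rewrite (le_trans (ler_normB _ _)) // lerD ?tr ?tail //.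
rewrite (le_trans (ler_normD _ _)) // lerD ?tr ?tail //.
by rewrite (le_trans (ler_normD _ _)) // lerD ?tr.
Qed.

Lemma peak_ge0 s z : 0 < s -> 0 <= peak s z.
Proof. by move=> s0; rewrite divr_ge0 ?sqr_ge0 // ltW. Qed.

(** Within distance [s] of the integers the uniform bound is the better one,
    and beyond it the quadratic decay. *)
Lemma kernel_peak a p : (0 < p)%N -> exists2 C : R, 0 < C &
  forall b s M z, (b -> (0 < a)%N) -> 0 < s -> (0 < a)%N || (s <= 1) ->
  1 <= M%:R * s ^+ 2 ->
  `|kernel b a p (s ^+ p) M z| <= C / s ^+ a * peak s z.
Proof.
move=> p0; have [A A0 PA] := kernel_sup a p0; have [B B0 PB] := kernel_decay a p0.
exists (2 * (A + 1) + 4 * (A + 1) + B); first by lra.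
move=> b s M z ba s0 as1 Ms; rewrite /peak.
have sa0 : 0 < s ^+ a by rewrite exprn_gt0.
set x := `|sin _|; have x0 : 0 <= x by exact: normr_ge0.
have x1 : x <= 1 by exact: sin_max.
rewrite mulrA ler_pdivlMr ?exprn_gt0 ?ltr_wpDr //.
set K := `|_|; have K0 : 0 <= K by exact: normr_ge0.
set e := s / s ^+ a; have e0 : 0 < e by rewrite divr_gt0.
have KA : K * s ^+ 2 <= (A + 1) * e.
  have := PA b s M z s0; rewrite -/K => le.
  apply: (@le_trans _ _ (((a == 0)%:R + A / s ^+ a.+1) * s ^+ 2)).
    by rewrite ler_wpM2r // sqr_ge0.
  rewrite exprS mulrDl (_ : A / _ * _ = A * e); last first.
    by rewrite /e; field; rewrite !gt_eqF.
  rewrite addrC mulrDl lerD2l; case: eqP => [a0|_]; last by rewrite mul0r mul1r ltW.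
  move: as1; rewrite a0 /= => s1.
  by rewrite !mul1r /e a0 expr0 divr1 expr2 ler_piMr // ltW.
have KB : 4 * (K * x ^+ 2) <= (B + 4 * (A + 1)) * e.
  have [s1|s1] := leP s 1.
    have := PB b s M z ba s0 s1 Ms; rewrite -/K -/x -mulrA => le.
    rewrite [K * _]mulrC (le_trans le) // -mulrA -/e ler_wpM2r ?(ltW e0) //.
    by rewrite lerDl mulr_ge0 // addr_ge0 // ltW.
  have x21 : x ^+ 2 <= 1 by rewrite expr_le1.
  have s21 : 1 <= s ^+ 2 by rewrite exprn_ege1 // ltW.
  have : K * x ^+ 2 <= K * s ^+ 2 by rewrite ler_wpM2l // (le_trans x21).
  by nra.
have -> : (2 * (A + 1) + 4 * (A + 1) + B) / s ^+ a * s = (2 * (A + 1) + 4 * (A + 1) + B) * e.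
  by rewrite /e; ring.
have : K * (s + x) ^+ 2 <= 2 * (K * s ^+ 2) + 2 * (K * x ^+ 2).
  rewrite (_ : 2 * _ + _ = K * (2 * (s ^+ 2 + x ^+ 2))); last by ring.
  rewrite ler_wpM2l // -subr_ge0 (_ : _ - _ = (s - x) ^+ 2) ?sqr_ge0 //.
  by ring.
have Ae : 0 < A * e by rewrite mulr_gt0.
have Be : 0 < B * e by rewrite mulr_gt0.
lra.
Qed.

End KernelBound.

(** * Continuity and integration over the cell *)

Section Continuity.
Context {R : realType} {T : topologicalType}.
Implicit Types (f g : T -> R).

Lemma continuous_pair f g : continuous f -> continuous g ->
  continuous (fun x => (f x, g x)).
Proof.
move=> cf cg x.
apply: (@cvg_pair _ _ _ _ (nbhs (f x)) (nbhs (g x)) _ _ _ f g); [exact: cf|exact: cg].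
Qed.

Lemma continuous_compose (U : topologicalType) (h : T -> U) (k : U -> R) :
  continuous k -> continuous h -> continuous (fun x => k (h x)).
Proof. by move=> ck ch x; apply: (@continuous_comp _ _ _ h k); [exact: ch|exact: ck]. Qed.

Lemma continuous_add f g : continuous f -> continuous g -> continuous (fun x => f x + g x).
Proof. by move=> cf cg x; apply: cvgD; [exact: cf|exact: cg]. Qed.

Lemma continuous_opp f : continuous f -> continuous (fun x => - f x).
Proof. by move=> cf x; apply: cvgN; exact: cf. Qed.

Lemma continuous_mul f g : continuous f -> continuous g -> continuous (fun x => f x * g x).
Proof. by move=> cf cg x; apply: cvgM; [exact: cf|exact: cg]. Qed.

Lemma continuous_const (a : R) : continuous (fun _ : T => a).
Proof. by move=> x; exact: cvg_cst. Qed.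

Lemma continuous_abs f : continuous f -> continuous (fun x => `|f x|).
Proof. by move=> cf x; apply: cvg_norm; exact: cf. Qed.

Lemma continuous_bigsum (I : Type) (r : seq I) (P : pred I) (F : I -> T -> R) :
  (forall i, continuous (F i)) -> continuous (fun x => \sum_(i <- r | P i) F i x).
Proof.
move=> cF; elim: r => [|i r IH].
  by under eq_fun do rewrite big_nil; exact: continuous_const.
under eq_fun do rewrite big_cons.
by case: (P i) => //; apply: continuous_add.
Qed.

End Continuity.

Lemma continuous_identity (T : topologicalType) : continuous (fun x : T => x).
Proof. by move=> x; exact: cvg_id. Qed.

Lemma continuous_proj1 (R : realType) : continuous (fun x : R * R => x.1).
Proof. by move=> x; exact: cvg_fst. Qed.

Lemma continuous_proj2 (R : realType) : continuous (fun x : R * R => x.2).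
Proof. by move=> x; exact: cvg_snd. Qed.

Lemma continuous_trig (R : realType) b : continuous (@trig R b).
Proof. by move=> t; exact: is_derive_continuous (is_derive_trig b t). Qed.

(** Proves the continuity of explicit expressions from that of the functions
    which occur in them. *)
Ltac continuity :=
  lazymatch goal with
  | |- continuous (fun x => @GRing.add _ (@?f x) (@?g x)) =>
      apply: (@continuous_add _ _ f g); continuity
  | |- continuous (fun x => @GRing.mul _ (@?f x) (@?g x)) =>
      apply: (@continuous_mul _ _ f g); continuity
  | |- continuous (fun x => @GRing.opp _ (@?f x)) =>
      apply: (@continuous_opp _ _ f); continuity
  | |- continuous (fun x => trig ?b (@?f x)) =>
      apply: (@continuous_compose _ _ _ f (trig b) (@continuous_trig _ b)); continuity
  | |- continuous (fun x => pair (@?f x) (@?g x)) =>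
      apply: (@continuous_pair _ _ f g); continuity
  | _ => first
    [ assumption
    | match goal with H : continuous ?f |- continuous (fun x => ?f (@?g x)) =>
        apply: (@continuous_compose _ _ _ g f H); continuity end
    | apply: continuous_proj1 | apply: continuous_proj2
    | apply: continuous_identity | apply: continuous_const
    | apply: continuous_pair; continuity
    | apply: continuous_abs; continuity
    | apply: continuous_bigsum => ?; continuity
    | apply: continuous_add; continuity
    | apply: continuous_mul; continuity
    | apply: (continuous_compose (@continuous_sin _)); continuity
    | match goal with H : continuous ?f |- continuous _ =>
        apply: (continuous_compose H); continuity end
    | idtac ]
  end.

Section Integral.
Context {R : realType}.
Notation mu := (@lebesgue_measure R).
Implicit Types (u v w : R * R -> R) (f g F : R -> R) (s t : R).

(** The squares with rational centers and radii form a countable base of the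
    plane. *)
Lemma open_measurable_prod (A : set (R * R)) : open A -> measurable A.
Proof.
move=> oA; pose box (q : rat * rat * rat) : set (R * R) :=
  `](ratr q.1.1 - ratr q.2), (ratr q.1.1 + ratr q.2)[ `*`
  `](ratr q.1.2 - ratr q.2), (ratr q.1.2 + ratr q.2)[.
rewrite (_ : A = \bigcup_(q in [set q | box q `<=` A]) box q); last first.
  apply/seteqP; split => [x Ax|x [q qA]]; last exact: qA.
  have /nbhs_ballP[e /= e0 eA] : nbhs x A by apply: open_nbhs_nbhs; split.
  have e40 : 0 < e / 4 by rewrite divr_gt0.
  have [r /itvP rr] := @rat_in_itvoo R _ _ e40.
  have r0 : 0 < ratr r :> R by rewrite rr.
  have re : ratr r < e / 4 by rewrite rr.
  have lt (z : R) : z - ratr r < z + ratr r by lra.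
  have [a /itvP ar] := rat_in_itvoo (lt x.1).
  have [b /itvP br] := rat_in_itvoo (lt x.2).
  have a1 : x.1 - ratr r < ratr a by rewrite ar.
  have a2 : ratr a < x.1 + ratr r by rewrite ar.
  have b1 : x.2 - ratr r < ratr b by rewrite br.
  have b2 : ratr b < x.2 + ratr r by rewrite br.
  exists (a, b, r); last first.
    by rewrite /box /= !in_itv /=; split; apply/andP; split; lra.
  move=> z [] /=; rewrite !in_itv /= => /andP[z1 z2] /andP[z3 z4]; apply: eA.
  by split; rewrite /ball /= ltr_norml; apply/andP; split; lra.
rewrite bigcup_mkcond; apply: countable_bigcupT_measurable => [|q]; first exact: countableP.
by case: ifPn => // _; apply: measurableX.
Qed.

Lemma continuous_measurable_prod u : continuous u -> measurable_fun setT u.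
Proof.
move=> cu; apply: (measurability _ (measurable_realfun.RGenOpens.measurableE R)).
move=> _ [_ [a [b ->] <-]]; rewrite setTI; apply: open_measurable_prod.
by apply: open_comp => [x _|]; [exact: cu|exact: interval_open].
Qed.

Lemma measurable_cell : measurable (@cell R).
Proof. exact: measurableX. Qed.

Lemma measure_cell : (mu \x mu)%E (@cell R) = 1%E.
Proof.
have m1 : mu `[0%R, 1%R[ = 1%E.
  by rewrite lebesgue_measure_itv /= lte_fin ltr01 oppr0 adde0.
apply: etrans (product_measure1E _ _ _ _) _ => //.
by rewrite -[RHS]mule1; congr (_ * _)%E; exact: m1.
Qed.

Lemma continuous_bounded_cell u : continuous u ->
  exists M : R, forall x, cell x -> `|u x| <= M.
Proof.
move=> cu; pose K : set (R * R) := `[0, 1] `*` `[0, 1].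
have cK : compact K by apply: compact_setX; exact: segment_compact.
have : compact (u @` K).
  by apply: continuous_compact => //; exact: continuous_subspaceT.
move=> /compact_bounded [M [_ MP]]; exists (M + 1) => x [x1 x2].
apply: (MP (M + 1)); first by rewrite ltrDl.
exists x => //; split; rewrite /= in_itv /=.
  by move: x1; rewrite /= in_itv /= => /andP[-> /ltW ->].
by move: x2; rewrite /= in_itv /= => /andP[-> /ltW ->].
Qed.

Lemma continuous_integrable_cell u : continuous u ->
  (mu \x mu)%E.-integrable cell (EFin \o u).
Proof.
move=> cu; apply: measurable_bounded_integrable.
- exact: measurable_cell.
- by rewrite [X in (X < _)%E]measure_cell ltry.
- exact: measurable_funTS (continuous_measurable_prod cu).
have [M MP] := continuous_bounded_cell cu.
exists M; split; first exact: num_real.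
by move=> N MN x Cx; apply: le_trans (MP _ Cx) (ltW MN).
Qed.

Definition I1 f : R := \int[mu]_(t in `[0, 1[) f t.
Definition I2 u : R := \int[(mu \x mu)%E]_(x in cell) u x.

Lemma continuous_integrable01 f : continuous f -> mu.-integrable `[0, 1[ (EFin \o f).
Proof.
move=> cf; apply: (@integrableS _ _ _ mu `[0, 1]) => //.
  by apply: subset_itv => //; rewrite bnd_simp.
apply: continuous_compact_integrable; first exact: segment_compact.
exact: continuous_subspaceT.
Qed.

Lemma I2_linear (a : R) u v : continuous u -> continuous v ->
  I2 (fun x => a * u x + v x) = a * I2 u + I2 v.
Proof.
move=> cu cv; have mC := measurable_cell.
have iu := continuous_integrable_cell cu; have iv := continuous_integrable_cell cv.
rewrite /I2 RintegralD //; first by rewrite RintegralZl.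
rewrite (_ : _ \o _ = fun x => (a%:E * (EFin \o u) x)%E); last by apply/funext => x.
exact: integrableZl.
Qed.

Lemma I2_le u v : continuous u -> continuous v ->
  (forall x, cell x -> u x <= v x) -> I2 u <= I2 v.
Proof.
move=> cu cv uv; apply: le_Rintegral => //; first exact: measurable_cell.
- exact: continuous_integrable_cell.
- exact: continuous_integrable_cell.
Qed.

Lemma I2_cst (a : R) : I2 (fun=> a) = a.
Proof.
rewrite /I2 Rintegral_cst; last exact: measurable_cell.
by rewrite [X in fine X]measure_cell mulr1.
Qed.

Lemma I2_iterated u : continuous u ->
  I2 u = I1 (fun s => I1 (fun t => u (s, t))) /\
  I2 u = I1 (fun t => I1 (fun s => u (s, t))).
Proof.
move=> cu; have iu := continuous_integrable_cell cu.
have mC := measurable_cell.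
have iC : (mu \x mu)%E.-integrable setT ((EFin \o u) \_ cell).
  apply: (iffLR (integrable_restrict (mu \x mu)%E mC measurableT (EFin \o u))).
  by rewrite setTI.
have c1 s t : (EFin \o u) \_ cell (s, t) =
    (if s \in `[0%R, 1%R[ then ((fun t => (u (s, t))%:E) \_ `[0%R, 1%R[) t else 0%E).
  rewrite !patchE /cell in_setX; case: ifPn => //=.
    by move=> /andP[]; rewrite !mem_setE => -> ->.
  by rewrite !mem_setE; do 2 case: ifPn => //=.
have c2 s t : (EFin \o u) \_ cell (s, t) =
    (if t \in `[0%R, 1%R[ then ((fun s => (u (s, t))%:E) \_ `[0%R, 1%R[) s else 0%E).
  rewrite !patchE /cell in_setX; case: ifPn => //=.
    by move=> /andP[]; rewrite !mem_setE => -> ->.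
  by rewrite !mem_setE; do 2 case: ifPn => //=.
have pairc1 (s : R) : continuous (fun t : R => u (s, t)) by continuity.
have pairc2 (t : R) : continuous (fun s : R => u (s, t)) by continuity.
split.
- rewrite /I2 /Rintegral integral_mkcond -(integral12_prod_meas1 iC) /I1.
  rewrite /Rintegral; congr fine; rewrite [RHS]integral_mkcond.
  apply: eq_integral => s _; rewrite /fubini_F patchE mem_setE.
  under eq_integral => t _ do rewrite c1.
  case: ifPn => _; last exact: integral0.
  rewrite -integral_mkcond /Rintegral fineK //.
  by apply: integrable_fin_num => //; exact: continuous_integrable01.
- rewrite /I2 /Rintegral integral_mkcond -(integral21_prod_meas1 iC) /I1.
  rewrite /Rintegral; congr fine; rewrite [RHS]integral_mkcond.
  apply: eq_integral => s _; rewrite /fubini_G patchE mem_setE.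
  under eq_integral => t _ do rewrite c2.
  case: ifPn => _; last exact: integral0.
  rewrite -integral_mkcond /Rintegral fineK //.
  by apply: integrable_fin_num => //; exact: continuous_integrable01.
Qed.

(** The primitives used below involve powers which are singular outside a
    neighborhood of [0, 1]. *)
Definition continuous01 f := forall t, 0 <= t <= 1 -> {for t, continuous f}.

Lemma continuous01_within f : continuous01 f -> {within `[0, 1], continuous f}.
Proof.
move=> cf; apply: continuous_in_subspaceT => t; rewrite inE /= in_itv /=.
exact: cf.
Qed.

Lemma continuous01_integrable f : continuous01 f -> mu.-integrable `[0, 1[ (EFin \o f).
Proof.
move=> cf; apply: (@integrableS _ _ _ mu `[0, 1]) => //.
  by apply: subset_itv => //; rewrite bnd_simp.
apply: continuous_compact_integrable; first exact: segment_compact.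
exact: continuous01_within.
Qed.

Lemma I1_FTC f F : continuous01 f ->
  (forall t, 0 <= t <= 1 -> is_derive t 1 F (f t)) -> I1 f = F 1 - F 0.
Proof.
move=> cf dF; rewrite /I1 Rintegral_itv_bndo_bndc; last exact: continuous01_integrable.
have cF t : 0 <= t <= 1 -> {for t, continuous F}.
  by move=> t01; apply: is_derive_continuous (dF t t01).
have oc t : t \in `]0, 1[ -> 0 <= t <= 1 by move=> /itvP t01; rewrite !ltW ?t01.
rewrite /Rintegral (@continuous_FTC2 _ f F) //.
- exact: continuous01_within.
- split; first by move=> t t01; case: (dF t (oc _ t01)).
  + by apply: cvg_at_right_filter (cF _ _); rewrite lexx ler01.
  + by apply: cvg_at_left_filter (cF _ _); rewrite lexx ler01.
- by move=> t t01; rewrite derive1E; have df := dF t (oc _ t01); exact: derive_val.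
Qed.

Lemma I1_linear (a : R) f g : continuous f -> continuous g ->
  I1 (fun x => a * f x + g x) = a * I1 f + I1 g.
Proof.
move=> cu cv.
have iu := continuous_integrable01 cu; have iv := continuous_integrable01 cv.
rewrite /I1 RintegralD //; first by rewrite RintegralZl.
rewrite (_ : _ \o _ = fun x => (a%:E * (EFin \o f) x)%E); last by apply/funext => x.
exact: integrableZl.
Qed.

Lemma I1_le f g : continuous01 f -> continuous01 g ->
  (forall x, 0 <= x < 1 -> f x <= g x) -> I1 f <= I1 g.
Proof.
move=> cu cv uv; apply: le_Rintegral => //.
- exact: continuous01_integrable.
- exact: continuous01_integrable.
Qed.

Lemma I1Z (a : R) f : continuous f -> I1 (fun x => a * f x) = a * I1 f.
Proof. by move=> cf; rewrite /I1 RintegralZl //; exact: continuous_integrable01. Qed.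

Lemma I2_tensor f g : continuous f -> continuous g ->
  I2 (fun x => f x.1 * g x.2) = I1 f * I1 g.
Proof.
move=> cf cg; have cfg : continuous (fun x : R * R => f x.1 * g x.2) by continuity.
have [-> _] := I2_iterated cfg.
rewrite (_ : (fun s => _) = fun s => I1 g * f s); first by rewrite I1Z // mulrC.
by apply/funext => s /=; rewrite I1Z // mulrC.
Qed.

End Integral.

(** * Periodic integrals and kernels of mean zero *)

Section PeriodicIntegrals.
Context {R : realType}.
Notation mu := (@lebesgue_measure R).
Implicit Types (u v w G : R * R -> R) (f g F phi psi : R -> R) (s t z beta N : R).
Implicit Types (a p m n M : nat) (b : bool).

Lemma is_derive_congr f (x d d' : R) : is_derive x 1 f d -> d = d' -> is_derive x 1 f d'.
Proof. by move=> ? <-. Qed.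

Lemma powR_add (x r s : R) : 0 < x -> x `^ (r + s) = x `^ r * x `^ s.
Proof. by move=> x0; rewrite powRD // (gt_eqF x0) implybT. Qed.

Lemma I2Z (a : R) u : continuous u -> I2 (fun y => a * u y) = a * I2 u.
Proof.
move=> cu; rewrite /I2 RintegralZl //; first exact: measurable_cell.
exact: continuous_integrable_cell.
Qed.

Lemma I2_sum (I : Type) (r : seq I) (P : pred I) (c : I -> R) (u : I -> R * R -> R) :
  (forall i, continuous (u i)) ->
  I2 (fun x => \sum_(i <- r | P i) c i * u i x) = \sum_(i <- r | P i) c i * I2 (u i).
Proof.
move=> cu; elim: r => [|i r IH].
  by rewrite big_nil; under eq_fun do rewrite big_nil; rewrite I2_cst.
rewrite big_cons; under eq_fun do rewrite big_cons.
by case: (P i) => //; rewrite I2_linear ?IH //; continuity.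
Qed.

Lemma I1_cst (c : R) : I1 (fun=> c) = c.
Proof.
apply: etrans (@I1_FTC _ _ (fun t => c * t) _ _) _ => [t _|t _|]; last by ring.
  exact: continuous_const.
exact: is_derive_mull.
Qed.

Lemma I1_sum (I : Type) (r : seq I) (P : pred I) (c : I -> R) (f : I -> R -> R) :
  (forall i, continuous (f i)) ->
  I1 (fun x => \sum_(i <- r | P i) c i * f i x) = \sum_(i <- r | P i) c i * I1 (f i).
Proof.
move=> cu; elim: r => [|i r IH].
  by rewrite big_nil; under eq_fun do rewrite big_nil; rewrite I1_cst.
rewrite big_cons; under eq_fun do rewrite big_cons.
by case: (P i) => //; rewrite I1_linear ?IH //; continuity.
Qed.

Lemma antiderivative f (N : R) : continuous f ->
  exists F, forall t, - N < t < N -> is_derive t 1 F (f t).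
Proof.
move=> cf; exists (fun x => \int[mu]_(t in `[(- N), x]) f t)%R => t /andP[t1 t2].
have i : mu.-integrable `[- N, N] (EFin \o f).
  apply: continuous_compact_integrable; first exact: segment_compact.
  exact: continuous_subspaceT.
have [d e] := continuous_FTC1_closed t2 i t1 (cf t).
by rewrite derive1E in e; exact: DeriveDef d e.
Qed.

(** The integral of a 1-periodic function over any period, run through
    backwards. *)
Lemma I1_shift f z : continuous f -> (forall t, f (t + 1) = f t) ->
  I1 (fun t => f (z - t)) = I1 f.
Proof.
move=> cf pf; pose N : R := `|z| + 3.
have [F dF] := antiderivative N cf.
have zN : - `|z| <= z <= `|z| by rewrite -ler_norml.
have [zN1 zN2] : - `|z| <= z /\ z <= `|z| by apply/andP.
have nz : 0 <= `|z| by [].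
have dF' t : - N < t < N -> is_derive t 1 F (f t) by exact: dF.
have dS t c : - N < t + c < N -> is_derive t 1 (fun t => F (t + c)) (f (t + c)).
  move=> tc; rewrite -[f _]mulr1; apply: is_derive_comp (is_derive_addr _ _).
  exact: dF'.
have -> : I1 (fun t => f (z - t)) = - F (z - 1) - - F (z - 0).
  apply: (@I1_FTC _ _ (fun t => - F (z - t))).
    by move=> t _; move: t; apply: continuous_compose => //; continuity.
  move=> t /andP[t0 t1].
  rewrite -[f _]opprK; apply: is_deriveN.
  rewrite -mulrN1; apply: is_derive_comp (is_derive_subl _ _).
  by apply: dF'; rewrite /N; apply/andP; split; lra.
have -> : I1 f = F 1 - F 0.
  apply: I1_FTC => t; first by move=> _; exact: cf.
  by move=> /andP[t0 t1]; apply: dF'; rewrite /N; apply/andP; split; lra.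
rewrite subr0 opprK addrC.
have dG t : - N + 2 < t < N -> is_derive t 1 (fun t => F t - F (t - 1)) (f t - f (t - 1)).
  move=> /andP[t1 t2]; apply: is_deriveB; first by apply: dF'; apply/andP; split; lra.
  by apply: dS; apply/andP; split; lra.
have G0 t : f t - f (t - 1) = 0 by rewrite -(pf (t - 1)) subrK subrr.
have [z1|z1] := leP z 1.
  have [|c _] := mean_value (f := fun t => F t - F (t - 1)) (df := fun t => f t - f (t - 1)) z1.
    by move=> t /andP[t1 t2]; apply: dG; rewrite /N; apply/andP; split; lra.
  by rewrite G0 mul0r subrr; lra.
have [|c _] := mean_value (f := fun t => F t - F (t - 1)) (df := fun t => f t - f (t - 1)) (ltW z1).
  by move=> t /andP[t1 t2]; apply: dG; rewrite /N; apply/andP; split; lra.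
by rewrite G0 mul0r subrr; lra.
Qed.

Lemma I1_trig b n z : I1 (fun t => trig b (kap n * (z - t))) = ((n == 0%N) && ~~ b)%:R.
Proof.
case: n => [|n].
  under eq_fun do rewrite kap0 mul0r.
  by rewrite I1_cst; case: b; rewrite /= ?sin0 ?cos0.
have k0 : kap n.+1 != 0 :> R by rewrite !mulf_neq0 // ?gt_eqF ?pi_gt0 ?ltr0n.
pose A t := - (tsgn (~~ b) / kap n.+1) * trig (~~ b) (kap n.+1 * (z - t)).
have -> : I1 (fun t => trig b (kap n.+1 * (z - t))) = A 1 - A 0.
  have cT : continuous (fun t : R => trig b (kap n.+1 * (z - t))) by continuity.
  apply: (@I1_FTC _ _ A) => t _; first exact: cT.
  have d1 : is_derive t 1 (fun t => kap n.+1 * (z - t)) (- kap n.+1).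
    by rewrite -mulrN1; apply: is_derive_scale; exact: is_derive_subl.
  have d2 := @is_derive_comp _ _ (fun t => kap n.+1 * (z - t)) _ _ _
    (is_derive_trig (~~ b) (kap n.+1 * (z - t))) d1.
  apply: is_derive_congr (is_derive_scale (- (tsgn (~~ b) / kap n.+1)) d2) _.
  rewrite negbK.
  have ss : tsgn (~~ b) * tsgn (~~ b) = 1 :> R by case: (b); rewrite /tsgn /= ?mulrNN mulr1.
  rewrite [LHS](_ : _ = (tsgn (~~ b) * tsgn (~~ b)) * trig b (kap n.+1 * (z - t)) *
     (kap n.+1 / kap n.+1)); last by ring.
  by rewrite ss mulfV // mulr1 mul1r.
rewrite /A subr0 -{2}(subrK 1 z) trig_periodic subrr.
by [].
Qed.

Lemma kernel_continuous b a p s M : continuous (@kernel R b a p s M).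
Proof. by rewrite /kernel; continuity. Qed.

Lemma kernel_periodic b a p s M z : kernel b a p s M (z + 1) = kernel b a p s M z :> R.
Proof. by apply: eq_bigr => i _; rewrite trig_periodic. Qed.

Lemma I1_kernel b a p s M z : (0 < p)%N ->
  I1 (fun t => kernel b a p s M (z - t)) = ((a == 0%N) && ~~ b)%:R :> R.
Proof.
move=> p0; rewrite /kernel I1_sum; last by move=> i; continuity.
rewrite big_ord_recl big1 => [|i _]; last by rewrite I1_trig mulr0.
rewrite I1_trig /= kap0 addr0 mul1r !expr0n (gtn_eqF p0) mulr0 oppr0 expR0 mulr1.
by case: a => [|a]; rewrite /= ?mul1r ?mul0r.
Qed.

Lemma quarter_pi : 1 / 2 <= cos (pi / 4) :> R /\ sin (pi / 4) = cos (pi / 4) :> R.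
Proof.
have pi0 := @pi_gt0 R.
have c0 : 0 < cos (pi / 4) :> R by apply: cos_gt0_pihalf; apply/andP; split; lra.
have s0 : 0 < sin (pi / 4) :> R by apply: sin_gt0_pihalf; apply/andP; split; lra.
have e : cos ((pi / 4) *+ 2) = 0 :> R.
  by rewrite (_ : _ *+ 2 = pi / 2) ?cos_pihalf // mulr2n; field.
move: e; rewrite cos_mulr2n => e; have := cos2Dsin2 (pi / 4 : R).
move: c0 s0 e; rewrite mulr2n; move: (cos _) (sin _) => c d c0 d0 e1 e2.
split; first by nra.
have : (d - c) * (d + c) = 0 by rewrite -subr_sqr; lra.
move/eqP; rewrite mulf_eq0 => /orP[/eqP|/eqP]; lra.
Qed.

(** A weak form of the inequality of Jordan. *)
Lemma sin_ge_id z : 0 <= z <= 1 / 2 -> z <= sin (pi * z).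
Proof.
move=> /andP[z0 z1]; have pi2 := @pi_ge2 R; have pi0 := @pi_gt0 R.
have [c4 s4] := quarter_pi.
have [z4|z4] := leP z (1 / 4).
  have pz : 0 <= pi * z by rewrite mulr_ge0 // ltW.
  have [c /andP[c0 c1]] := mean_value pz (fun y _ => is_derive_sin y).
  rewrite sin0 !subr0 => ->.
  have c14 : c <= pi / 4.
    by rewrite (le_trans c1) // ler_pM2l //; lra.
  have : 1 / 2 <= cos c.
    rewrite (le_trans c4) //; have [->//|cn] := eqVneq c (pi / 4).
    by rewrite ltW // ltr_cos // ?in_itv /= ?lt_neqAle ?cn //; apply/andP; split; lra.
  by nra.
have : sin (pi / 4) <= sin (pi * z).
  have lt : pi / 4 < pi * z by rewrite ltr_pM2l //; lra.
  have : pi * z <= pi * (1 / 2) by rewrite ler_pM2l.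
  by move=> le; rewrite ltW // ltr_sin // in_itv /=; apply/andP; split; lra.
by lra.
Qed.

Lemma norm_sin_pi_ge z : 0 <= z <= 1 ->
  z <= `|sin (pi * z)| \/ 1 - z <= `|sin (pi * z)|.
Proof.
move=> /andP[z0 z1]; have [z2|z2] := leP z (1 / 2).
  left; have z3 : 0 <= z <= 1 / 2 by rewrite z0.
  by rewrite (le_trans (sin_ge_id z3)) // ler_norm.
right; have z3 : 0 <= 1 - z <= 1 / 2 by apply/andP; split; lra.
rewrite (le_trans (sin_ge_id z3)) // (_ : pi * (1 - z) = - (pi * z - pi)); last by ring.
by rewrite sinN -sinDpi subrK ler_norm.
Qed.

Lemma norm_sin_pi_periodic z : `|sin (pi * (z + 1))| = `|sin (pi * z)|.
Proof. by rewrite mulrDr mulr1 sinDpi normrN. Qed.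

(** The bump [peak s] times (s + |sin (pi z)|)^beta. *)
Definition weight beta s z : R := s * (s + `|sin (pi * z)|) `^ (beta - 2).

Lemma continuous_powR_pos (T : topologicalType) (h : T -> R) c :
  continuous h -> (forall x, 0 < h x) -> continuous (fun x => h x `^ c).
Proof.
move=> ch h0 x; apply: (@continuous_comp _ _ _ h (fun t => t `^ c)); first exact: ch.
exact: is_derive_continuous (is_derive1_powR c (h0 x)).
Qed.

Lemma weight_continuous beta s : 0 < s -> continuous (weight beta s).
Proof.
move=> s0; rewrite /weight; apply: continuous_mul; first by continuity.
apply: continuous_powR_pos; first by continuity.
by move=> z; rewrite ltr_wpDr.
Qed.

Lemma weight0 s z : 0 < s -> weight 0 s z = peak s z.
Proof.
move=> s0; rewrite /weight /peak add0r powR_invn //.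
by rewrite addr_ge0 // ltW.
Qed.

(** On each half of the period the sine dominates the distance to the nearest
    end, which leaves powers with explicit primitives. *)
Lemma I1_weight beta s z : beta < 1 -> 0 < s ->
  I1 (fun t => weight beta s (z - t)) <= 2 / (1 - beta) * s `^ beta.
Proof.
move=> b1 s0; rewrite I1_shift; first last.
- by move=> t; rewrite /weight norm_sin_pi_periodic.
- exact: weight_continuous.
pose A t := s / (beta - 1) * ((s + t) `^ (beta - 1) - (s + (1 - t)) `^ (beta - 1)).
pose f t := s * ((s + t) `^ (beta - 2) + (s + (1 - t)) `^ (beta - 2)).
have b10 : beta - 1 != 0 by rewrite lt_eqF // subr_lt0.
have d1 t c : 0 < s + t -> is_derive t 1 (fun t => (s + t) `^ c) (c * (s + t) `^ (c - 1)).
  move=> st; rewrite -[_ * _]mulr1; apply: (@is_derive_comp _ (fun t => t `^ c)) (is_derive_addl _ _).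
  exact: is_derive1_powR.
have d2 t c : 0 < s + (1 - t) ->
    is_derive t 1 (fun t => (s + (1 - t)) `^ c) (- (c * (s + (1 - t)) `^ (c - 1))).
  move=> st; rewrite (_ : (fun t => _) = (fun t => (s + 1 - t) `^ c)); last first.
    by apply/funext => r; rewrite addrA.
  have st1 : 0 < s + 1 - t by rewrite -addrA.
  apply: is_derive_congr (@is_derive_comp _ (fun t => t `^ c) (fun t => s + 1 - t) _ _ _
    (is_derive1_powR c st1) (is_derive_subl _ _)) _.
  by rewrite addrA; ring.
have cf : continuous01 f.
  move=> t /andP[t0 t1]; apply: cvgM; first exact: cvg_cst.
  by apply: cvgD; [apply: is_derive_continuous (d1 _ _ _)|apply: is_derive_continuous (d2 _ _ _)]; lra.
have cw : continuous01 (weight beta s) by move=> t _; exact: weight_continuous.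
apply: le_trans (I1_le cw cf _) _.
  move=> t /andP[t0 t1]; rewrite /weight /f ler_pM2l //.
  have t01 : 0 <= t <= 1 by rewrite t0 ltW.
  have h (x y : R) : 0 < x -> x <= y -> y `^ (beta - 2) <= x `^ (beta - 2).
    move=> x0 xy; have y0 : 0 < y by exact: lt_le_trans xy.
    rewrite -(opprB 2 beta) !powRN lef_pV2 ?posrE ?powR_gt0 //.
    by rewrite ge0_ler_powR ?nnegrE ?(ltW x0) ?(ltW y0) //; lra.
  have [le|le] := norm_sin_pi_ge t01.
    rewrite (@le_trans _ _ ((s + t) `^ (beta - 2))) ?lerDl ?powR_ge0 //.
    by apply: h; lra.
  rewrite (@le_trans _ _ ((s + (1 - t)) `^ (beta - 2))) ?lerDr ?powR_ge0 //.
  by apply: h; lra.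
have -> : I1 f = A 1 - A 0.
  apply: I1_FTC => [|t /andP[t0 t1]]; first exact: cf.
  have st : 0 < s + t by lra.
  have st' : 0 < s + (1 - t) by lra.
  apply: is_derive_congr (is_derive_scale (s / (beta - 1))
    (is_deriveB (d1 t (beta - 1) st) (d2 t (beta - 1) st'))) _.
  rewrite /f (_ : beta - 1 - 1 = beta - 2); last by ring.
  by field.
rewrite /A !subr0 addr0 subrr addr0 (_ : 2 / (1 - beta) * s `^ beta =
   - (2 * s / (beta - 1) * s `^ (beta - 1))); last first.
    have -> : s `^ beta = s `^ (beta - 1) * s.
      by have := powR_add (beta - 1) 1 s0; rewrite subrK powRr1 ?(ltW s0).
    by field; rewrite b10 subr_eq0 eq_sym; move: b10; rewrite subr_eq0 => ->.
have : 0 <= - (s / (beta - 1)) * (s + 1) `^ (beta - 1).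
    by rewrite mulr_ge0 ?powR_ge0 // oppr_ge0 mulr_ge0_le0 ?(ltW s0) // invr_le0; lra.
by lra.
Qed.

Definition tconv G phi psi (x : R * R) : R :=
  I2 (fun y => phi (x.1 - y.1) * psi (x.2 - y.2) * G y).

Definition x1_holder N beta G := forall s s' t,
  `|G (s', t) - G (s, t)| <= N * `|sin (pi * (s - s'))| `^ beta.

(** As [phi] has mean zero, G y may be replaced by its increment G y - G (x.1,
    y.2) in the first variable, which at scale [s1] is of size [s1 `^ beta]. *)
Lemma tconv_bound G N beta phi psi (c1 c2 s1 s2 : R) x :
  continuous G -> x1_holder N beta G -> 0 < beta -> beta < 1 ->
  continuous phi -> continuous psi -> 0 < s1 -> 0 < s2 -> 0 <= N ->
  (forall z, `|phi z| <= c1 * peak s1 z) -> (forall z, `|psi z| <= c2 * peak s2 z) ->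
  I1 (fun t => phi (x.1 - t)) = 0 ->
  `|tconv G phi psi x| <= 4 / (1 - beta) * (c1 * c2 * N * s1 `^ beta).
Proof.
move=> cG hG b0 b1 cphi cpsi s10 s20 N0 phib psib mean0.
have c10 : 0 <= c1.
  have := le_trans (normr_ge0 _) (phib 0); rewrite /peak mulr0 sin0 normr0 addr0.
  by rewrite pmulr_lge0 // divr_gt0 // exprn_gt0.
have c20 : 0 <= c2.
  have := le_trans (normr_ge0 _) (psib 0); rewrite /peak mulr0 sin0 normr0 addr0.
  by rewrite pmulr_lge0 // divr_gt0 // exprn_gt0.
have w1c := @weight_continuous beta _ s10.
have w2c := @weight_continuous 0 _ s20.
pose D y := phi (x.1 - y.1) * psi (x.2 - y.2) * (G y - G (x.1, y.2)).
have cD : continuous D by rewrite /D; continuity.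
have e : tconv G phi psi x = I2 D.
  pose E y := phi (x.1 - y.1) * (psi (x.2 - y.2) * G (x.1, y.2)).
  have cE : continuous E by rewrite /E; continuity.
  have E0 : I2 E = 0.
    rewrite (@I2_tensor _ (fun t => phi (x.1 - t)) (fun t => psi (x.2 - t) * G (x.1, t))).
    - by rewrite mean0 mul0r.
    - by continuity.
    - by continuity.
  have := I2_linear 1 cD cE; rewrite E0 mul1r addr0 => <-.
  by congr I2; apply/funext => y; rewrite /D /E; ring.
pose W y := c1 * c2 * N * (weight beta s1 (x.1 - y.1) * weight 0 s2 (x.2 - y.2)).
have cW : continuous W by rewrite /W; continuity.
have le y : `|D y| <= W y.
  rewrite /D /W !normrM.
  rewrite (_ : _ * _ = (c1 * (N * weight beta s1 (x.1 - y.1))) * (c2 * weight 0 s2 (x.2 - y.2))); last by ring.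
  rewrite mulrAC ler_pM ?mulr_ge0 //; last by rewrite weight0.
  have hGy := hG x.1 y.1 y.2; rewrite -surjective_pairing in hGy.
  rewrite (le_trans (ler_pM _ _ (phib _) hGy)) //=.
  set r := _ `^ beta.
  rewrite [leLHS](_ : _ = c1 * (N * (peak s1 (x.1 - y.1) * r))); last by ring.
  apply: ler_wpM2l => //; apply: ler_wpM2l => //; rewrite {}/r.
  rewrite -weight0 // /weight add0r -mulrA ler_wpM2l ?(ltW s10) //.
  set sg := `|sin _|; have sg0 : 0 <= sg by exact: normr_ge0.
  have ssg : 0 < s1 + sg by rewrite ltr_wpDr.
  rewrite (powR_add beta (-2) ssg) mulrC ler_wpM2r ?powR_ge0 //.
  by rewrite ge0_ler_powR ?nnegrE ?(ltW b0) ?(ltW ssg) ?lerDr // ltW.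
rewrite e ler_norml.
have IW : I2 W <= 4 / (1 - beta) * (c1 * c2 * N * s1 `^ beta).
  have -> : I2 W = c1 * c2 * N * (I1 (fun t => weight beta s1 (x.1 - t)) * I1 (fun t => weight 0 s2 (x.2 - t))).
    rewrite -I2_tensor; [|by continuity|by continuity].
    by rewrite -I2Z //; continuity.
  have c0 : 0 <= c1 * c2 * N by rewrite !mulr_ge0.
  have w1 := I1_weight x.1 b1 s10.
  have w2 := I1_weight x.2 ltr01 s20.
  rewrite subr0 divr1 powRr0 mulr1 in w2.
  have pos (b s z : R) : 0 < s -> 0 <= I1 (fun t => weight b s (z - t)).
    by move=> s0; apply: Rintegral_ge0 => t _; rewrite mulr_ge0 ?powR_ge0 // ltW.
  rewrite [leRHS](_ : _ = c1 * c2 * N * ((2 / (1 - beta) * s1 `^ beta) * 2)); last by ring.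
  by rewrite ler_wpM2l // ler_pM // pos.
have h1 : I2 D <= I2 W by apply: I2_le => // y _; rewrite (le_trans _ (le y)) // ler_norm.
have h2 : - I2 W <= I2 D.
  rewrite -mulN1r -I2Z //; apply: I2_le => [|//|y _]; first by continuity.
  by rewrite mulN1r lerNl (le_trans _ (le y)) // -normrN ler_norm.
by apply/andP; split; lra.
Qed.

End PeriodicIntegrals.

(** * Integration over the heat time and increments of the kernels *)

Section Duhamel.
Context {R : realType}.
Implicit Types (s t z beta N T h : R) (a p m n M : nat) (b : bool).

Lemma is_derive_bigsum (I : Type) (r : seq I) (P : pred I) (F : I -> R -> R) (dF : I -> R) (x : R) :
  (forall i, is_derive x 1 (F i) (dF i)) ->
  is_derive x 1 (fun t => \sum_(i <- r | P i) F i t) (\sum_(i <- r | P i) dF i).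
Proof.
move=> d; elim: r => [|i r IH].
  rewrite big_nil; under eq_fun do rewrite big_nil; exact: is_derive_cst.
rewrite big_cons; under eq_fun do rewrite big_cons.
by case: (P i) => //; apply: is_deriveD.
Qed.

Lemma is_derive_powR_scale (c e T : R) : 0 < T -> e != 0 ->
  is_derive T 1 (fun t => c / e * t `^ e) (c * T `^ (e - 1)).
Proof.
move=> T0 e0; apply: is_derive_congr (is_derive_scale (c / e) (is_derive1_powR e T0)) _.
by rewrite mulrA divfK.
Qed.

Section Heat.
Variables (I : finType) (c lam : I -> R).
Hypothesis c_lam : forall i, c i = 0 \/ 0 < lam i.

(* [u] is a heat evolution with eigenvalues [lam], and [v] is its integral
   over the later times. *)
Let v T := \sum_i c i * (expR (- (T * lam i)) / lam i).
Let u T := \sum_i c i * expR (- (T * lam i)).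

Lemma is_derive_heat T : is_derive T 1 v (- u T).
Proof.
rewrite /u -sumrN; apply: is_derive_bigsum => i.
have d1 : is_derive T 1 (fun t => - (t * lam i)) (- lam i).
  rewrite (_ : (fun t => _) = fun t => (- lam i) * t); first exact: is_derive_mull.
  by apply/funext => t; ring.
have d2 := @is_derive_comp _ _ (fun t => - (t * lam i)) _ _ _ (is_derive_expR (- (T * lam i))) d1.
have d3 := is_derive_scale (c i / lam i) d2.
case: (c_lam i) => [ci0|l0].
  rewrite ci0 mul0r oppr0 (_ : (fun t => _) = cst 0); first exact: is_derive_cst.
  by apply/funext => t; rewrite mul0r.
rewrite (_ : (fun t => _) = fun t => c i / lam i * expR (- (t * lam i))); last first.
  by apply/funext => t; ring.
by apply: is_derive_congr d3 _; field; rewrite gt_eqF.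
Qed.

(** The crude bound of order 1 / T shows that [v] vanishes at infinity, so
    that it is the integral of [u] from [T0] on. *)
Lemma heat_tail (d B T0 : R) : 0 < d -> 0 < T0 -> 0 <= B ->
  (forall T, T0 <= T -> `|u T| <= B * T `^ (- d - 1)) ->
  `|v T0| <= B / d * T0 `^ (- d).
Proof.
move=> d0 T00 B0 ub; pose K := \sum_i `|c i| / lam i ^+ 2.
have K0 : 0 <= K by apply: sumr_ge0 => i _; rewrite divr_ge0 // sqr_ge0.
have vK T : 0 < T -> `|v T| <= K / T.
  move=> T0'; rewrite (le_trans (ler_norm_sum _ _ _)) // /K mulr_suml ler_sum // => i _.
  case: (c_lam i) => [ci0|l0]; first by rewrite ci0 mul0r normr0 !mul0r.
  rewrite !normrM -!mulrA ler_wpM2l // normfV (gtr0_norm l0) (gtr0_norm (expR_gt0 _)).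
  have Tl : 0 < T * lam i by rewrite mulr_gt0.
  apply: (@le_trans _ _ ((T * lam i)^-1 / lam i)).
    rewrite ler_wpM2r ?invr_ge0 ?(ltW l0) // expRN lef_pV2 ?posrE ?expR_gt0 //.
    by have := expR_ge1Dx (T * lam i); lra.
  by rewrite le_eqVlt; apply/orP; left; apply/eqP; field; rewrite !gt_eqF.
apply/ler_addgt0Pl => e e0; pose T := T0 + K / e.
have T0T : T0 <= T by rewrite lerDl divr_ge0 // ltW.
have Tp : 0 < T by exact: lt_le_trans T0T.
have KT : K / T <= e.
  rewrite ler_pdivrMr // mulrDr [e * (K / e)]mulrC divfK ?gt_eqF //.
  by rewrite lerDr mulr_ge0 // ltW.
have pos x : T0 <= x <= T -> 0 < x by move=> /andP[h _]; exact: lt_le_trans h.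
have le : `|v T - v T0| <= B / - d * T `^ (- d) - B / - d * T0 `^ (- d).
  apply: (@variation_le _ v (fun x => - u x) (fun t => B / - d * t `^ (- d))
    (fun t => B * t `^ (- d - 1)) _ _ T0T) => [x _|x /pos x0|x /andP[x0 _]].
  - exact: is_derive_heat.
  - by apply: is_derive_powR_scale; rewrite // oppr_eq0 gt_eqF.
  - by rewrite normrN ub.
have le' := vK T Tp.
have : `|v T0| <= `|v T| + `|v T - v T0|.
  by rewrite -[X in `|X| <= _](subKr (v T)) (le_trans (ler_normB _ _)).
have : 0 <= B / d * T `^ (- d) by rewrite mulr_ge0 ?powR_ge0 ?divr_ge0 // ltW.
move: le; rewrite invrN !mulrN !mulNr; lra.
Qed.

(** The first bound is integrated up to the time [H] and the second one from
    [H] on. The starting time [tau] does not enter the estimate, because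
    T^(g-1) is integrable at 0. *)
Lemma heat_interpolation (g d A B tau H : R) :
  0 < g -> 0 < d -> 0 < tau -> 0 < H -> 0 <= A -> 0 <= B ->
  (forall T, tau <= T -> T <= H -> `|u T| <= A * T `^ (g - 1)) ->
  (forall T, tau <= T -> H <= T -> `|u T| <= B * T `^ (- d - 1)) ->
  `|v tau| <= A / g * H `^ g + B / d * H `^ (- d).
Proof.
move=> g0 d0 t0 H0 A0 B0 uA uB.
have AH : 0 <= A / g * H `^ g by rewrite mulr_ge0 ?powR_ge0 ?divr_ge0 // ltW.
have [tH|Ht] := leP tau H; last first.
  apply: (@le_trans _ _ (B / d * tau `^ (- d))).
    by apply: heat_tail => // T tT; apply: uB => //; rewrite (le_trans (ltW Ht)).
  have : B / d * tau `^ (- d) <= B / d * H `^ (- d).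
    rewrite ler_wpM2l ?divr_ge0 ?(ltW d0) // !powRN lef_pV2 ?posrE ?powR_gt0 //.
    by rewrite ge0_ler_powR ?nnegrE ?(ltW d0) ?(ltW t0) ?(ltW H0) ?(ltW Ht).
  by lra.
have vH : `|v H| <= B / d * H `^ (- d).
  by apply: heat_tail => // T HT; apply: uB => //; rewrite (le_trans tH).
have le : `|v H - v tau| <= A / g * H `^ g - A / g * tau `^ g.
  apply: (@variation_le _ v (fun x => - u x) (fun t => A / g * t `^ g)
    (fun t => A * t `^ (g - 1)) _ _ tH) => [x _|x /andP[x0 _]|x /andP[x0 x1]].
  - exact: is_derive_heat.
  - by apply: is_derive_powR_scale; rewrite ?gt_eqF // (lt_le_trans t0).
  - by rewrite normrN uA.
have : `|v tau| <= `|v H| + `|v H - v tau|.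
  by rewrite -[X in `|X| <= _](subKr (v H)) (le_trans (ler_normB _ _)).
have : 0 <= A / g * tau `^ g by rewrite mulr_ge0 ?powR_ge0 ?divr_ge0 // ltW.
by lra.
Qed.

End Heat.
End Duhamel.

Section OperatorBounds.
Context {R : realType}.
Implicit Types (s t z beta N T h : R) (a p m n M : nat) (b : bool).
Implicit Types (G : R * R -> R) (phi psi : R -> R).

Lemma is_derive_kernel b a p T M z :
  is_derive z 1 (kernel b a p T M) (tsgn b * kernel (~~ b) a.+1 p T M z).
Proof.
rewrite /kernel mulr_sumr; apply: is_derive_bigsum => i.
have d := @is_derive_comp _ _ (fun t => kap i * t) _ _ _
  (is_derive_trig b (kap i * z)) (is_derive_mull _ _).
apply: is_derive_congr (is_derive_scale (mult i * (kap i ^+ a * expR (- (T * kap i ^+ p)))) d) _.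
by rewrite exprS; ring.
Qed.

(** A shift by at most [s] changes the chordal distance by at most [4 s]. *)
Lemma peak_shift s z k : 0 < s -> `|k| <= s -> peak s (z + k) <= 81 * peak s z.
Proof.
move=> s0 ks; rewrite /peak mulrCA ler_pM2l //.
set x := `|sin (pi * z)|; set y := `|sin (pi * (z + k))|.
have x0 : 0 <= x by exact: normr_ge0.
have y0 : 0 <= y by exact: normr_ge0.
have pi4 : pi <= 4 :> R by have := @pihalf_lt2 R; lra.
have xy : x <= y + 4 * s.
  have [l _ e] := mean_value_abs (pi * z) (pi * k) (@is_derive_sin R).
  have : `|sin (pi * z + pi * k) - sin (pi * z)| <= 4 * s.
    rewrite e normrM (le_trans (ler_piMl _ (cos_max _))) // normrM.
    by rewrite ler_pM // ger0_norm // pi_ge0.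
  rewrite -mulrDr => le; rewrite /x /y.
  have := ler_normB (sin (pi * (z + k))) (sin (pi * (z + k)) - sin (pi * z)).
  by rewrite subKr => /le_trans; apply; rewrite lerD2l.
have py : 0 < (s + y) ^+ 2 by rewrite exprn_gt0 // ltr_wpDr.
have px : 0 < (s + x) ^+ 2 by rewrite exprn_gt0 // ltr_wpDr.
rewrite ler_pdivlMr // mulrC ler_pdivrMr //.
rewrite (_ : 81 * _ = (9 * (s + y)) ^+ 2); last by ring.
by rewrite ler_sqr ?nnegrE; lra.
Qed.

Lemma increment_peak (phi dphi : R -> R) (c s h : R) : 0 < s -> 0 <= c -> `|h| <= s ->
  (forall z, is_derive z 1 phi (dphi z)) -> (forall z, `|dphi z| <= c * peak s z) ->
  forall z, `|phi (z + h) - phi z| <= 81 * c * `|h| * peak s z.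
Proof.
move=> s0 c0 hs d db z; have [k kh ->] := mean_value_abs z h d.
rewrite normrM [leRHS](_ : _ = (c * (81 * peak s z)) * `|h|); last by ring.
rewrite ler_wpM2r // (le_trans (db _)) // ler_wpM2l //.
by apply: peak_shift => //; exact: le_trans hs.
Qed.

Lemma increment2_peak (phi dphi ddphi : R -> R) (c s h : R) : 0 < s -> 0 <= c -> `|h| <= s ->
  (forall z, is_derive z 1 phi (dphi z)) -> (forall z, is_derive z 1 dphi (ddphi z)) ->
  (forall z, `|ddphi z| <= c * peak s z) ->
  forall z, `|phi (z + h) - phi z - h * dphi z| <= 81 * c * h ^+ 2 * peak s z.
Proof.
move=> s0 c0 hs d dd db z; have [k kh le] := taylor2_abs z h d dd.
apply: (le_trans le).
rewrite [leRHS](_ : _ = (c * (81 * peak s z)) * h ^+ 2); last by ring.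
rewrite ler_wpM2r ?sqr_ge0 // (le_trans (db _)) // ler_wpM2l //.
by apply: peak_shift => //; exact: le_trans hs.
Qed.

Lemma powR_root n T : (0 < n)%N -> 0 < T -> (T `^ (1 / n%:R)) ^+ n = T.
Proof.
move=> n0 T0; rewrite -powR_mulrn ?powR_ge0 // -powRrM divfK ?powRr1 ?(ltW T0) //.
by rewrite pnatr_eq0 -lt0n.
Qed.

Lemma scale_admissible n M T : (2 <= n)%N -> 0 < T -> 1 <= M%:R * T ->
  1 <= M%:R * (T `^ (1 / n%:R)) ^+ 2.
Proof.
move=> n2 T0 MT.
have M1 : 1 <= M%:R :> R.
  by rewrite ler1n lt0n; apply/eqP => M0; move: MT; rewrite M0 mul0r; lra.
have n0 : 0 < n%:R :> R by rewrite ltr0n ltnW.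
rewrite -powR_mulrn ?powR_ge0 // -powRrM.
have e : 1 / n%:R * 2 <= 1 :> R.
  by rewrite mulrAC ler_pdivrMr // !mul1r ler_nat.
have [T1|T1] := leP T 1.
  rewrite (le_trans MT) // ler_wpM2l //.
  by rewrite -[leLHS]powRr1 ?(ltW T0) // ger_powR // T0.
rewrite -[leLHS]mulr1 ler_pM // -[leLHS](powRr0 T) ler_powR ?(ltW T1) //.
Qed.

Lemma kernel_peak1 a p : (0 < a)%N -> (1 < p)%N -> exists2 C : R, 0 < C &
  forall b M T z, 0 < T -> 1 <= M%:R * T ->
  `|kernel b a p T M z| <= C * T `^ (- (a%:R / p%:R)) * peak (T `^ (1 / p%:R)) z.
Proof.
move=> a0 p1; have p0 : (0 < p)%N by exact: ltnW.
have [C C0 PC] := kernel_peak (R := R) a p0.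
exists C => // b M T z T0 MT; set s := T `^ (1 / p%:R).
have s0 : 0 < s by rewrite powR_gt0.
have := PC b s M z (fun _ => a0) s0; rewrite a0 => /(_ isT).
rewrite /s powR_root // => /(_ (scale_admissible p1 T0 MT)).
rewrite -powR_mulrn ?powR_ge0 // -powRrM -powRN.
by rewrite (_ : - (1 / p%:R * a%:R) = - (a%:R / p%:R)) //; ring.
Qed.

(** For a = 0 and large times the kernel tends to 1 instead of concentrating
    at the scale T^(1/2), which is then more than a period; the peak is taken
    at scale 1. *)
Lemma kernel_peak2 a : exists2 C : R, 0 < C &
  forall b M T, (b -> (0 < a)%N) -> 0 < T -> 1 <= M%:R * T -> exists2 s, 0 < s &
  forall z, `|kernel b a 2 T M z| <= C * T `^ (- (a%:R / 2)) * peak s z.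
Proof.
have [C C0 PC] := kernel_peak (R := R) a (isT : (0 < 2)%N).
have [A A0 PA] := kernel_sup (R := R) a (isT : (0 < 2)%N).
exists (C + 4 * (1 + A)); first by lra.
move=> b M T ba T0 MT; pose r := T `^ (1 / 2).
have r0 : 0 < r by rewrite powR_gt0.
have rT : r ^+ 2 = T by exact: powR_root.
have rM : 1 <= M%:R * r ^+ 2 by exact: scale_admissible.
have e : T `^ (- (a%:R / 2)) = (r ^+ a)^-1.
  rewrite -powR_mulrn ?powR_ge0 // -powRrM -powRN.
  by congr (_ `^ _); ring.
rewrite e -rT; have ra0 : 0 < (r ^+ a)^-1 by rewrite invr_gt0 exprn_gt0.
have [ar|] := boolP ((0 < a)%N || (r <= 1)).
  exists r => // z; apply: (le_trans (PC _ _ _ _ ba r0 ar rM)).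
  apply: ler_wpM2r; first exact: peak_ge0.
  apply: ler_wpM2r; [exact: ltW|lra].
rewrite negb_or -leqNgt leqn0 -ltNge => /andP[/eqP a00 r1].
exists 1 => // z; have := PA b r M z r0; rewrite a00 expr1 expr0 invr1 mulr1 eqxx.
move=> le; apply: (le_trans le).
have Ar : A / r <= A by rewrite ler_pdivrMr // ler_peMr // ltW.
have x1 : `|sin (pi * z)| <= 1 by exact: sin_max.
have x0 : 0 <= `|sin (pi * z)| by exact: normr_ge0.
rewrite /peak mulrA mulr1 ler_pdivlMr ?exprn_gt0 ?ltr_wpDr //.
apply: (@le_trans _ _ ((1 + A) * 4)); last by lra.
rewrite ler_pM //.
- by rewrite addr_ge0 // divr_ge0 // ltW.
- by rewrite lerD2l.
- by nra.
Qed.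

End OperatorBounds.

(** * Bounds for the heat semigroup *)

Section TconvLinear.
Context {R : realType}.
Implicit Types (s z beta N T h c : R) (a b p m n M : nat) (t : bool).
Implicit Types (G : R * R -> R) (phi psi : R -> R) (x : R * R).

Lemma tconv_lin1 G c phi phi' psi x : continuous G ->
  continuous phi -> continuous phi' -> continuous psi ->
  tconv G (fun z => c * phi z + phi' z) psi x = c * tconv G phi psi x + tconv G phi' psi x.
Proof.
move=> cG c1 c2 c3; rewrite /tconv -I2_linear; [|by continuity|by continuity].
by congr I2; apply/funext => y; ring.
Qed.

Lemma tconv_lin2 G c phi psi psi' x : continuous G ->
  continuous phi -> continuous psi -> continuous psi' ->
  tconv G phi (fun z => c * psi z + psi' z) x = c * tconv G phi psi x + tconv G phi psi' x.
Proof.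
move=> cG c1 c2 c3; rewrite /tconv -I2_linear; [|by continuity|by continuity].
by congr I2; apply/funext => y; ring.
Qed.

Lemma tconv_sum (I J : finType) G (cI : I -> R) (cJ : J -> R) (phi : I -> R -> R)
    (psi : J -> R -> R) x : continuous G ->
  (forall i, continuous (phi i)) -> (forall j, continuous (psi j)) ->
  tconv G (fun z => \sum_i cI i * phi i z) (fun z => \sum_j cJ j * psi j z) x =
  \sum_(k : I * J) cI k.1 * cJ k.2 * tconv G (phi k.1) (psi k.2) x.
Proof.
move=> cG c1 c2; rewrite /tconv -I2_sum; last by
  move=> k; have h1 := c1 k.1; have h2 := c2 k.2; continuity.
congr I2; apply/funext => y; rewrite big_distrlr /= pair_big /= mulr_suml.
by apply: eq_bigr => k _; ring.
Qed.

Lemma tconv_shift1 G phi psi x h :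
  tconv G phi psi (x.1 + h, x.2) = tconv G (fun z => phi (z + h)) psi x.
Proof. by congr I2; apply/funext => y /=; rewrite addrAC. Qed.

Lemma tconv_shift2 G phi psi x h :
  tconv G phi psi (x.1, x.2 + h) = tconv G phi (fun z => psi (z + h)) x.
Proof. by congr I2; apply/funext => y /=; rewrite addrAC. Qed.

(** In each case the operator is a convolution with a product kernel which is
    concentrated at scale T^(1/3) in the first variable and has mean zero
    there, so that [tconv_bound] applies. Derivatives, or increments divided
    by the step, cost T^(-1/3) in the first variable and T^(-1/2) in the
    second one. *)
Lemma semigroup_bounds a b beta : (0 < a)%N -> 0 < beta -> beta < 1 ->
  exists2 C : R, 0 < C & forall G N t1 t2 M T,
  continuous G -> x1_holder N beta G -> 0 <= N -> (t2 -> (0 < b)%N) ->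
  0 < T -> 1 <= M%:R * T ->
  let U := tconv G (kernel t1 a 3 T M) (kernel t2 b 2 T M) in
  let U' := fun x => tsgn t1 * tconv G (kernel (~~ t1) a.+1 3 T M) (kernel t2 b 2 T M) x in
  let e := (beta - a%:R) / 3 - b%:R / 2 in
  [/\ forall x, `|U x| <= C * N * T `^ e,
      forall x, `|U' x| <= C * N * T `^ (e - 1 / 3),
      forall x h, `|h| <= T `^ (1 / 3) ->
        `|U (x.1 + h, x.2) - U x| <= C * N * `|h| * T `^ (e - 1 / 3),
      forall x h, `|h| <= T `^ (1 / 3) ->
        `|U (x.1 + h, x.2) - U x - h * U' x| <= C * N * h ^+ 2 * T `^ (e - 2 / 3) &
      forall x h, `|h| <= T `^ (1 / 2) ->
        `|U (x.1, x.2 + h) - U x| <= C * N * `|h| * T `^ (e - 1 / 2)].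
Proof.
move=> a0 b0 b1.
have [A0 A00 PA0] := kernel_peak1 (R := R) a0 (isT : (1 < 3)%N).
have [A1 A10 PA1] := kernel_peak1 (R := R) (isT : (0 < a.+1)%N) (isT : (1 < 3)%N).
have [A2 A20 PA2] := kernel_peak1 (R := R) (isT : (0 < a.+2)%N) (isT : (1 < 3)%N).
have [B0 B00 PB0] := kernel_peak2 (R := R) b.
have [B1 B10 PB1] := kernel_peak1 (R := R) (isT : (0 < b.+1)%N) (isT : (1 < 2)%N).
have [D D0 DE] : exists2 D : R, 0 < D & D = 4 / (1 - beta).
  by exists (4 / (1 - beta)); rewrite // divr_gt0 // subr_gt0.
pose S := 81 * ((A0 + A1 + A2) * (B0 + B1)).
have S0 : 0 < S by rewrite !mulr_gt0 // !addr_gt0.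
have SS (x y : R) : 0 < x -> 0 < y -> x <= A0 + A1 + A2 -> y <= B0 + B1 -> x * y <= S / 81.
  by move=> x0 y0 xA yB; rewrite /S [leRHS]mulrAC divff ?pnatr_eq0 // mul1r ler_pM // ltW.
clearbody S; exists (D * S) => [|G N t1 t2 M T cG hG N0 tb T0 MT U U' e]; first by rewrite mulr_gt0.
set s1 := T `^ (1 / 3); have s10 : 0 < s1 by rewrite powR_gt0.
(* The common form of the five estimates: [Q] is the power of the step h, and
   [k] collects the constants of the two kernels. *)
have gen phi psi (c1 c2 s2 Q r k : R) x : continuous phi -> continuous psi -> 0 < s2 ->
    (forall z, `|phi z| <= c1 * peak s1 z) -> (forall z, `|psi z| <= c2 * peak s2 z) ->
    I1 (fun y : R => phi (x.1 - y)) = 0 -> 0 <= Q -> k <= S ->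
    c1 * c2 = k * Q * T `^ (r - beta / 3) ->
    `|tconv G phi psi x| <= D * S * N * Q * T `^ r.
  move=> cphi cpsi s20 phib psib m0 Q0 kS e12.
  have sE : s1 `^ beta = T `^ (beta / 3) by rewrite /s1 -powRrM; congr (_ `^ _); ring.
  apply: (le_trans (tconv_bound cG hG b0 b1 cphi cpsi s10 s20 N0 phib psib m0)).
  rewrite -DE sE e12.
  rewrite [leLHS](_ : _ = D * N * Q * k * (T `^ (r - beta / 3) * T `^ (beta / 3))); last by ring.
  rewrite -powR_add // subrK [leRHS](_ : _ = D * N * Q * S * T `^ r); last by ring.
  apply: ler_wpM2r; first exact: powR_ge0.
  by apply: ler_wpM2l => //; rewrite !mulr_ge0 // ltW.
have [s2 s20 K2b] := PB0 t2 M T tb T0 MT.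
have cK t n p m : continuous (kernel t n p T m : R -> R) by exact: kernel_continuous.
have cKs t n p m h : continuous (fun z : R => kernel t n p T m (z + h)).
  by apply: continuous_compose; [exact: cK|continuity].
have I1K t n z : I1 (fun y => kernel t n.+1 3 T M (z - y)) = 0 :> R.
  by rewrite I1_kernel.
have I1Ka z : I1 (fun y => kernel t1 a 3 T M (z - y)) = 0 :> R.
  by rewrite I1_kernel // (gtn_eqF a0).
have pw q : 0 < T `^ q by rewrite powR_gt0.
have Tsum (u v r : R) : u + v = r -> T `^ u * T `^ v = T `^ r.
  by move=> <-; rewrite powR_add.
have ts t z : `|tsgn t * z| = `|z|.
  by rewrite normrM /tsgn; case: t; rewrite ?normrN normr1 mul1r.
have tt t : tsgn t * tsgn (~~ t) = -1 :> R by case: t; rewrite /tsgn /= ?mulN1r ?mul1r.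
have dK0 z : is_derive z 1 (kernel t1 a 3 T M) (tsgn t1 * kernel (~~ t1) a.+1 3 T M z).
  exact: is_derive_kernel.
have dK1 z : is_derive z 1 (fun z => tsgn t1 * kernel (~~ t1) a.+1 3 T M z)
    (- kernel t1 a.+2 3 T M z).
  apply: is_derive_congr (is_derive_scale _ (is_derive_kernel _ _ _ _ _ _)) _.
  by rewrite mulrA tt negbK mulN1r.
have Idiff h z : I1 (fun y => kernel t1 a 3 T M (z - y + h) - kernel t1 a 3 T M (z - y)) = 0 :> R.
  have c1 : continuous (fun y : R => kernel t1 a 3 T M (z - y)) by continuity.
  have c2 : continuous (fun y : R => kernel t1 a 3 T M (z - y + h)).
    by apply: continuous_compose; [exact: cK|continuity].
  have e2 : I1 (fun y : R => kernel t1 a 3 T M (z - y + h)) = 0 :> R.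
    by under eq_fun do rewrite addrAC; rewrite I1Ka.
  have := I1_linear (-1) c1 c2; rewrite I1Ka e2 mulr0 add0r => e1.
  by rewrite -[RHS]e1; congr I1; apply/funext => y; ring.
split.
- move=> x; rewrite -[C in C * T `^ e]mulr1.
  apply: (gen _ _ _ _ s2 _ _ (A0 * B0) _ _ _ _ (fun z => PA0 t1 M T z T0 MT) K2b) => //.
  + rewrite (le_trans (SS _ _ A00 B00 _ _)) //; [lra|lra|].
    by lra.
  + rewrite mulr1 mulrACA; congr (_ * _); apply: Tsum; rewrite /e; ring.
- move=> x; rewrite /U' ts -[C in C * T `^ _]mulr1.
  apply: (gen _ _ _ _ s2 _ _ (A1 * B0) _ _ _ _ (fun z => PA1 (~~ t1) M T z T0 MT) K2b) => //.
  + rewrite (le_trans (SS _ _ A10 B00 _ _)) //; [lra|lra|].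
    by lra.
  + by rewrite mulr1 mulrACA; congr (_ * _); apply: Tsum; rewrite /e -[a.+1%:R]natr1; field.
- move=> x h hs.
  have -> : U (x.1 + h, x.2) - U x = tconv G
      (fun z => kernel t1 a 3 T M (z + h) - kernel t1 a 3 T M z) (kernel t2 b 2 T M) x.
    rewrite (_ : (fun z => _) = fun z => -1 * kernel t1 a 3 T M z + kernel t1 a 3 T M (z + h)).
      by rewrite /U tconv_shift1 tconv_lin1 //; ring.
    by apply/funext => z; ring.
  have K1b := increment_peak s10 _ hs dK0 _.
  have {}K1b : forall z, `|kernel t1 a 3 T M (z + h) - kernel t1 a 3 T M z| <=
      81 * (A1 * T `^ (- (a.+1%:R / 3))) * `|h| * peak s1 z.
    apply: K1b; first by rewrite mulr_ge0 ?(ltW A10) ?(ltW (pw _)).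
    by move=> z; rewrite ts PA1.
  apply: (gen _ _ _ _ s2 _ _ (81 * (A1 * B0)) _ _ _ _ K1b K2b) => //.
  + by continuity.
  + have := SS _ _ A10 B00; rewrite ler_pdivlMr // mulrC; apply; lra.
  + rewrite -(@Tsum (- (a.+1%:R / 3)) (- (b%:R / 2)) (e - 1 / 3 - beta / 3)); first by ring.
    by rewrite /e -[a.+1%:R]natr1; field.
- move=> x h hs.
  have -> : U (x.1 + h, x.2) - U x - h * U' x = tconv G
      (fun z => kernel t1 a 3 T M (z + h) - kernel t1 a 3 T M z
         - h * (tsgn t1 * kernel (~~ t1) a.+1 3 T M z)) (kernel t2 b 2 T M) x.
    rewrite (_ : (fun z => _) = fun z => -1 * kernel t1 a 3 T M z +
       (- (h * tsgn t1) * kernel (~~ t1) a.+1 3 T M z + kernel t1 a 3 T M (z + h))).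
      by rewrite /U tconv_shift1 tconv_lin1 // ?tconv_lin1 // /U'; [ring|continuity].
    by apply/funext => z; ring.
  have K1b := increment2_peak s10 _ hs dK0 dK1 _.
  have {}K1b : forall z, `|kernel t1 a 3 T M (z + h) - kernel t1 a 3 T M z
         - h * (tsgn t1 * kernel (~~ t1) a.+1 3 T M z)| <=
      81 * (A2 * T `^ (- (a.+2%:R / 3))) * h ^+ 2 * peak s1 z.
    apply: K1b; first by rewrite mulr_ge0 ?(ltW A20) ?(ltW (pw _)).
    by move=> z; rewrite normrN PA2.
  apply: (gen _ _ _ _ s2 _ _ (81 * (A2 * B0)) _ _ _ _ K1b K2b) => //.
  + by continuity.
  + have c1 : continuous (fun y : R => kernel (~~ t1) a.+1 3 T M (x.1 - y)) by continuity.
    have c2 : continuous (fun y : R => kernel t1 a 3 T M (x.1 - y + h) - kernel t1 a 3 T M (x.1 - y)).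
      by apply: continuous_add; [apply: continuous_compose; [exact: cK|continuity]|continuity].
    have := I1_linear (- (h * tsgn t1)) c1 c2; rewrite Idiff I1K mulr0 add0r => <-.
    by congr I1; apply/funext => y; ring.
  + exact: sqr_ge0.
  + have := SS _ _ A20 B00; rewrite ler_pdivlMr // mulrC; apply; lra.
  + rewrite -(@Tsum (- (a.+2%:R / 3)) (- (b%:R / 2)) (e - 2 / 3 - beta / 3)); first by ring.
    by rewrite /e -[a.+2%:R]natr1 -[a.+1%:R]natr1; field.
- move=> x h hs.
  have -> : U (x.1, x.2 + h) - U x = tconv G (kernel t1 a 3 T M)
      (fun z => kernel t2 b 2 T M (z + h) - kernel t2 b 2 T M z) x.
    rewrite (_ : (fun z => _) = fun z => -1 * kernel t2 b 2 T M z + kernel t2 b 2 T M (z + h)).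
      by rewrite /U tconv_shift2 tconv_lin2 //; ring.
    by apply/funext => z; ring.
  have dK z : is_derive z 1 (kernel t2 b 2 T M) (tsgn t2 * kernel (~~ t2) b.+1 2 T M z).
    exact: is_derive_kernel.
  have r0 : 0 < T `^ (1 / 2) by [].
  have {}K2b : forall z, `|kernel t2 b 2 T M (z + h) - kernel t2 b 2 T M z| <=
      81 * (B1 * T `^ (- (b.+1%:R / 2))) * `|h| * peak (T `^ (1 / 2)) z.
    apply: (increment_peak r0 _ hs dK _); first by rewrite mulr_ge0 ?(ltW B10) ?(ltW (pw _)).
    by move=> z; rewrite ts; exact: PB1.
  apply: (gen _ _ _ _ _ _ _ (81 * (A0 * B1)) _ _ _ r0 (fun z => PA0 t1 M T z T0 MT) K2b) => //.
  + by continuity.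
  + have := SS _ _ A00 B10; rewrite ler_pdivlMr // mulrC; apply; lra.
  + rewrite -(@Tsum (- (a%:R / 3)) (- (b.+1%:R / 2)) (e - 1 / 2 - beta / 3)); first by ring.
    by rewrite /e -[b.+1%:R]natr1; field.
Qed.

End TconvLinear.

(** * Hoelder bounds for the potentials *)

Section Potential.
Context {R : realType}.
Implicit Types (s z beta N T h c alpha : R) (a b p m n M : nat) (t : bool).
Implicit Types (G : R * R -> R) (phi psi : R -> R) (x : R * R).

Definition wave t n z : R := trig t (kap n * z).

Definition symb (k : nat * nat) : R := kap k.1 ^+ 3 + kap k.2 ^+ 2.

Definition coef a b (k : nat * nat) : R := mult k.1 * kap k.1 ^+ a * (mult k.2 * kap k.2 ^+ b).

(** The part of the heat representation of the inverse operator that uses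
    times after [T]. *)
Definition pot G t1 t2 a b M T x : R := \sum_(k : 'I_M.+1 * 'I_M.+1)
  coef a b (k.1 : nat, k.2 : nat) * tconv G (wave t1 k.1) (wave t2 k.2) x *
  (expR (- (T * symb (k.1 : nat, k.2 : nat))) / symb (k.1 : nat, k.2 : nat)).

Lemma wave_continuous t n : continuous (wave t n).
Proof. by rewrite /wave; continuity. Qed.

Lemma tconv_kernels G t1 t2 a b M T x : continuous G ->
  tconv G (kernel t1 a 3 T M) (kernel t2 b 2 T M) x =
  \sum_(k : 'I_M.+1 * 'I_M.+1)
  coef a b (k.1 : nat, k.2 : nat) * tconv G (wave t1 k.1) (wave t2 k.2) x *
  expR (- (T * symb (k.1 : nat, k.2 : nat))).
Proof.
move=> cG; rewrite tconv_sum //; [|by move=> i; exact: wave_continuous..].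
apply: eq_bigr => k _; rewrite /coef /symb /= mulrDr opprD expRD /wave; ring.
Qed.

Lemma coef_symb a b k : (0 < a)%N -> coef a b k = 0 \/ 0 < symb k.
Proof.
case: k => [[|n] m] a0; [left|right].
  by rewrite /coef /= kap0 expr0n gtn_eqF //= mulr0 mul0r.
by rewrite /symb /= ltr_wpDr ?sqr_ge0 // exprn_gt0 // /kap !mulr_gt0 ?pi_gt0.
Qed.

Lemma le_powR_root (h n T : R) : 0 < n -> `|h| `^ n <= T -> `|h| <= T `^ (1 / n).
Proof.
move=> n0 hT; have -> : `|h| = (`|h| `^ n) `^ (1 / n).
  by rewrite -powRrM mulrCA divff ?gt_eqF // mulr1 powRr1.
rewrite ge0_ler_powR ?nnegrE ?powR_ge0 ?divr_ge0 ?(ltW n0) //.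
by rewrite (le_trans _ hT) // powR_ge0.
Qed.

Lemma powR_root_le (h n T : R) : 0 < n -> 0 <= T -> T <= `|h| `^ n -> T `^ (1 / n) <= `|h|.
Proof.
move=> n0 T0 hT; have -> : `|h| = (`|h| `^ n) `^ (1 / n).
  by rewrite -powRrM mulrCA divff ?gt_eqF // mulr1 powRr1.
by rewrite ge0_ler_powR ?nnegrE ?powR_ge0 ?divr_ge0 ?(ltW n0).
Qed.

Section Bounds.
Variables (a b : nat) (beta alpha : R).
Hypotheses (a0 : (0 < a)%N) (b0 : 0 < beta) (b1 : beta < 1).
(* The power of [T] in the sup bound for the semigroup. *)
Hypothesis homog : (beta - a%:R) / 3 - b%:R / 2 = alpha / 3 - 1.

(** The times up to h^2 are controlled by the sup bound, and the later ones by
    the derivative in x_2. The integral over the latter converges at infinity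
    since alpha < 3 / 2. *)
Lemma pot_x2_holder : 0 < alpha -> alpha < 3 / 2 -> exists2 C : R, 0 < C &
  forall G N t1 t2 M T, continuous G -> x1_holder N beta G -> 0 <= N ->
  (t2 -> (0 < b)%N) -> 0 < T -> 1 <= M%:R * T -> forall x h,
  `|pot G t1 t2 a b M T (x.1, x.2 + h) - pot G t1 t2 a b M T x| <=
    C * N * `|h| `^ (2 * alpha / 3).
Proof.
move=> al0 al1; have [C C0 PC] := semigroup_bounds b a0 b0 b1.
pose g := alpha / 3; pose d := 1 / 2 - alpha / 3.
have g0 : 0 < g by rewrite divr_gt0.
have d0 : 0 < d by rewrite /d; lra.
exists (2 * C / g + C / d) => [|G N t1 t2 M T0 cG hG N0 tb T00 MT0 x h].
  by rewrite addr_gt0 // divr_gt0 // mulr_gt0.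
have [->|h0] := eqVneq h 0.
  rewrite addr0 -surjective_pairing subrr normr0 powR0 ?mulr0 //.
  by rewrite mulf_neq0 ?invr_neq0 // gt_eqF ?mulr_gt0.
have nh : 0 < `|h| by rewrite normr_gt0.
have H0 : 0 < `|h| `^ 2 by rewrite powR_gt0.
pose c (k : 'I_M.+1 * 'I_M.+1) := coef a b (k.1 : nat, k.2 : nat) *
  (tconv G (wave t1 k.1) (wave t2 k.2) (x.1, x.2 + h) - tconv G (wave t1 k.1) (wave t2 k.2) x).
pose lam (k : 'I_M.+1 * 'I_M.+1) := symb (k.1 : nat, k.2 : nat).
have clam k : c k = 0 \/ 0 < lam k.
  by case: (coef_symb b (k.1 : nat, k.2 : nat) a0) => [e|]; [left; rewrite /c e mul0r|right].
have uE T : \sum_i c i * expR (- (T * lam i)) =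
    tconv G (kernel t1 a 3 T M) (kernel t2 b 2 T M) (x.1, x.2 + h) -
    tconv G (kernel t1 a 3 T M) (kernel t2 b 2 T M) x.
  rewrite !tconv_kernels // -sumrB; apply: eq_bigr => i _; rewrite /c /lam; ring.
have vE : pot G t1 t2 a b M T0 (x.1, x.2 + h) - pot G t1 t2 a b M T0 x =
    \sum_i c i * (expR (- (T0 * lam i)) / lam i).
  rewrite /pot -sumrB; apply: eq_bigr => i _; rewrite /c /lam; ring.
rewrite vE.
have MT T : T0 <= T -> 1 <= M%:R * T.
  by move=> le; rewrite (le_trans MT0) // ler_wpM2l.
have := @heat_interpolation R _ c lam clam g d (2 * C * N) (C * N * `|h|) T0 (`|h| `^ 2)
  g0 d0 T00 H0 _ _ _ _.
have -> : 2 * C * N / g * `|h| `^ 2 `^ g + C * N * `|h| / d * `|h| `^ 2 `^ (- d) =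
    (2 * C / g + C / d) * N * `|h| `^ (2 * alpha / 3).
  rewrite -!powRrM (_ : 2 * g = 2 * alpha / 3); last by rewrite /g; ring.
  have : `|h| `^ 1 * `|h| `^ (2 * - d) = `|h| `^ (2 * alpha / 3).
    by rewrite -powR_add //; congr (_ `^ _); rewrite /d; field.
  by rewrite powRr1 // => <-; ring.
apply.
- by rewrite !mulr_ge0 // ltW.
- by rewrite !mulr_ge0 // ltW.
- move=> T T0T TH; have T1 : 0 < T by exact: lt_le_trans T0T.
  have [/= PU _ _ _ _] := PC G N t1 t2 M T cG hG N0 tb T1 (MT _ T0T).
  rewrite uE (le_trans (ler_normB _ _)) // (_ : g - 1 = (beta - a%:R) / 3 - b%:R / 2) //.
  by rewrite -!mulrA mulr2n mulrDl mul1r !mulrA lerD.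
- move=> T T0T HT; have T1 : 0 < T by exact: lt_le_trans T0T.
  have [/= _ _ _ _ PU] := PC G N t1 t2 M T cG hG N0 tb T1 (MT _ T0T).
  rewrite uE (le_trans (PU _ _ _)) //; first exact: le_powR_root.
  by rewrite homog (_ : alpha / 3 - 1 - 1 / 2 = - d - 1) // /d; field.
Qed.

(** The critical time is |h|^3, and the integral over the later times
    converges since alpha < 1. *)
Lemma pot_x1_holder : 0 < alpha -> alpha < 1 -> exists2 C : R, 0 < C &
  forall G N t1 t2 M T, continuous G -> x1_holder N beta G -> 0 <= N ->
  (t2 -> (0 < b)%N) -> 0 < T -> 1 <= M%:R * T -> forall x h,
  `|pot G t1 t2 a b M T (x.1 + h, x.2) - pot G t1 t2 a b M T x| <=
    C * N * `|h| `^ alpha.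
Proof.
move=> al0 al1; have [C C0 PC] := semigroup_bounds b a0 b0 b1.
pose g := alpha / 3; pose d := (1 - alpha) / 3.
have g0 : 0 < g by rewrite divr_gt0.
have d0 : 0 < d by rewrite /d; lra.
exists (2 * C / g + C / d) => [|G N t1 t2 M T0 cG hG N0 tb T00 MT0 x h].
  by rewrite addr_gt0 // divr_gt0 // mulr_gt0.
have [->|h0] := eqVneq h 0.
  by rewrite addr0 -surjective_pairing subrr normr0 powR0 ?mulr0 // gt_eqF.
have nh : 0 < `|h| by rewrite normr_gt0.
have H0 : 0 < `|h| `^ 3 by rewrite powR_gt0.
pose c (k : 'I_M.+1 * 'I_M.+1) := coef a b (k.1 : nat, k.2 : nat) *
  (tconv G (wave t1 k.1) (wave t2 k.2) (x.1 + h, x.2) - tconv G (wave t1 k.1) (wave t2 k.2) x).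
pose lam (k : 'I_M.+1 * 'I_M.+1) := symb (k.1 : nat, k.2 : nat).
have clam k : c k = 0 \/ 0 < lam k.
  by case: (coef_symb b (k.1 : nat, k.2 : nat) a0) => [e|]; [left; rewrite /c e mul0r|right].
have uE T : \sum_i c i * expR (- (T * lam i)) =
    tconv G (kernel t1 a 3 T M) (kernel t2 b 2 T M) (x.1 + h, x.2) -
    tconv G (kernel t1 a 3 T M) (kernel t2 b 2 T M) x.
  rewrite !tconv_kernels // -sumrB; apply: eq_bigr => i _; rewrite /c /lam; ring.
have vE : pot G t1 t2 a b M T0 (x.1 + h, x.2) - pot G t1 t2 a b M T0 x =
    \sum_i c i * (expR (- (T0 * lam i)) / lam i).
  rewrite /pot -sumrB; apply: eq_bigr => i _; rewrite /c /lam; ring.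
rewrite vE.
have MT T : T0 <= T -> 1 <= M%:R * T.
  by move=> le; rewrite (le_trans MT0) // ler_wpM2l.
have := @heat_interpolation R _ c lam clam g d (2 * C * N) (C * N * `|h|) T0 (`|h| `^ 3)
  g0 d0 T00 H0 _ _ _ _.
have -> : 2 * C * N / g * `|h| `^ 3 `^ g + C * N * `|h| / d * `|h| `^ 3 `^ (- d) =
    (2 * C / g + C / d) * N * `|h| `^ alpha.
  rewrite -!powRrM (_ : 3 * g = alpha); last by rewrite /g; field.
  have : `|h| `^ 1 * `|h| `^ (3 * - d) = `|h| `^ alpha.
    by rewrite -powR_add //; congr (_ `^ _); rewrite /d; field.
  by rewrite powRr1 // => <-; ring.
apply.
- by rewrite !mulr_ge0 // ltW.
- by rewrite !mulr_ge0 // ltW.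
- move=> T T0T TH; have T1 : 0 < T by exact: lt_le_trans T0T.
  have [/= PU _ _ _ _] := PC G N t1 t2 M T cG hG N0 tb T1 (MT _ T0T).
  rewrite uE (le_trans (ler_normB _ _)) // (_ : g - 1 = (beta - a%:R) / 3 - b%:R / 2) //.
  by rewrite -!mulrA mulr2n mulrDl mul1r !mulrA lerD.
- move=> T T0T HT; have T1 : 0 < T by exact: lt_le_trans T0T.
  have [/= _ _ PU _ _] := PC G N t1 t2 M T cG hG N0 tb T1 (MT _ T0T).
  rewrite uE (le_trans (PU _ _ _)) //; first exact: le_powR_root.
  by rewrite homog (_ : alpha / 3 - 1 - 1 / 3 = - d - 1) // /d; field.
Qed.

(** Up to the time |h|^3 the three terms are bounded one by one; the bound for
    the slope is the most singular one at T = 0, and it is integrable since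
    alpha > 1. Afterwards the second derivative is used. *)
Lemma pot_x1_taylor : 1 < alpha -> alpha < 2 -> exists2 C : R, 0 < C &
  forall G N t1 t2 M T, continuous G -> x1_holder N beta G -> 0 <= N ->
  (t2 -> (0 < b)%N) -> 0 < T -> 1 <= M%:R * T -> forall x h,
  `|pot G t1 t2 a b M T (x.1 + h, x.2) - pot G t1 t2 a b M T x -
    h * (tsgn t1 * pot G (~~ t1) t2 a.+1 b M T x)| <=
    C * N * `|h| `^ alpha.
Proof.
move=> al0 al1; have [C C0 PC] := semigroup_bounds b a0 b0 b1.
pose g := (alpha - 1) / 3; pose d := (2 - alpha) / 3.
have g0 : 0 < g by rewrite /g; lra.
have d0 : 0 < d by rewrite /d; lra.
exists (3 * C / g + C / d) => [|G N t1 t2 M T0 cG hG N0 tb T00 MT0 x h].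
  by rewrite addr_gt0 // divr_gt0 // mulr_gt0.
have [->|h0] := eqVneq h 0.
  by rewrite addr0 -surjective_pairing subrr mul0r subr0 normr0 powR0 ?mulr0 // gt_eqF //; lra.
have nh : 0 < `|h| by rewrite normr_gt0.
have H0 : 0 < `|h| `^ 3 by rewrite powR_gt0.
pose c (k : 'I_M.+1 * 'I_M.+1) := coef a b (k.1 : nat, k.2 : nat) *
  (tconv G (wave t1 k.1) (wave t2 k.2) (x.1 + h, x.2) - tconv G (wave t1 k.1) (wave t2 k.2) x
   - h * (tsgn t1 * (kap k.1 * tconv G (wave (~~ t1) k.1) (wave t2 k.2) x))).
pose lam (k : 'I_M.+1 * 'I_M.+1) := symb (k.1 : nat, k.2 : nat).
have clam k : c k = 0 \/ 0 < lam k.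
  by case: (coef_symb b (k.1 : nat, k.2 : nat) a0) => [e|]; [left; rewrite /c e mul0r|right].
have coefS k : coef a.+1 b k = coef a b k * kap k.1.
  by rewrite /coef exprS; ring.
have uE T : \sum_i c i * expR (- (T * lam i)) =
    tconv G (kernel t1 a 3 T M) (kernel t2 b 2 T M) (x.1 + h, x.2) -
    tconv G (kernel t1 a 3 T M) (kernel t2 b 2 T M) x -
    h * (tsgn t1 * tconv G (kernel (~~ t1) a.+1 3 T M) (kernel t2 b 2 T M) x).
  rewrite !tconv_kernels // !mulr_sumr -!sumrB; apply: eq_bigr => i _.
  by rewrite /c /lam coefS; ring.
have vE : pot G t1 t2 a b M T0 (x.1 + h, x.2) - pot G t1 t2 a b M T0 x -
    h * (tsgn t1 * pot G (~~ t1) t2 a.+1 b M T0 x) =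
    \sum_i c i * (expR (- (T0 * lam i)) / lam i).
  rewrite /pot !mulr_sumr -!sumrB; apply: eq_bigr => i _.
  by rewrite /c /lam coefS; ring.
rewrite vE.
have MT T : T0 <= T -> 1 <= M%:R * T.
  by move=> le; rewrite (le_trans MT0) // ler_wpM2l.
have := @heat_interpolation R _ c lam clam g d (3 * C * N * `|h|) (C * N * h ^+ 2) T0 (`|h| `^ 3)
  g0 d0 T00 H0 _ _ _ _.
have -> : 3 * C * N * `|h| / g * `|h| `^ 3 `^ g + C * N * h ^+ 2 / d * `|h| `^ 3 `^ (- d) =
    (3 * C / g + C / d) * N * `|h| `^ alpha.
  have e1 : `|h| * `|h| `^ 3 `^ g = `|h| `^ alpha.
    rewrite -powRrM -{1}(powRr1 (ltW nh)) -powR_add //.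
    by congr (_ `^ _); rewrite /g; field.
  have e2 : h ^+ 2 * `|h| `^ 3 `^ (- d) = `|h| `^ alpha.
    rewrite -powRrM -real_normK ?num_real // -powR_mulrn // -powR_add //.
    by congr (_ `^ _); rewrite /d; field.
  rewrite [X in X + _](_ : _ = 3 * C / g * N * (`|h| * `|h| `^ 3 `^ g)); last by ring.
  rewrite [X in _ + X](_ : _ = C / d * N * (h ^+ 2 * `|h| `^ 3 `^ (- d))); last by ring.
  by rewrite e1 e2; ring.
apply.
- by rewrite !mulr_ge0 // ltW.
- by rewrite mulr_ge0 ?sqr_ge0 // mulr_ge0 // ltW.
- move=> T T0T TH; have T1 : 0 < T by exact: lt_le_trans T0T.
  have [/= PU PU' _ _ _] := PC G N t1 t2 M T cG hG N0 tb T1 (MT _ T0T).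
  have e1 : T `^ (alpha / 3 - 1) <= `|h| * T `^ (g - 1).
    rewrite (_ : alpha / 3 - 1 = 1 / 3 + (g - 1)); last by rewrite /g; field.
    by rewrite powR_add // ler_wpM2r ?powR_ge0 // powR_root_le // ltW.
  have CN : 0 <= C * N by rewrite mulr_ge0 // ltW.
  have e2 y : `|tconv G (kernel t1 a 3 T M) (kernel t2 b 2 T M) y| <= C * N * (`|h| * T `^ (g - 1)).
    by rewrite (le_trans (PU y)) // homog ler_wpM2l.
  rewrite uE (le_trans (ler_normB _ _)) //.
  rewrite [leRHS](_ : _ = C * N * (`|h| * T `^ (g - 1)) + C * N * (`|h| * T `^ (g - 1))
     + `|h| * (C * N * T `^ (g - 1))); last by ring.
  rewrite lerD // ?(le_trans (ler_normB _ _)) ?lerD //.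
  rewrite normrM ler_wpM2l // (le_trans (PU' x)) //.
  by rewrite homog (_ : alpha / 3 - 1 - 1 / 3 = g - 1) // /g; field.
- move=> T T0T HT; have T1 : 0 < T by exact: lt_le_trans T0T.
  have [/= _ _ _ PU _] := PC G N t1 t2 M T cG hG N0 tb T1 (MT _ T0T).
  rewrite uE (le_trans (PU _ _ _)) //; first exact: le_powR_root.
  by rewrite homog (_ : alpha / 3 - 1 - 2 / 3 = - d - 1) // /d; field.
Qed.

End Bounds.
End Potential.

(** * Trigonometric test functions *)

Section TestFunctions.
Context {R : realType}.
Implicit Types (F G phi psi : R * R -> R) (x y : R * R) (w : seq bool).
Implicit Types (n m : nat) (b i : bool).

Lemma slice1 F x : 
  (fun h : R => h^-1 *: ((F \o shift x) (h *: e1) - F x)) =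
  (fun h : R => h^-1 *: (((fun t => F (t, x.2)) \o shift x.1) (h *: (1 : R)) - F (x.1, x.2))).
Proof.
apply/funext => h /=; rewrite -surjective_pairing; congr (_ *: (F _ - _)).
by rewrite /shift /e1; case: x => x1 x2; congr pair; rewrite /= /GRing.scale /= mulr0 add0r.
Qed.

Lemma slice2 F x : 
  (fun h : R => h^-1 *: ((F \o shift x) (h *: e2) - F x)) =
  (fun h : R => h^-1 *: (((fun t => F (x.1, t)) \o shift x.2) (h *: (1 : R)) - F (x.1, x.2))).
Proof.
apply/funext => h /=; rewrite -surjective_pairing; congr (_ *: (F _ - _)).
by rewrite /shift /e2; case: x => x1 x2; congr pair; rewrite /= /GRing.scale /= mulr0 add0r.
Qed.

Lemma is_derive_slice1 F x (d : R) :
  is_derive x e1 F d <-> is_derive x.1 1 (fun t => F (t, x.2)) d.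
Proof.
have e := slice1 F x; split => -[dF vF]; split.
- by move: dF; rewrite /derivable e.
- by move: vF; rewrite /derive e.
- by move: dF; rewrite /derivable e.
- by move: vF; rewrite /derive e.
Qed.

Lemma is_derive_slice2 F x (d : R) :
  is_derive x e2 F d <-> is_derive x.2 1 (fun t => F (x.1, t)) d.
Proof.
have e := slice2 F x; split => -[dF vF]; split.
- by move: dF; rewrite /derivable e.
- by move: vF; rewrite /derive e.
- by move: dF; rewrite /derivable e.
- by move: vF; rewrite /derive e.
Qed.

Definition dir i : R * R := if i then e1 else e2.

Definition tensor n1 b1 n2 b2 x : R := wave b1 n1 x.1 * wave b2 n2 x.2.

Lemma is_derive_wave b n (z : R) :
  is_derive z 1 (wave b n) (tsgn b * kap n * wave (~~ b) n z).
Proof.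
have d := @is_derive_comp _ _ (fun t => kap n * t) _ _ _
  (is_derive_trig b (kap n * z)) (is_derive_mull _ _).
by apply: is_derive_congr d _; rewrite /wave; ring.
Qed.

Definition dtensor n1 b1 n2 b2 i x : R :=
  if i then tsgn b1 * kap n1 * tensor n1 (~~ b1) n2 b2 x
  else tsgn b2 * kap n2 * tensor n1 b1 n2 (~~ b2) x.

Lemma is_derive_tensor n1 b1 n2 b2 i x :
  is_derive x (dir i) (tensor n1 b1 n2 b2) (dtensor n1 b1 n2 b2 i x).
Proof.
case: i; rewrite /dir /dtensor.
  apply/is_derive_slice1; rewrite /tensor /=.
  rewrite (_ : (fun t => _) = fun t => wave b2 n2 x.2 * wave b1 n1 t); last first.
    by apply/funext => t; rewrite mulrC.
  by apply: is_derive_congr (is_derive_scale _ (is_derive_wave _ _ _)) _; ring.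
apply/is_derive_slice2; rewrite /tensor /=.
by apply: is_derive_congr (is_derive_scale _ (is_derive_wave _ _ _)) _; ring.
Qed.

Lemma pderivE F i x (d : R) : is_derive x (dir i) F d -> pderiv i F x = d.
Proof. by move=> h; rewrite /pderiv; exact: derive_val. Qed.

Lemma pderiv_tensor n1 b1 n2 b2 i :
  pderiv i (tensor n1 b1 n2 b2) = dtensor n1 b1 n2 b2 i.
Proof. by apply/funext => x; exact: pderivE (is_derive_tensor _ _ _ _ _ _). Qed.

Lemma tensor_continuous n1 b1 n2 b2 : continuous (tensor n1 b1 n2 b2).
Proof. by rewrite /tensor /wave; continuity. Qed.

Lemma smooth_derivable phi : smooth phi ->
  forall w i x, derivable (pderivs w phi) x (dir i).
Proof.
move=> s w i x; have [_ d] := s w; have [d1 d2] := d x.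
by case: i; [exact: d1|exact: d2].
Qed.

Lemma pderivs_linear (a : R) phi psi w : smooth phi -> smooth psi ->
  pderivs w (fun x => a * phi x + psi x) =
  (fun x => a * pderivs w phi x + pderivs w psi x).
Proof.
move=> s1 s2; elim: w => [//|i w IH]; rewrite /= -/(pderivs w _) IH.
apply/funext => x; apply: (@pderivE _ i).
have d1 := derivableP (@smooth_derivable _ s1 w i x).
have d2 := derivableP (@smooth_derivable _ s2 w i x).
exact: (is_deriveD (is_deriveZ a d1) d2).
Qed.

Lemma smooth_linear (a : R) phi psi : smooth phi -> smooth psi ->
  smooth (fun x => a * phi x + psi x).
Proof.
move=> s1 s2 w; rewrite pderivs_linear //; split.
  have [c1 _] := s1 w; have [c2 _] := s2 w.
  by apply: continuous_add => //; apply: continuous_mul => //; exact: continuous_const.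
have d i x : derivable (fun x => a * pderivs w phi x + pderivs w psi x) x (dir i).
  have d1 := derivableP (@smooth_derivable _ s1 w i x).
  have d2 := derivableP (@smooth_derivable _ s2 w i x).
  by case: (is_deriveD (is_deriveZ a d1) d2).
by move=> x; split; [exact: (d true)|exact: (d false)].
Qed.

Lemma test_linear (a : R) phi psi : test phi -> test psi ->
  test (fun x => a * phi x + psi x).
Proof.
move=> [p1 s1] [p2 s2]; split; last exact: smooth_linear.
by move=> x; have [-> ->] := p1 x; have [-> ->] := p2 x.
Qed.

(** Iterated derivatives are handled by a class stable under differentiation
    instead of by induction on words. *)
Lemma smooth_class (C : (R * R -> R) -> Prop) :
  (forall F, C F -> [/\ continuous F, forall i x, derivable F x (dir i) &
     forall i, C (pderiv i F)]) -> forall F, C F -> smooth F.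
Proof.
move=> CP F CF w; have : C (pderivs w F).
  by elim: w => [//|i w IH] /=; have [_ _] := CP _ IH; exact.
by move=> /CP[c d _]; split => // x; split; [exact: (d true)|exact: (d false)].
Qed.

Lemma test_tensor_scaled (a : R) n1 b1 n2 b2 : test (fun x => a * tensor n1 b1 n2 b2 x).
Proof.
split.
  move=> x; split; congr (_ * _); rewrite /tensor /wave /=; congr (_ * _);
  exact: trig_periodic.
apply: (@smooth_class (fun F => exists c d1 d2, F = fun x => c * tensor n1 d1 n2 d2 x)).
  move=> F [c [d1 [d2 ->]]].
  have d i x := is_deriveZ c (is_derive_tensor n1 d1 n2 d2 i x).
  split.
  - by apply: continuous_mul; [exact: continuous_const|exact: tensor_continuous].
  - by move=> i x; case: (d i x).
  - have e i : pderiv i (fun x => c * tensor n1 d1 n2 d2 x) =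
        fun x => c * dtensor n1 d1 n2 d2 i x.
      by apply/funext => x; exact: pderivE (d i x).
    case; rewrite e /dtensor.
      exists (c * (tsgn d1 * kap n1)), (~~ d1), d2.
      by apply/funext => x; rewrite mulrA.
    exists (c * (tsgn d2 * kap n2)), d1, (~~ d2).
    by apply/funext => x; rewrite mulrA.
by exists a, b1, b2.
Qed.

Lemma test_tensor n1 b1 n2 b2 : test (tensor n1 b1 n2 b2).
Proof.
rewrite (_ : tensor _ _ _ _ = fun x => 1 * tensor n1 b1 n2 b2 x); first exact: test_tensor_scaled.
by apply/funext => x; rewrite mul1r.
Qed.

Lemma test_zero : test (fun _ : R * R => 0 : R).
Proof.
rewrite (_ : (fun _ => _) = fun x => 0 * tensor 0 true 0 true x); first exact: test_tensor_scaled.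
by apply/funext => x; rewrite mul0r.
Qed.

Lemma test_sum (I : Type) (r : seq I) (c : I -> R) (F : I -> R * R -> R) :
  (forall k, test (F k)) -> test (fun x => \sum_(k <- r) c k * F k x).
Proof.
move=> tF; elim: r => [|k r IH].
  by under eq_fun do rewrite big_nil; exact: test_zero.
by under eq_fun do rewrite big_cons; exact: test_linear.
Qed.

Lemma test_continuous phi : test phi -> continuous phi.
Proof. by move=> [_ /(_ [::])[]]. Qed.

Lemma periodic_pderiv F i : periodic2 F -> periodic2 (pderiv i F).
Proof.
move=> pF x; have pF1 y : F (y.1 + 1, y.2) = F y by have [] := pF y.
have pF2 y : F (y.1, y.2 + 1) = F y by have [] := pF y.
rewrite /pderiv /derive; split; congr (lim (_ @ 0^')); apply/funext => h /=.
  rewrite pF1 -[in RHS]pF1; congr (_ *: (F _ - _)).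
  by rewrite /shift; case: (_ *: _) => u v; congr pair; rewrite /= addrA.
rewrite pF2 -[in RHS]pF2; congr (_ *: (F _ - _)).
by rewrite /shift; case: (_ *: _) => u v; congr pair; rewrite /= addrA.
Qed.

Lemma test_pderiv phi i : test phi -> test (pderiv i phi).
Proof.
move=> [p s]; split; first exact: periodic_pderiv.
by move=> w; have := s (rcons w i); rewrite /pderivs foldr_rcons.
Qed.

Lemma test_pderivs phi w : test phi -> test (pderivs w phi).
Proof. by move=> t; elim: w => [//|i w IH] /=; exact: test_pderiv. Qed.

Lemma test_derive phi i x : test phi -> is_derive x (dir i) phi (pderiv i phi x).
Proof.
move=> [_ s]; have := @smooth_derivable _ s [::] i x => /= d.
exact: derivableP.
Qed.

Section Distribution.
Variable T : (R * R -> R) -> R.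
Hypothesis dT : periodic_distribution T.

Lemma dist_linear (a : R) phi psi : test phi -> test psi ->
  T (fun x => a * phi x + psi x) = a * T phi + T psi.
Proof. by move: dT => [+ _]; apply. Qed.

Lemma dist_zero : T (fun _ => 0) = 0.
Proof.
have := dist_linear (-1) test_zero test_zero.
under [X in T X = _]eq_fun do rewrite mulr0 addr0.
by move=> ->; rewrite mulN1r addNr.
Qed.

Lemma dist_sum (I : Type) (r : seq I) (c : I -> R) (F : I -> R * R -> R) :
  (forall k, test (F k)) ->
  T (fun x => \sum_(k <- r) c k * F k x) = \sum_(k <- r) c k * T (F k).
Proof.
move=> tF; elim: r => [|k r IH].
  by rewrite big_nil; under eq_fun do rewrite big_nil; exact: dist_zero.
rewrite big_cons -IH; under eq_fun do rewrite big_cons.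
by rewrite dist_linear //; exact: test_sum.
Qed.

End Distribution.

Lemma I2_pderiv F i : periodic2 F -> continuous (pderiv i F) ->
  (forall x, is_derive x (dir i) F (pderiv i F x)) -> I2 (pderiv i F) = 0.
Proof.
move=> pF cF dF; have [it1 it2] := I2_iterated cF.
case: i cF dF it1 it2 => cF dF it1 it2.
  rewrite it2 (_ : (fun t => _) = fun=> 0); first exact: I1_cst.
  apply/funext => t.
  have -> : I1 (fun s => pderiv true F (s, t)) = F (1, t) - F (0, t).
    apply: (@I1_FTC _ _ (fun s => F (s, t))) => s _; last first.
      exact: (iffLR (@is_derive_slice1 F (s, t) _) (dF (s, t))).
    have cS : continuous (fun s : R => pderiv true F (s, t)) by continuity.
    exact: cS.
  have [+ _] := pF (0, t); rewrite /= add0r => ->.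
  by rewrite subrr.
rewrite it1 (_ : (fun t => _) = fun=> 0); first exact: I1_cst.
apply/funext => s.
have -> : I1 (fun t => pderiv false F (s, t)) = F (s, 1) - F (s, 0).
  apply: (@I1_FTC _ _ (fun t => F (s, t))) => t _; last first.
    exact: (iffLR (@is_derive_slice2 F (s, t) _) (dF (s, t))).
  have cS : continuous (fun t : R => pderiv false F (s, t)) by continuity.
  exact: cS.
have [_ +] := pF (s, 0); rewrite /= add0r => ->.
by rewrite subrr.
Qed.

Lemma I2_by_parts phi psi i : test phi -> test psi ->
  I2 (fun x => pderiv i phi x * psi x) = - I2 (fun x => phi x * pderiv i psi x).
Proof.
move=> t1 t2; have c1 := test_continuous t1; have c2 := test_continuous t2.
have c3 := test_continuous (test_pderiv i t1).
have c4 := test_continuous (test_pderiv i t2).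
have d x : is_derive x (dir i) (fun y => phi y * psi y)
    (1 * (pderiv i phi x * psi x) + phi x * pderiv i psi x).
  have := is_deriveM (test_derive i x t1) (test_derive i x t2).
  by move=> h; apply: is_derive_eq h _; rewrite /GRing.scale /=; ring.
have e : pderiv i (fun y => phi y * psi y) =
    fun x => 1 * (pderiv i phi x * psi x) + phi x * pderiv i psi x.
  by apply/funext => x; exact: pderivE.
have := @I2_pderiv (fun y => phi y * psi y) i; rewrite e I2_linear; first last.
- by continuity.
- by continuity.
move=> h; apply/eqP; rewrite -addr_eq0 -[X in X + _]mul1r; apply/eqP/h.
- by move=> x; have [p1 p2] := t1.1 x; have [p3 p4] := t2.1 x; rewrite /= p1 p2 p3 p4.
- by continuity.
Qed.

End TestFunctions.

(** * Regularization of distributions *)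

Section Regularization.
Context {R : realType}.
Implicit Types (phi psi u F : R * R -> R) (x y : R * R) (w : seq bool).
Implicit Types (n m j : nat) (b i : bool) (s t z beta N : R).
Implicit Types (T : (R * R -> R) -> R).

Definition tau j : R := j.+1%:R^-1.

Definition mollifier p j : R -> R := kernel false 0 p (tau j) j.+1.

(** The kernel of the heat semigroup at time [tau j]. The truncation makes it
    a trigonometric polynomial, hence a test function which can be expanded in
    finitely many modes. *)
Definition delta j x y : R := mollifier 3 j (x.1 - y.1) * mollifier 2 j (x.2 - y.2).

Definition reg T j x : R := T (delta j x).

Definition conv u j x : R := I2 (fun y => u y * delta j x y).

Definition modes j : finType := (('I_j.+2 * 'I_j.+2) * (bool * bool))%type.

Definition mode j (k : modes j) : R * R -> R := tensor k.1.1 k.2.1 k.1.2 k.2.2.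

Definition amplitude j (k : modes j) : R :=
  coef 0 0 (k.1.1 : nat, k.1.2 : nat) * expR (- (tau j * symb (k.1.1 : nat, k.1.2 : nat))).

Lemma wave_addition n (s t : R) : wave false n (s - t) = \sum_b wave b n s * wave b n t.
Proof. by rewrite big_bool /wave /= mulrBr cosB addrC. Qed.

Lemma delta_expand j x y : delta j x y =
  \sum_(k : modes j) (amplitude k * mode k x) * mode k y.
Proof.
have e p (s t : R) : mollifier p j (s - t) =
    \sum_(n < j.+2) \sum_b mult n * expR (- (tau j * kap n ^+ p)) * (wave b n s * wave b n t).
  by apply: eq_bigr => n _; rewrite expr0 mul1r -mulr_sumr -wave_addition.
have -> : \sum_(k : modes j) amplitude k * mode k x * mode k y =
    \sum_(a : 'I_j.+2 * 'I_j.+2) \sum_(b : bool * bool)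
      amplitude ((a, b) : modes j) * mode ((a, b) : modes j) x * mode ((a, b) : modes j) y.
  by rewrite pair_bigA; apply: eq_bigr => -[].
rewrite /delta !e big_distrlr /= pair_big /=.
apply: eq_bigr => k _; rewrite big_distrlr /= pair_big /=.
apply: eq_bigr => b _; rewrite /amplitude /coef /symb /mode /tensor /= !expr0.
by rewrite mulrDr opprD expRD; ring.
Qed.

Lemma kernel_even a p (s : R) m z : kernel false a p s m (- z) = kernel false a p s m z.
Proof. by apply: eq_bigr => n _; rewrite mulrN /= cosN. Qed.

Lemma test_mode j (k : modes j) : test (mode k). Proof. exact: test_tensor. Qed.

Lemma test_delta j x : test (delta j x).
Proof.
rewrite (_ : delta j x = fun y => \sum_(k : modes j) (amplitude k * mode k x) * mode k y).
  by apply: test_sum => k; exact: test_mode.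
by apply/funext => y; exact: delta_expand.
Qed.

Lemma delta_continuous j x : continuous (delta j x).
Proof. exact: test_continuous (test_delta j x). Qed.

Lemma reg_expand T j : periodic_distribution T ->
  reg T j = fun x => \sum_(k : modes j) (amplitude k * T (mode k)) * mode k x.
Proof.
move=> dT; apply/funext => x; rewrite /reg.
rewrite (_ : delta j x = fun y => \sum_(k : modes j) (amplitude k * mode k x) * mode k y).
  rewrite dist_sum //; last by move=> k; exact: test_mode.
  by apply: eq_bigr => k _; rewrite mulrAC.
by apply/funext => y; exact: delta_expand.
Qed.

Lemma test_reg T j : periodic_distribution T -> test (reg T j).
Proof. by move=> dT; rewrite reg_expand //; apply: test_sum => k; exact: test_mode. Qed.

Lemma mode_continuous j (k : modes j) : continuous (mode k).
Proof. exact: test_continuous (test_mode k). Qed.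

Lemma conv_expand u j : continuous u ->
  conv u j = fun x => \sum_(k : modes j) (amplitude k * I2 (fun y => u y * mode k y)) * mode k x.
Proof.
move=> cu; apply/funext => x; rewrite /conv.
rewrite (_ : (fun y => _) = fun y => \sum_(k : modes j) (amplitude k * mode k x) * (u y * mode k y)).
  rewrite I2_sum; last by move=> k; have := @mode_continuous _ k => ck; continuity.
  by apply: eq_bigr => k _; rewrite mulrAC.
by apply/funext => y; rewrite delta_expand mulr_sumr; apply: eq_bigr => k _; ring.
Qed.

Lemma test_conv u j : continuous u -> test (conv u j).
Proof. by move=> cu; rewrite conv_expand //; apply: test_sum => k; exact: test_mode. Qed.

Lemma reg_pairing T j u : periodic_distribution T -> continuous u ->
  I2 (fun x => reg T j x * u x) = T (conv u j).
Proof.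
move=> dT cu; rewrite conv_expand // reg_expand // dist_sum //; last first.
  by move=> k; exact: test_mode.
rewrite (_ : (fun x => _) = fun x => \sum_(k : modes j) (amplitude k * T (mode k)) * (u x * mode k x)).
  rewrite I2_sum; last by move=> k; have := @mode_continuous _ k => ck; continuity.
  by apply: eq_bigr => k _; ring.
by apply/funext => y; rewrite mulr_suml; apply: eq_bigr => k _; ring.
Qed.

Lemma mollifier_continuous p j : continuous (mollifier p j).
Proof. exact: kernel_continuous. Qed.

(** The substitution r |-> s + t - r exchanges the two kernels, which are
    even. *)
Lemma I1_swap p j j' (s t : R) :
  I1 (fun r => mollifier p j (s - r) * mollifier p j' (t - r)) =
  I1 (fun r => mollifier p j' (s - r) * mollifier p j (t - r)).
Proof.
have c1 := @mollifier_continuous p j; have c2 := @mollifier_continuous p j'.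
pose f r := mollifier p j (r - t) * mollifier p j' (r - s).
have cf : continuous f by rewrite /f; continuity.
have pf r : f (r + 1) = f r.
  by rewrite /f /mollifier ![_ + 1 - _]addrAC !kernel_periodic.
rewrite -[LHS](_ : I1 (fun r => f (s + t - r)) = _).
  rewrite I1_shift //; congr I1; apply/funext => r; rewrite /f mulrC.
  by congr (_ * _); rewrite /mollifier -[in RHS]kernel_even opprB.
congr I1; apply/funext => r; rewrite /f.
by congr (mollifier p j _ * mollifier p j' _); ring.
Qed.

Lemma delta_swap j j' x y :
  I2 (fun v => delta j x v * delta j' y v) = I2 (fun v => delta j' x v * delta j y v).
Proof.
have c1 := @mollifier_continuous 3 j; have c2 := @mollifier_continuous 3 j'.
have c3 := @mollifier_continuous 2 j; have c4 := @mollifier_continuous 2 j'.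
have e (k l : nat) : continuous (mollifier 3 k) -> continuous (mollifier 3 l) ->
   continuous (mollifier 2 k) -> continuous (mollifier 2 l) ->
   I2 (fun v => delta k x v * delta l y v) =
   I1 (fun r => mollifier 3 k (x.1 - r) * mollifier 3 l (y.1 - r)) *
   I1 (fun r => mollifier 2 k (x.2 - r) * mollifier 2 l (y.2 - r)).
  move=> ? ? ? ?; rewrite -I2_tensor; [|by continuity|by continuity].
  by congr I2; apply/funext => z; rewrite /delta; ring.
by rewrite !e // I1_swap; congr (_ * _); rewrite I1_swap.
Qed.

Lemma reg_conv_comm T j j' x : periodic_distribution T ->
  conv (reg T j) j' x = conv (reg T j') j x.
Proof.
move=> dT; rewrite /conv !reg_pairing //; try exact: delta_continuous.
by congr T; apply/funext => y; exact: delta_swap.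
Qed.

Lemma tau_gt0 j : 0 < tau j. Proof. by rewrite invr_gt0 ltr0n. Qed.

Lemma tau_le1 j : tau j <= 1. Proof. by rewrite invf_le1 ?ler1n ?ltr0n. Qed.

Lemma tau_admissible j : 1 <= j.+1%:R * tau j.
Proof. by rewrite mulfV // pnatr_eq0. Qed.

Lemma I2_delta j x : I2 (delta j x) = 1.
Proof.
have c1 := @mollifier_continuous 3 j; have c2 := @mollifier_continuous 2 j.
rewrite /delta (@I2_tensor _ (fun t => mollifier 3 j (x.1 - t)) (fun t => mollifier 2 j (x.2 - t))).
- by rewrite !I1_kernel // mulr1.
- by continuity.
- by continuity.
Qed.

Lemma peak_le_weight beta s z : 0 < beta -> 0 < s ->
  peak s z * `|sin (pi * z)| `^ beta <= weight beta s z.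
Proof.
move=> b0 s0; rewrite -weight0 // /weight add0r -mulrA ler_wpM2l ?(ltW s0) //.
set sg := `|sin _|; have sg0 : 0 <= sg by exact: normr_ge0.
have ssg : 0 < s + sg by rewrite ltr_wpDr.
rewrite (powR_add beta (-2) ssg) mulrC ler_wpM2r ?powR_ge0 //.
by rewrite ge0_ler_powR ?nnegrE ?(ltW b0) ?(ltW ssg) ?lerDr // ltW.
Qed.

Lemma mollifier_peak p : (1 < p)%N -> exists2 C : R, 0 < C &
  forall j z, `|mollifier p j z| <= C * peak (tau j `^ (1 / p%:R)) z.
Proof.
move=> p1; have p0 : (0 < p)%N by exact: ltnW.
have [C C0 PC] := kernel_peak (R := R) 0 p0.
exists C => // j z; set s := tau j `^ (1 / p%:R).
have s0 : 0 < s by rewrite powR_gt0 // tau_gt0.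
have s1 : s <= 1.
  have := @ge0_ler_powR R (1 / p%:R) _ (tau j) 1; rewrite powR1; apply; rewrite ?nnegrE ?tau_le1 //.
  exact: ltW (tau_gt0 _).
have := PC false s j.+1 z; rewrite expr0 divr1 /s powR_root ?tau_gt0 //.
by apply=> //; rewrite -/s // (scale_admissible p1) ?tau_gt0 ?tau_admissible.
Qed.

Definition sin_holder beta N u :=
  (forall s s' t, `|u (s', t) - u (s, t)| <= N * `|sin (pi * (s - s'))| `^ beta) /\
  (forall s t t', `|u (s, t') - u (s, t)| <= N * `|sin (pi * (t - t'))| `^ beta).

(** As the kernel has integral 1, the error is its integral against an increment
    of [u], which splits into a step in each variable. *)
Lemma product_kernel_approx be s1 s2 A B N (d1 d2 : R -> R) u x :
  0 < be -> be < 1 -> 0 < s1 -> 0 < s2 -> 0 <= A -> 0 <= B -> 0 <= N ->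
  continuous d1 -> continuous d2 -> continuous u ->
  (forall z, `|d1 z| <= A * peak s1 z) -> (forall z, `|d2 z| <= B * peak s2 z) ->
  I2 (fun y : R * R => d1 (x.1 - y.1) * d2 (x.2 - y.2)) = 1 -> sin_holder be N u ->
  `|I2 (fun y => u y * (d1 (x.1 - y.1) * d2 (x.2 - y.2))) - u x| <=
    A * B * N * (4 / (1 - be) * (s1 `^ be + s2 `^ be)).
Proof.
move=> be0 be1 s10 s20 A0 B0 N0 cd1 cd2 cu PA PB mass [h1 h2].
have w10 := @weight_continuous R 0 s1 s10; have w1b := @weight_continuous R be s1 s10.
have w20 := @weight_continuous R 0 s2 s20; have w2b := @weight_continuous R be s2 s20.
pose W1 y := weight be s1 (x.1 - y.1) * weight 0 s2 (x.2 - y.2).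
pose W2 y := weight 0 s1 (x.1 - y.1) * weight be s2 (x.2 - y.2).
have cW1 : continuous W1 by rewrite /W1; continuity.
have cW2 : continuous W2 by rewrite /W2; continuity.
pose d y := d1 (x.1 - y.1) * d2 (x.2 - y.2).
have cd : continuous d by rewrite /d; continuity.
pose D y := (u y - u x) * d y.
have cD : continuous D.
  apply: continuous_mul => //; apply: continuous_add => //; exact: continuous_const.
have cud : continuous (fun y => u y * d y) by continuity.
have e : I2 (fun y => u y * d y) - u x = I2 D.
  have := I2_linear (- u x) cd cud; rewrite mass mulr1 addrC => <-.
  by congr I2; apply/funext => y; rewrite /D; ring.
pose W y := A * B * N * (1 * W1 y + W2 y).
have cJ : continuous (fun y => 1 * W1 y + W2 y) by continuity.
have cW : continuous W by rewrite /W; continuity.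
have le y : `|D y| <= W y.
  have du : `|u y - u x| <= N * `|sin (pi * (x.1 - y.1))| `^ be + N * `|sin (pi * (x.2 - y.2))| `^ be.
    have g1 := h1 x.1 y.1 y.2; have g2 := h2 x.1 x.2 y.2.
    rewrite -surjective_pairing in g1; rewrite -surjective_pairing in g2.
    rewrite (_ : u y - u x = (u y - u (x.1, y.2)) + (u (x.1, y.2) - u x)); last by ring.
    by rewrite (le_trans (ler_normD _ _)) // lerD.
  have k1 := peak_le_weight (x.1 - y.1) be0 s10.
  have k2 := peak_le_weight (x.2 - y.2) be0 s20.
  have p1 := peak_ge0 (x.1 - y.1) s10; have p2 := peak_ge0 (x.2 - y.2) s20.
  rewrite normrM [`|d y|]normrM.
  apply: (@le_trans _ _ ((N * `|sin (pi * (x.1 - y.1))| `^ be + N * `|sin (pi * (x.2 - y.2))| `^ be)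
     * ((A * peak s1 (x.1 - y.1)) * (B * peak s2 (x.2 - y.2))))).
    by rewrite ler_pM ?mulr_ge0 // ler_pM.
  rewrite /W /W1 /W2 !weight0 // mul1r.
  rewrite [leLHS](_ : _ = A * B * N *
    ((peak s1 (x.1 - y.1) * `|sin (pi * (x.1 - y.1))| `^ be) * peak s2 (x.2 - y.2) +
     peak s1 (x.1 - y.1) * (peak s2 (x.2 - y.2) * `|sin (pi * (x.2 - y.2))| `^ be))); last by ring.
  rewrite ler_wpM2l ?mulr_ge0 //.
  by rewrite lerD // ?ler_wpM2r // ler_wpM2l.
have IW : I2 W <= A * B * N * (4 / (1 - be) * (s1 `^ be + s2 `^ be)).
  rewrite I2Z // I2_linear // mul1r.
  have t1b : continuous (fun t : R => weight be s1 (x.1 - t)) by continuity.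
  have t10 : continuous (fun t : R => weight 0 s1 (x.1 - t)) by continuity.
  have t2b : continuous (fun t : R => weight be s2 (x.2 - t)) by continuity.
  have t20 : continuous (fun t : R => weight 0 s2 (x.2 - t)) by continuity.
  rewrite (I2_tensor t1b t20) (I2_tensor t10 t2b).
  have pos (b s z : R) : 0 < s -> 0 <= I1 (fun t => weight b s (z - t)).
    by move=> s0; apply: Rintegral_ge0 => t _; rewrite mulr_ge0 ?powR_ge0 // ltW.
  have a1 := I1_weight x.1 be1 s10; have a2 := I1_weight x.2 be1 s20.
  have a3 := I1_weight x.1 (@ltr01 R) s10; have a4 := I1_weight x.2 (@ltr01 R) s20.
  rewrite subr0 divr1 powRr0 mulr1 in a3; rewrite subr0 divr1 powRr0 mulr1 in a4.
  apply: ler_wpM2l; first by rewrite !mulr_ge0.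
  rewrite [leRHS](_ : _ = (2 / (1 - be) * s1 `^ be) * 2 + 2 * (2 / (1 - be) * s2 `^ be)); last by ring.
  by apply: lerD; (apply: ler_pM; [exact: pos|exact: pos| |]).
rewrite e ler_norml.
have q1 : I2 D <= I2 W by apply: I2_le => // y _; rewrite (le_trans _ (le y)) // ler_norm.
have q2 : - I2 W <= I2 D.
  rewrite -mulN1r -I2Z //; apply: I2_le => [|//|y _]; first by continuity.
  by rewrite mulN1r lerNl (le_trans _ (le y)) // -normrN ler_norm.
by apply/andP; split; lra.
Qed.

(** The scale tau^(1/3) in the first variable is the coarser one, and the
    Hoelder exponent 1 / 3 of [u] turns it into tau^(1/9). *)
Lemma conv_approx : exists2 C : R, 0 < C & forall N u j x,
  continuous u -> 0 <= N -> sin_holder (1 / 3) N u ->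
  `|conv u j x - u x| <= C * N * tau j `^ (1 / 9).
Proof.
have [A A0 PA] := mollifier_peak (isT : (1 < 3)%N).
have [B B0 PB] := mollifier_peak (isT : (1 < 2)%N).
exists (12 * (A * B)) => [|N u j x cu N0 hu]; first by rewrite !mulr_gt0.
have t0 := tau_gt0 j.
have s10 : 0 < tau j `^ (1 / 3) by rewrite powR_gt0.
have s20 : 0 < tau j `^ (1 / 2) by rewrite powR_gt0.
have be0 : 0 < 1 / 3 :> R by rewrite divr_gt0.
have be1 : 1 / 3 < 1 :> R by rewrite ltr_pdivrMr // mul1r ltr1n.
have := product_kernel_approx be0 be1 s10 s20 (ltW A0) (ltW B0) N0
  (@mollifier_continuous 3 j) (@mollifier_continuous 2 j) cu (PA j) (PB j) (I2_delta j x) hu.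
move=> le; apply: (le_trans le).
have e1 : (tau j `^ (1 / 3)) `^ (1 / 3) = tau j `^ (1 / 9).
  by rewrite -powRrM; congr (_ `^ _); field.
have e2 : (tau j `^ (1 / 2)) `^ (1 / 3) <= tau j `^ (1 / 9).
  rewrite -powRrM (_ : 1 / 2 * (1 / 3) = 1 / 6); last by field.
  apply: ger_powR; first by rewrite t0 tau_le1.
  by rewrite ler_pdivrMr // mulrAC ler_pdivlMr // !mul1r ler_nat.
rewrite e1; move: (tau j `^ (1 / 9)) e2 => r e2.
have -> : 4 / (1 - 1 / 3) = 6 :> R by field.
have AB : 0 <= A * B * N by rewrite !mulr_ge0 // ltW.
rewrite [leRHS](_ : _ = A * B * N * (6 * (r + r))); last by ring.
by rewrite ler_wpM2l // ler_pM2l // lerD2l.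
Qed.

End Regularization.

(** * Convergence of the regularizations *)

Section Periodicity.
Context {R : realType}.
Implicit Types (phi psi u F : R * R -> R) (x y : R * R) (w : seq bool).
Implicit Types (n m j : nat) (b i : bool) (s t z beta N e : R).
Implicit Types (T : (R * R -> R) -> R) (g : R -> R).

Lemma periodic_int g (n : int) s : (forall t, g (t + 1) = g t) -> g (s + n%:~R) = g s.
Proof.
move=> pg; have pn m t : g (t + m%:R) = g t.
  elim: m t => [|m IH] t; first by rewrite addr0.
  by rewrite -natr1 addrA pg.
case: n => m; first exact: pn.
by rewrite NegzE mulrNz -(pn m.+1 (s - _)) subrK.
Qed.

Lemma near_integer z : exists n : int, `|z + n%:~R| <= 1 / 2.
Proof.
exists (- Num.floor (z + 1 / 2)); rewrite mulrNz ler_norml.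
have := floor_itv (z + 1 / 2); rewrite intrD => /andP[h1 h2].
by apply/andP; split; lra.
Qed.

Lemma norm_sin_ge z : `|z| <= 1 / 2 -> `|z| <= `|sin (pi * z)|.
Proof.
move=> z2; have z1 : 0 <= `|z| <= 1 / 2 by rewrite normr_ge0.
apply: le_trans (sin_ge_id z1) _.
have [z0|z0] := leP 0 z; first by rewrite (ger0_norm z0) ler_norm.
by rewrite (ltr0_norm z0) mulrN sinN -normrN ler_norm.
Qed.

(** The chordal distance on the circle replaces the distance to the nearest
    integer. *)
Lemma periodic_sin_holder g N beta : 0 <= N -> 0 <= beta ->
  (forall t, g (t + 1) = g t) ->
  (forall s h, `|h| <= 1 / 2 -> `|g (s + h) - g s| <= N * `|h| `^ beta) ->
  forall s s', `|g s' - g s| <= N * `|sin (pi * (s - s'))| `^ beta.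
Proof.
move=> N0 b0 pg hg s s'; have [n hn] := near_integer (s' - s).
have := hg s _ hn; rewrite (_ : s + (s' - s + n%:~R) = s' + n%:~R); last by ring.
rewrite periodic_int // => le.
apply: (le_trans le); rewrite ler_wpM2l // ge0_ler_powR ?nnegrE //.
apply: (le_trans (norm_sin_ge hn)).
rewrite (@periodic_int (fun t => `|sin (pi * t)|)); last exact: norm_sin_pi_periodic.
by rewrite -opprB mulrN sinN normrN.
Qed.

Lemma periodic_bounded F : continuous F -> periodic2 F ->
  exists2 M, 0 <= M & forall x, `|F x| <= M.
Proof.
move=> cF pF; have [M MP] := continuous_bounded_cell cF.
exists `|M| => // x; pose n1 := - Num.floor x.1; pose n2 := - Num.floor x.2.
have e1 : F (x.1 + n1%:~R, x.2) = F x.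
  rewrite (@periodic_int (fun t => F (t, x.2))) -?surjective_pairing // => t.
  by have [h _] := pF (t, x.2).
have e2 : F (x.1 + n1%:~R, x.2 + n2%:~R) = F (x.1 + n1%:~R, x.2).
  rewrite (@periodic_int (fun t => F (x.1 + n1%:~R, t))) // => t.
  by have [_ h] := pF (x.1 + n1%:~R, t).
rewrite -e1 -e2; apply: le_trans (ler_norm M); apply: MP.
have fl z : 0 <= z + (- Num.floor z)%:~R < 1.
  by have := floor_itv z; rewrite intrD mulrNz => /andP[h1 h2]; apply/andP; split; lra.
by split; rewrite /= in_itv /= fl.
Qed.

Lemma test_sin_holder phi : test phi -> exists2 N, 0 <= N & sin_holder (1 / 3) N phi.
Proof.
move=> tp; have [pp _] := tp.
have td i := test_pderiv i tp.
have [M1 M10 MP1] := periodic_bounded (test_continuous (td true)) (td true).1.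
have [M2 M20 MP2] := periodic_bounded (test_continuous (td false)) (td false).1.
have small (h : R) : `|h| <= 1 / 2 -> `|h| <= `|h| `^ (1 / 3).
  move=> h2; have [->|h0] := eqVneq h 0; first by rewrite normr0 powR_ge0.
  apply: ger1_powR; first by rewrite normr_gt0 h0 /=; lra.
  by rewrite ler_pdivrMr // mul1r ler1n.
have b0 : 0 <= 1 / 3 :> R by rewrite divr_ge0.
have M0 : 0 <= M1 + M2 by rewrite addr_ge0.
exists (M1 + M2) => //; split => [s s' t|s t t'].
- apply: (@periodic_sin_holder (fun r => phi (r, t))) => // [r|r h h2].
    by have [h _] := pp (r, t).
  have d (r' : R) : is_derive r' 1 (fun r : R => phi (r, t)) (pderiv true phi (r', t)).
    exact: (iffLR (@is_derive_slice1 _ phi (r', t) _) (test_derive true (r', t) tp)).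
  have [k _ ->] := mean_value_abs r h d.
  rewrite normrM ler_pM // ?small // (le_trans (MP1 _)) //; lra.
- apply: (@periodic_sin_holder (fun r => phi (s, r))) => // [r|r h h2].
    by have [_ h] := pp (s, r).
  have d (r' : R) : is_derive r' 1 (fun r : R => phi (s, r)) (pderiv false phi (s, r')).
    exact: (iffLR (@is_derive_slice2 _ phi (s, r') _) (test_derive false (s, r') tp)).
  have [k _ ->] := mean_value_abs r h d.
  rewrite normrM ler_pM // ?small // (le_trans (MP2 _)) //; lra.
Qed.

Lemma words_bound (P : seq bool -> R -> Prop) n :
  (forall w (a b : R), a <= b -> P w a -> P w b) ->
  (forall w, exists B, P w B) -> exists B, forall w, (size w <= n)%N -> P w B.
Proof.
elim: n P => [|n IH] P mono ex.
  by have [B PB] := ex [::]; exists B => -[].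
have [||B PB] := IH (fun w B => [/\ P w B, P (true :: w) B & P (false :: w) B]).
- move=> w a b ab [h1 h2 h3].
  by split; [exact: mono h1|exact: mono h2|exact: mono h3].
- move=> w; have [B1 P1] := ex w; have [B2 P2] := ex (true :: w).
  have [B3 P3] := ex (false :: w).
  exists (Num.max B1 (Num.max B2 B3)).
  split; [apply: mono P1|apply: mono P2|apply: mono P3]; rewrite !le_max lexx ?orbT //.
exists B => -[_|[] w /= sw]; first by have [] := PB [::] isT.
  by have [_ h _] := PB w sw.
by have [_ _ h] := PB w sw.
Qed.

Lemma is_derive_dir_sum (I : Type) (r : seq I) (F : I -> R * R -> R) (dF : I -> R) i x :
  (forall k, is_derive x (dir i) (F k) (dF k)) ->
  is_derive x (dir i) (fun y => \sum_(k <- r) F k y) (\sum_(k <- r) dF k).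
Proof.
move=> d; elim: r => [|k r IH].
  by rewrite big_nil; under eq_fun do rewrite big_nil; exact: is_derive_cst.
by rewrite big_cons; under eq_fun do rewrite big_cons; exact: is_deriveD.
Qed.

(** At a fixed frequency, the sum of the modes over the four parities is a
    function of x - y, so that its derivatives in x and in y cancel. *)
Lemma mode_transport j i x y : \sum_(k : modes j) amplitude k *
  (pderiv i (mode k) x * mode k y + mode k x * pderiv i (mode k) y) = 0.
Proof.
have -> : \sum_(k : modes j) amplitude k *
  (pderiv i (mode k) x * mode k y + mode k x * pderiv i (mode k) y) =
    \sum_(a : 'I_j.+2 * 'I_j.+2) \sum_(b : bool * bool)
      amplitude ((a, b) : modes j) * (pderiv i (mode ((a, b) : modes j)) x * mode ((a, b) : modes j) y
       + mode ((a, b) : modes j) x * pderiv i (mode ((a, b) : modes j)) y).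
  by rewrite pair_bigA; apply: eq_bigr => -[].
rewrite big1 // => a _.
have -> : \sum_(b : bool * bool) amplitude ((a, b) : modes j) *
  (pderiv i (mode ((a, b) : modes j)) x * mode ((a, b) : modes j) y
       + mode ((a, b) : modes j) x * pderiv i (mode ((a, b) : modes j)) y) =
   \sum_(b1 : bool) \sum_(b2 : bool) amplitude ((a, (b1, b2)) : modes j) *
  (pderiv i (mode ((a, (b1, b2)) : modes j)) x * mode ((a, (b1, b2)) : modes j) y
       + mode ((a, (b1, b2)) : modes j) x * pderiv i (mode ((a, (b1, b2)) : modes j)) y).
  by rewrite pair_bigA; apply: eq_bigr => -[].
rewrite !big_bool /= /amplitude /mode /= !pderiv_tensor /dtensor /tensor /tsgn.
by case: i => /=; ring.
Qed.

(** The derivative of the kernel in x is transferred to y by [mode_transport],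
    and to [phi] by an integration by parts. *)
Lemma pderiv_conv phi j i : test phi -> pderiv i (conv phi j) = conv (pderiv i phi) j.
Proof.
move=> tp; have cp := test_continuous tp; have cd := test_continuous (test_pderiv i tp).
have cm (k : modes j) : continuous (mode k : R * R -> R) by exact: mode_continuous.
have cdm (k : modes j) : continuous (pderiv i (mode k) : R * R -> R).
  exact: test_continuous (test_pderiv i (test_mode k)).
rewrite !conv_expand //; apply/funext => x; apply: pderivE.
have -> : \sum_(k : modes j) amplitude k * I2 (fun y => pderiv i phi y * mode k y) * mode k x =
    \sum_(k : modes j) amplitude k * I2 (fun y => phi y * mode k y) * pderiv i (mode k) x.
  apply/eqP; rewrite eq_sym -subr_eq0 -sumrB; apply/eqP.
  transitivity (\sum_(k : modes j) 1 * I2 (fun y => phi y * (amplitude k *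
      (pderiv i (mode k) x * mode k y + mode k x * pderiv i (mode k) y)))).
    apply: eq_bigr => k _; rewrite I2_by_parts //; last exact: test_mode.
    have ck := cm k; have cdk := cdm k.
    rewrite (_ : (fun y => phi y * (amplitude k * _)) = fun y =>
       (amplitude k * pderiv i (mode k) x) * (phi y * mode k y) +
       (amplitude k * mode k x) * (phi y * pderiv i (mode k) y)); last first.
      by apply/funext => y; ring.
    have c1 : continuous (fun y => phi y * mode k y) by exact: continuous_mul.
    have c2 : continuous (fun y => phi y * pderiv i (mode k) y) by exact: continuous_mul.
    rewrite I2_linear // ?I2Z //; first by ring.
    by apply: continuous_mul => //; exact: continuous_const.
  rewrite -I2_sum; last first.
    move=> k; apply: continuous_mul => //; apply: continuous_mul; first exact: continuous_const.
    by apply: continuous_add; apply: continuous_mul => //; exact: continuous_const.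
  rewrite (_ : (fun y => _) = fun=> 0); first exact: I2_cst.
  apply/funext => y; under eq_bigr do rewrite mul1r.
  by rewrite -mulr_sumr mode_transport mulr0.
apply: is_derive_dir_sum => k; apply: is_deriveZ.
exact: test_derive (test_mode k).
Qed.

Lemma pderivs_conv phi j w : test phi -> pderivs w (conv phi j) = conv (pderivs w phi) j.
Proof.
move=> tp; elim: w => [//|i w IH] /=; rewrite -/(pderivs w _) IH pderiv_conv //.
exact: test_pderivs.
Qed.

Lemma tau_rate (g e : R) : 0 < g -> 0 < e -> exists J, forall j, (J <= j)%N -> tau j `^ g <= e.
Proof.
move=> g0 e0; pose d := e `^ g^-1; exists (Num.truncn d^-1) => j Jj.
have d0 : 0 < d by rewrite powR_gt0.
have le : tau j <= d.
  rewrite /tau invf_ple ?posrE ?ltr0n //.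
  by rewrite (le_trans (ltW (truncnS_gt _))) // ler_nat ltnS.
have -> : e = d `^ g by rewrite /d -powRrM mulVf ?gt_eqF // powRr1 // ltW.
by rewrite ge0_ler_powR ?nnegrE ?(ltW g0) ?(ltW d0) ?(ltW (tau_gt0 j)).
Qed.

(** Since derivatives commute with the regularization, [conv_approx] applies
    to each of the derivatives of [phi] that control [T]. *)
Lemma dist_conv_cvg T phi e : periodic_distribution T -> test phi -> 0 < e ->
  exists J, forall j, (J <= j)%N -> `|T (conv phi j) - T phi| <= e.
Proof.
move=> dT tp e0; have [C C0 PC] := conv_approx (R := R).
have [_ [K [n Kn]]] := dT.
have [||B PB] := @words_bound (fun w B => forall j x,
    `|conv (pderivs w phi) j x - pderivs w phi x| <= B * tau j `^ (1 / 9)) n.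
- by move=> w a b ab h j x; rewrite (le_trans (h j x)) // ler_wpM2r // powR_ge0.
- move=> w; have tw := test_pderivs w tp; have [N N0 hN] := test_sin_holder tw.
  by exists (C * N) => j x; apply: PC => //; exact: test_continuous.
pose Q := `|K| * `|B| + 1; have Q0 : 0 < Q by rewrite ltr_wpDl // mulr_ge0.
have eQ : 0 < e / Q by rewrite divr_gt0.
have [J JP] := @tau_rate (1 / 9) _ (divr_gt0 ltr01 (ltr0Sn _ _)) eQ.
exists J => j Jj; have cp := test_continuous tp; have tc := test_conv j cp.
rewrite (_ : T (conv phi j) - T phi = T (fun x => -1 * phi x + conv phi j x)); last first.
  by rewrite dist_linear //; ring.
apply: le_trans (Kn _ (`|B| * tau j `^ (1 / 9)) _ _) _.
- exact: test_linear.
- move=> w x wn; rewrite pderivs_linear; [|exact: tp.2|exact: tc.2].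
  rewrite pderivs_conv // addrC mulN1r (le_trans (PB _ wn j x)) //.
  by rewrite ler_wpM2r ?powR_ge0 // ler_norm.
rewrite (le_trans (ler_norm _)) // normrM (@ger0_norm _ (_ * _)) ?mulr_ge0 ?powR_ge0 //.
apply: (@le_trans _ _ (Q * (e / Q))); last by rewrite mulrC divfK // gt_eqF.
rewrite mulrA; apply: ler_pM; rewrite ?mulr_ge0 ?powR_ge0 ?JP //.
by rewrite lerDl.
Qed.

Lemma cauchy_limit (u e : nat -> R) : (forall j k, `|u j - u k| <= e j + e k) ->
  (forall r, 0 < r -> exists J, forall j, (J <= j)%N -> e j <= r) ->
  forall j, `|u j - lim (u @ \oo)| <= e j.
Proof.
move=> ue e0; have cu : cvg (u @ \oo).
  apply: cauchy_cvg; apply: cauchy_exP => r r0.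
  have [J JP] := e0 (r / 4) (divr_gt0 r0 (ltr0Sn _ _)).
  exists (u J); exists J => // j /= Jj; rewrite /ball /=.
  have := ue J j; have := JP J (leqnn _); have := JP j Jj; lra.
move=> j; apply/ler_addgt0Pr => r r0.
have r2 : 0 < r / 2 by rewrite divr_gt0.
have [I _ IP] := (iffLR (cvgrPdist_le _ _) cu) _ r2.
have [J JP] := e0 _ r2.
pose k := maxn I J; have := IP k (leq_maxl _ _); have := JP k (leq_maxr _ _).
have := ue j k; rewrite distrC => h1 h2 h3.
have := ler_normD (u j - u k) (u k - lim (u @ \oo)).
rewrite addrA subrK distrC => h4.
have : `|u k - lim (u @ \oo)| <= r / 2 by rewrite distrC.
rewrite distrC in h1; move: h4; rewrite distrC; lra.
Qed.

End Periodicity.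

(** * The function representing a distribution *)

Section Density.
Context {R : realType}.
Implicit Types (phi u F G D : R * R -> R) (x y : R * R) (T : (R * R -> R) -> R).
Implicit Types (j : nat) (h b g p e N K : R) (f : R -> R).

Lemma le_fraction (k N z e : R) : 0 < k -> 0 <= N -> 0 <= z -> z <= e / (k * (N + 1)) ->
  N * z <= e / k.
Proof.
move=> k0 N0 z0 ze; have N1 : 0 < N + 1 by rewrite ltr_wpDl.
apply: (@le_trans _ _ (e / (k * (N + 1)) * (N + 1))).
  by rewrite mulrC ler_pM // lerDl.
by rewrite invfM mulrA divfK // gt_eqF.
Qed.

Lemma powR_small b g h : 0 < b -> b <= g -> `|h| <= 1 / 2 -> `|h| `^ g <= `|h| `^ b.
Proof.
move=> b0 bg h2; have g0 : 0 < g by exact: lt_le_trans bg.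
have [->|h0] := eqVneq h 0; first by rewrite normr0 !powR0 // gt_eqF.
by apply: ger_powR => //; rewrite normr_gt0 h0 /=; lra.
Qed.

Lemma powR_near g e : 0 < g -> 0 < e ->
  exists2 d, 0 < d & forall h, `|h| < d -> `|h| `^ g <= e.
Proof.
move=> g0 e0; exists (e `^ g^-1) => [|h hd]; first by rewrite powR_gt0.
rewrite -[leRHS](_ : (e `^ g^-1) `^ g = e); last first.
  by rewrite -powRrM mulVf ?gt_eqF // powRr1 // ltW.
by rewrite ge0_ler_powR ?nnegrE ?powR_ge0 ?(ltW g0) ?(ltW hd).
Qed.

Lemma sin_holder_continuous b N F : 0 < b -> 0 <= N -> sin_holder b N F -> continuous F.
Proof.
move=> b0 N0 [h1 h2] x; apply/cvgrPdist_le => e e0.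
have N1 : 0 < 2 * (N + 1) by rewrite mulr_gt0 // ltr_wpDl.
have [d d0 dP] := powR_near b0 (divr_gt0 e0 N1).
have c1 : continuous (fun y : R * R => sin (pi * (x.1 - y.1))).
  by apply: (continuous_compose (@continuous_sin _)); continuity.
have c2 : continuous (fun y : R * R => sin (pi * (x.2 - y.2))).
  by apply: (continuous_compose (@continuous_sin _)); continuity.
move/cvgrPdist_lt: (c1 x) => /(_ d d0) n1; move/cvgrPdist_lt: (c2 x) => /(_ d d0) n2.
apply: filterS2 n1 n2 => y; rewrite /= !subrr !mulr0 !sin0 !sub0r !normrN => y1 y2.
have g1 := h1 x.1 y.1 y.2; have g2 := h2 x.1 x.2 y.2.
rewrite -surjective_pairing in g1; rewrite -surjective_pairing in g2.
rewrite distrC (_ : F y - F x = (F y - F (x.1, y.2)) + (F (x.1, y.2) - F x)); last by ring.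
rewrite (le_trans (ler_normD _ _)) // (le_trans (lerD g1 g2)) //.
rewrite (_ : e = e / 2 + e / 2); last by field.
by rewrite lerD // le_fraction ?powR_ge0 ?dP.
Qed.

(** A first order expansion in the first variable, with slope [D], and a
    modulus of continuity in the second one, at the scales of the anisotropic
    distance. *)
Definition expansion p N F D :=
  (forall x h, `|F (x.1, x.2 + h) - F x| <= N * `|h| `^ (2 * p / 3)) /\
  (forall x h, `|F (x.1 + h, x.2) - F x - h * D x| <= N * `|h| `^ p).

(** By periodicity, a step of length 1 sees only the slope. *)
Lemma expansion_slope p N F D x : periodic2 F -> expansion p N F D -> `|D x| <= N.
Proof.
move=> pF [_ h]; have := h x 1; have [-> _] := pF x.
by rewrite subrr sub0r mul1r !normrN normr1 powR1 mulr1.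
Qed.

Lemma expansion_sin_holder b p N F D : periodic2 F -> 0 <= N -> 0 < b -> b <= 2 * p / 3 ->
  b <= 1 -> expansion p N F D -> sin_holder b (2 * N) F.
Proof.
move=> pF N0 b0 bp b1 ex; have [h2 h1] := ex; have N20 : 0 <= 2 * N by rewrite mulr_ge0.
split => [s s' t|s t t'].
- apply: (@periodic_sin_holder _ (fun r => F (r, t))) => // [|r|r h hh]; first exact: ltW.
    by have [] := pF (r, t).
  have g := h1 (r, t) h; have dN := expansion_slope (r, t) pF ex.
  rewrite (_ : _ - _ = (F (r + h, t) - F (r, t) - h * D (r, t)) + h * D (r, t)); last by ring.
  rewrite (le_trans (ler_normD _ _)) // normrM mulr2n mulrDl mul1r [leRHS]mulrDl.
  apply: lerD; first by rewrite (le_trans g) // ler_wpM2l // powR_small //; lra.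
  rewrite mulrC ler_pM // -[leLHS]powRr1 //.
  exact: powR_small.
- apply: (@periodic_sin_holder _ (fun r => F (s, r))) => // [|r|r h hh]; first exact: ltW.
    by have [] := pF (s, r).
  apply: (le_trans (h2 (s, r) h)); apply: ler_pM; rewrite ?powR_ge0 //; first by lra.
  exact: powR_small.
Qed.

Lemma I2_norm_le u K : continuous u -> (forall x, `|u x| <= K) -> `|I2 u| <= K.
Proof.
move=> cu uK; have cK : continuous (fun _ : R * R => K) by exact: continuous_const.
have cK' : continuous (fun _ : R * R => - K) by exact: continuous_const.
rewrite ler_norml; apply/andP; split; [rewrite -(I2_cst (- K))|rewrite -[leRHS]I2_cst];
  by apply: I2_le => // x _; have := uK x; rewrite ler_norml => /andP[].
Qed.

(** If the increments of [f] at 0 are affine up to errors of order [p > 1]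
    and up to arbitrarily small errors, then the difference quotients at 0
    form a Cauchy family. *)
Lemma approximate_slope f p N : 1 < p -> 0 <= N ->
  (forall e, 0 < e -> exists d, forall h, `|f h - h * d| <= N * `|h| `^ p + e) ->
  exists d, forall h, `|f h - h * d| <= N * `|h| `^ p.
Proof.
move=> p1 N0 ap; have p0 : 0 < p - 1 by rewrite subr_gt0.
pose q n := f (tau n) / tau n.
have quot e n d : 0 < e -> (forall h, `|f h - h * d| <= N * `|h| `^ p + e) ->
    `|q n - d| <= N * tau n `^ (p - 1) + e / tau n.
  move=> e0 /(_ (tau n)); have t0 := @tau_gt0 R n; rewrite (gtr0_norm t0) => le.
  have t1 : 0 <= (tau n)^-1 :> R by rewrite invr_ge0 ltW.
  have := ler_wpM2r t1 le; rewrite -{1}(ger0_norm t1) -normrM mulrBl mulrAC mulfV ?gt_eqF // mul1r.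
  move=> /le_trans; apply; rewrite mulrDl lerD // -mulrA ler_wpM2l //.
  by rewrite -[in leLHS](subrK 1 p) (powR_add (p - 1) 1 t0) powRr1 ?(ltW t0) // mulfK ?gt_eqF.
have cau n m : `|q n - q m| <= N * tau n `^ (p - 1) + N * tau m `^ (p - 1).
  apply/ler_addgt0Pr => e e0.
  have s0 : 0 < (tau n)^-1 + (tau m)^-1 :> R by rewrite addr_gt0 // invr_gt0 tau_gt0.
  have r0 : 0 < e / ((tau n)^-1 + (tau m)^-1) by rewrite divr_gt0.
  have [d dP] := ap _ r0.
  have q1 := quot _ n d r0 dP; have q2 := quot _ m d r0 dP.
  rewrite (_ : q n - q m = (q n - d) - (q m - d)); last by ring.
  rewrite (le_trans (ler_normB _ _)) // (le_trans (lerD q1 q2)) //.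
  set c := e / (_ + _); have -> : e = c * (tau n)^-1 + c * (tau m)^-1.
    by rewrite -mulrDr divfK // gt_eqF.
  by rewrite /q; lra.
have rate e : 0 < e -> exists J, forall j, (J <= j)%N -> N * tau j `^ (p - 1) <= e.
  move=> e0; have N1 : 0 < N + 1 by rewrite ltr_wpDl.
  have [J JP] := tau_rate p0 (divr_gt0 e0 N1); exists J => j Jj.
  rewrite (@le_trans _ _ ((N + 1) * (e / (N + 1)))) //.
    by rewrite ler_pM ?powR_ge0 ?JP // lerDl.
  by rewrite mulrC divfK // gt_eqF.
have lim := cauchy_limit cau rate; set d0 := lim _ in lim.
exists d0 => h; apply/ler_addgt0Pr => e e0.
have h1 : 0 < 2 * (`|h| + 1) by rewrite mulr_gt0 // ltr_wpDl.
have [n /(_ n (leqnn n)) nP] := rate _ (divr_gt0 (divr_gt0 e0 (ltr0Sn _ 1)) h1).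
have s0 : 0 < 1 + `|h| / tau n by rewrite ltr_wpDr // divr_ge0 // ltW // tau_gt0.
have r0 : 0 < e / 2 / (1 + `|h| / tau n) by rewrite !divr_gt0.
have [d dP] := ap _ r0; have q1 := quot _ n d r0 dP; have q2 := lim n.
rewrite (_ : f h - h * d0 = (f h - h * d) + (h * (q n - d0) - h * (q n - d))); last by ring.
rewrite (le_trans (ler_normD _ _)) //.
have le1 := dP h; have le2 := ler_normB (h * (q n - d0)) (h * (q n - d)).
rewrite !normrM in le2.
have le3 : `|h| * `|q n - d0| <= `|h| * (N * tau n `^ (p - 1)) by rewrite ler_wpM2l.
have le4 : `|h| * `|q n - d| <= `|h| * (N * tau n `^ (p - 1) + e / 2 / (1 + `|h| / tau n) / tau n).
  by rewrite ler_wpM2l.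
have le5 : `|h| * (N * tau n `^ (p - 1)) <= e / 4.
  rewrite (_ : e / 4 = e / 2 / 2); last by field.
  by apply: le_fraction; rewrite ?mulr_ge0 ?powR_ge0.
have e6 : e / 2 = e / 2 / (1 + `|h| / tau n) + `|h| * (e / 2 / (1 + `|h| / tau n) / tau n).
  rewrite [RHS](_ : _ = e / 2 / (1 + `|h| / tau n) * (1 + `|h| / tau n)); last by ring.
  by rewrite divfK // gt_eqF.
rewrite mulrDr in le4.
set c := e / 2 / _ in e6 le1 le4; lra.
Qed.

(** Significant only when the regularizations converge. *)
Definition density T x : R := lim ((fun j => reg T j x) @ \oo).

Section Limit.
Variables (T : (R * R -> R) -> R) (N : R).
Hypotheses (dT : periodic_distribution T) (N0 : 0 <= N).
Hypothesis holT : forall j, sin_holder (1 / 3) N (reg T j).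

(** The commutation of two regularizations makes the regularizations of [T] a
    Cauchy sequence. *)
Lemma reg_density e : 0 < e ->
  exists J, forall j, (J <= j)%N -> forall x, `|reg T j x - density T x| <= e.
Proof.
move=> e0; have [C C0 PC] := conv_approx (R := R).
have rate K r : 0 <= K -> 0 < r -> exists J, forall j, (J <= j)%N -> K * tau j `^ (1 / 9) <= r.
  move=> K0 r0; have K1 : 0 < K + 1 by rewrite ltr_wpDl.
  have [J JP] := @tau_rate _ (1 / 9) _ (divr_gt0 ltr01 (ltr0Sn _ _)) (divr_gt0 r0 K1).
  exists J => j Jj; rewrite (@le_trans _ _ ((K + 1) * (r / (K + 1)))) //.
    by rewrite ler_pM ?powR_ge0 ?JP // lerDl.
  by rewrite mulrC divfK // gt_eqF.
have CN : 0 <= C * N by rewrite mulr_ge0 // ltW.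
have [J JP] := rate _ e CN e0; exists J => j Jj x.
apply: le_trans (JP j Jj).
apply: (@cauchy_limit _ (fun j => reg T j x) (fun j => C * N * tau j `^ (1 / 9))).
  move=> i k; have ci := test_continuous (test_reg i dT).
  have ck := test_continuous (test_reg k dT).
  have l1 := PC N _ k x ci N0 (holT i); have l2 := PC N _ i x ck N0 (holT k).
  rewrite reg_conv_comm // in l1.
  rewrite (_ : reg T i x - reg T k x = (conv (reg T k) i x - reg T k x) -
     (conv (reg T k) i x - reg T i x)); last by ring.
  by rewrite (le_trans (ler_normB _ _)) // lerD.
by move=> r r0; exact: rate.
Qed.

Lemma density_periodic : periodic2 (density T).
Proof.
by move=> x; split; congr (lim (_ @ \oo)); apply/funext => j;
  have [pR _] := test_reg j dT; have [] := pR x.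
Qed.

Lemma density_increment x y d e : 0 < e -> exists J, forall j, (J <= j)%N ->
  `|density T y - density T x - d| <= `|reg T j y - reg T j x - d| + e.
Proof.
move=> e0; have [J JP] := reg_density (divr_gt0 e0 (ltr0Sn _ 1)).
exists J => j Jj; have h1 := JP j Jj x; have h2 := JP j Jj y.
rewrite (_ : _ - _ - d = (reg T j y - reg T j x - d) +
  ((reg T j x - density T x) - (reg T j y - density T y))); last by ring.
rewrite (le_trans (ler_normD _ _)) // lerD2l (le_trans (ler_normB _ _)) //; lra.
Qed.

Lemma density_bound x y K : (forall j, `|reg T j y - reg T j x| <= K) ->
  `|density T y - density T x| <= K.
Proof.
move=> h; apply/ler_addgt0Pr => e e0; have [J JP] := density_increment x y 0 e0.
by have := JP J (leqnn J); rewrite !subr0 => /le_trans; apply; rewrite lerD2r.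
Qed.

Lemma density_sin_holder : sin_holder (1 / 3) N (density T).
Proof.
by split => *; apply: density_bound => j; have [h1 h2] := holT j; [exact: h1|exact: h2].
Qed.

Lemma density_continuous : continuous (density T).
Proof. by apply: sin_holder_continuous N0 density_sin_holder; rewrite divr_gt0. Qed.

(** The kernel [delta] can be moved from [T] to the test function, by
    [reg_pairing], and the regularized test functions converge. *)
Lemma density_represents : eq_dist T (dist_of_fun (density T)).
Proof.
move=> phi tp; rewrite /dist_of_fun -/(I2 _); set F := density T.
have cF : continuous F by exact: density_continuous.
have cp := test_continuous tp.
have [M M0 MP] := periodic_bounded cp tp.1.
apply/eqP; rewrite -subr_eq0 -normr_le0; apply/ler_addgt0Pr => e e0; rewrite add0r.
have M1 : 0 < 2 * (M + 1) by rewrite mulr_gt0 // ltr_wpDl.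
have [J1 P1] := dist_conv_cvg dT tp (divr_gt0 e0 (ltr0Sn _ 1)).
have [J2 P2] := reg_density (divr_gt0 e0 M1).
pose j := maxn J1 J2; have h1 := P1 j (leq_maxl _ _); have h2 := P2 j (leq_maxr _ _).
have cj := test_continuous (test_reg j dT).
have c1 : continuous (fun x => reg T j x * phi x) by exact: continuous_mul.
have c2 : continuous (fun x => F x * phi x) by exact: continuous_mul.
have e1 : T (conv phi j) - I2 (fun x => F x * phi x) =
    I2 (fun x => -1 * (F x * phi x) + reg T j x * phi x).
  by rewrite I2_linear // -reg_pairing //; ring.
have h3 : `|I2 (fun x => -1 * (F x * phi x) + reg T j x * phi x)| <= e / 2.
  apply: I2_norm_le.
    by apply: continuous_add => //; apply: continuous_mul => //; exact: continuous_const.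
  move=> x; rewrite (_ : _ + _ = (reg T j x - F x) * phi x); last by ring.
  rewrite normrM; apply: (@le_trans _ _ (e / (2 * (M + 1)) * (M + 1))).
    by rewrite ler_pM // (le_trans (MP x)) // lerDl.
  by rewrite invfM mulrA divfK // gt_eqF // ltr_wpDl.
rewrite (_ : T phi - _ = (T (conv phi j) - I2 (fun x => F x * phi x)) - (T (conv phi j) - T phi)); last by ring.
by rewrite e1 (le_trans (ler_normB _ _)) //; lra.
Qed.

End Limit.

Lemma expansion_is_derive p N F D x : 1 < p -> 0 <= N -> expansion p N F D ->
  is_derive x (dir true) F (D x).
Proof.
move=> p1 N0 [_ ex]; apply/is_derive_slice1.
have p0 : 0 < p - 1 by rewrite subr_gt0.
suff lim : (fun h : R => h^-1 *: (((fun t => F (t, x.2)) \o shift x.1) (h *: (1 : R)) -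
    F (x.1, x.2))) @ 0^' --> D x.
  by split; [apply/cvg_ex; exists (D x)|exact: cvg_lim lim].
apply/cvgrPdist_le => e e0; have N1 : 0 < N + 1 by rewrite ltr_wpDl.
have [d d0 dP] := powR_near p0 (divr_gt0 e0 N1).
near=> h; have h0 : h != 0 by near: h; exact: nbhs_dnbhs_neq.
have hd : `|h| < d by near: h; apply: dnbhs0_lt.
rewrite /= /shift /= /GRing.scale /= mulr1 (addrC h).
have nh : 0 < `|h| by rewrite normr_gt0.
have := ex x h; rewrite {3}[x]surjective_pairing => le.
rewrite (_ : D x - _ = - (h^-1 * (F (x.1 + h, x.2) - F (x.1, x.2) - h * D x))); last first.
  by rewrite [in RHS]mulrBr mulKf // opprB.
rewrite normrN normrM normfV ler_pdivrMl //; apply: (le_trans le).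
rewrite -[in leLHS](subrK 1 p) (powR_add (p - 1) 1 nh) powRr1 // mulrA mulrC ler_pM2l //.
apply: (@le_trans _ _ ((N + 1) * (e / (N + 1)))); last by rewrite mulrC divfK // gt_eqF.
by apply: ler_pM; rewrite ?powR_ge0 ?dP // lerDl.
Unshelve. all: by end_near.
Qed.

(** The slope is the uniform limit of the difference quotients. *)
Lemma expansion_slope_continuous p N F D : 1 < p -> 0 <= N -> continuous F ->
  expansion p N F D -> continuous D.
Proof.
move=> p1 N0 cF [_ ex] x; have p0 : 0 < p - 1 by rewrite subr_gt0.
apply/cvgrPdist_le => e e0; have N1 : 0 < 3 * (N + 1) by rewrite mulr_gt0 // ltr_wpDl.
have [n /(_ n (leqnn n)) nP] := tau_rate p0 (divr_gt0 e0 N1).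
have t0 := @tau_gt0 R n; set t := tau n in nP t0.
pose q y := (F (y.1 + t, y.2) - F y) / t.
have qD y : `|q y - D y| <= e / 3.
  have -> : q y - D y = (F (y.1 + t, y.2) - F y - t * D y) / t.
    by rewrite [RHS]mulrBl mulrAC mulfV ?gt_eqF // mul1r.
  rewrite normrM normfV (gtr0_norm t0) ler_pdivrMr // (le_trans (ex y t)) //.
  rewrite (gtr0_norm t0) -[in leLHS](subrK 1 p) (powR_add (p - 1) 1 t0) powRr1 ?(ltW t0) // mulrA ler_wpM2r ?(ltW t0) //.
  exact: le_fraction (powR_ge0 _ _) nP.
have cq : continuous q.
  have cS : continuous (fun y : R * R => F (y.1 + t, y.2)) by continuity.
  apply: continuous_mul; last exact: continuous_const.
  by apply: continuous_add => //; exact: continuous_opp.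
have e3 : 0 < e / 3 by rewrite divr_gt0.
apply: filterS (iffLR (cvgrPdist_le _ _) (cq x) _ e3) => y /= qy.
have h1 := qD x; have h2 := qD y.
rewrite (_ : D x - D y = (q x - q y) - ((q x - D x) - (q y - D y))); last by ring.
rewrite (le_trans (ler_normB _ _)) //.
have := ler_normB (q x - D x) (q y - D y); lra.
Qed.

Lemma adist_ge0 x y : 0 <= adist x y.
Proof. by rewrite addr_ge0 // powR_ge0. Qed.

Lemma adist_gt0 x y : x != y -> 0 < adist x y.
Proof.
move=> xy; rewrite lt_neqAle adist_ge0 andbT eq_sym; apply: contraNneq xy => d0.
have : `|x.1 - y.1| = 0 /\ `|x.2 - y.2| `^ (2 / 3) = 0.
  have h1 : 0 <= `|x.1 - y.1| by [].
  have h2 := powR_ge0 (`|x.2 - y.2|) (2 / 3).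
  by move: d0; rewrite /adist; lra.
case=> /normr0_eq0/subr0_eq a /powR_eq0_eq0/normr0_eq0/subr0_eq b.
by apply/eqP; rewrite (surjective_pairing x) a b -surjective_pairing.
Qed.

(** From x to y one first moves in the first variable, where the expansion at
    x is used, and then in the second one. *)
Lemma expansion_holder p N F D : 0 < p -> 0 <= N -> expansion p N F D ->
  (forall x, D x = if p <= 1 then 0 else pderiv true F x) ->
  (holder p F <= (2 * N)%:E)%E.
Proof.
move=> p0 N0 [h2 h1] eD; apply: ge_ereal_sup => r [x [y [xy ->]]]; rewrite lee_fin.
have a0 : 0 < adist y x by rewrite adist_gt0 // eq_sym.
rewrite ler_pdivrMr ?powR_gt0 //.
have -> : remainder p F x y = (F (y.1, x.2 + (y.2 - x.2)) - F (y.1, x.2)) +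
    (F (x.1 + (y.1 - x.1), x.2) - F x - (y.1 - x.1) * D x).
  have sub (a b : R) : a + (b - a) = b by rewrite addrC subrK.
  rewrite !sub -surjective_pairing /remainder eD.
  by case: ifP => _; ring.
rewrite (_ : 2 * N * _ = N * adist y x `^ p + N * adist y x `^ p); last by ring.
rewrite (le_trans (ler_normD _ _)) // lerD //.
  rewrite (le_trans (h2 (y.1, x.2) _)) // ler_wpM2l //.
  rewrite (_ : 2 * p / 3 = 2 / 3 * p); last by ring.
  rewrite powRrM ge0_ler_powR ?nnegrE ?powR_ge0 ?(ltW p0) ?(ltW a0) //.
  by rewrite /adist lerDr.
rewrite (le_trans (h1 x _)) // ler_wpM2l //.
by rewrite ge0_ler_powR ?nnegrE ?(ltW p0) ?(ltW a0) // /adist lerDl powR_ge0.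
Qed.

Lemma holder_expansion p K F : 0 < p -> p <= 1 -> (holder p F <= K%:E)%E ->
  expansion p K F (fun=> 0).
Proof.
move=> p0 p1 hK.
have le x y : x != y -> `|F y - F x| <= K * adist y x `^ p.
  move=> xy; have a0 : 0 < adist y x by rewrite adist_gt0 // eq_sym.
  rewrite -ler_pdivrMr ?powR_gt0 // -lee_fin; apply: le_trans hK.
  by apply: ereal_sup_ubound; exists x, y; split=> //; rewrite /remainder p1.
have two : 0 < 2 / 3 :> R by rewrite divr_gt0.
split=> x h; have [->|h0] := eqVneq h 0.
- rewrite addr0 -surjective_pairing subrr normr0 powR0 ?mulr0 //.
  by rewrite gt_eqF // divr_gt0 // mulr_gt0.
- apply: (le_trans (le _ _ _)).
    by apply: contraNneq h0 => /(congr1 snd) /= /esym/eqP; rewrite -subr_eq0 addrAC subrr add0r.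
  rewrite /adist /= subrr normr0 add0r addrAC subrr add0r -powRrM.
  by rewrite (_ : 2 / 3 * p = 2 * p / 3) //; ring.
- by rewrite addr0 -surjective_pairing subrr mul0r subr0 normr0 powR0 ?mulr0 // gt_eqF.
- rewrite mulr0 subr0; apply: (le_trans (le _ _ _)).
    by apply: contraNneq h0 => /(congr1 fst) /= /esym/eqP; rewrite -subr_eq0 addrAC subrr add0r.
  by rewrite /adist /= subrr normr0 (powR0 (lt0r_neq0 two)) addr0 addrAC subrr add0r.
Qed.

(** The exponents p and 2 p / 3 exceed 1 / 3, which makes the regularizations
    uniformly Hoelder and hence uniformly convergent. For p > 1 the slopes of
    the regularizations need not be followed: the slope of the limit is
    recovered from the approximate expansions by [approximate_slope]. *)
Lemma density_regularity p N T : 1 / 2 < p -> p < 3 / 2 -> p <> 1 -> 0 <= N ->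
  periodic_distribution T ->
  (forall j, exists2 D, expansion p N (reg T j) D & p < 1 -> forall x, D x = 0) ->
  represents p (density T) T /\ (holder p (density T) <= (2 * N)%:E)%E.
Proof.
move=> p12 p32 p1 N0 dT ex; have p0 : 0 < p by lra.
have N20 : 0 <= 2 * N by rewrite mulr_ge0.
have hol j : sin_holder (1 / 3) (2 * N) (reg T j).
  have [D eD _] := ex j; have [pR _] := test_reg j dT.
  by apply: expansion_sin_holder pR N0 _ _ _ eD; lra.
have pF := density_periodic dT.
have cF := density_continuous dT N20 hol.
have h2 x h : `|density T (x.1, x.2 + h) - density T x| <= N * `|h| `^ (2 * p / 3).
  by apply: density_bound dT N20 hol _ _ _ _ => j; have [D [+ _] _] := ex j; apply.
have [D eD D0] : exists2 D, expansion p N (density T) D & p <= 1 -> forall x, D x = 0.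
  have [le1|gt1] := leP p 1.
    exists (fun=> 0) => //; split=> // x h; rewrite mulr0 subr0.
    apply: density_bound dT N20 hol _ _ _ _ => j; have [D [_ hD] D0] := ex j.
    have := hD x h; rewrite D0 ?mulr0 ?subr0 // lt_neqAle le1 andbT.
    exact/eqP.
  have slope x : exists d, forall h,
      `|density T (x.1 + h, x.2) - density T x - h * d| <= N * `|h| `^ p.
    apply: (@approximate_slope (fun h => density T (x.1 + h, x.2) - density T x)) => // e e0.
    have [J JP] := reg_density dT N20 hol (divr_gt0 e0 (ltr0Sn _ 1)).
    have [D [_ hD] _] := ex J; exists (D x) => h.
    have h3 := JP J (leqnn J) x; have h4 := JP J (leqnn J) (x.1 + h, x.2); have h5 := hD x h.
    rewrite (_ : _ - _ - _ = (reg T J (x.1 + h, x.2) - reg T J x - h * D x) +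
      ((reg T J x - density T x) - (reg T J (x.1 + h, x.2) - density T (x.1 + h, x.2)))); last by ring.
    rewrite (le_trans (ler_normD _ _)) // lerD // (le_trans (ler_normB _ _)) //; lra.
  by have [D HD] := choice slope; exists D.
have dF x : 1 < p -> is_derive x (dir true) (density T) (D x).
  by move=> gt1; exact: expansion_is_derive eD.
have eP : 1 < p -> pderiv true (density T) = D.
  by move=> gt1; apply/funext => x; apply: pderivE; exact: dF.
split; last first.
  apply: expansion_holder eD _ => // x; case: leP => [le1|gt1]; first exact: D0.
  by rewrite eP.
split=> //; last exact: density_represents N20 hol.
split=> // gt1; split => [x|]; first by case: (dF x gt1).
by rewrite eP //; exact: expansion_slope_continuous eD.
Qed.

End Density.

(** * The multipliers on products of trigonometric functions *)

Section Spectrum.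
Context {R : realType}.
Implicit Types (phi u F G H : R * R -> R) (x y : R * R) (T S : (R * R -> R) -> R).
Implicit Types (j n a q : nat) (b t : bool) (c : R).

Lemma trig_add b1 (s t : R) :
  trig b1 (s + t) = trig b1 s * trig false t + tsgn b1 * trig (~~ b1) s * trig true t.
Proof. by case: b1; rewrite /trig /tsgn /= ?sinD ?cosD; ring. Qed.

Lemma trig_sub b1 (s t : R) :
  trig b1 (s - t) = trig b1 s * trig false t - tsgn b1 * trig (~~ b1) s * trig true t.
Proof. by rewrite trig_add /trig cosN sinN; ring. Qed.

Lemma freq_kap n1 : freq (Posz n1) = kap n1 :> R. Proof. by []. Qed.

Lemma freq_opp n1 : freq (- Posz n1) = - kap n1 :> R.
Proof. by rewrite /freq mulrNz mulrN. Qed.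

Lemma plane_plus b1 n1 n2 : (fun x => trig b1 (phase (Posz n1, Posz n2) x)) =
  (fun x => tsgn b1 * tensor n1 (~~ b1) n2 true x + tensor n1 b1 n2 false x).
Proof.
by apply/funext => x; rewrite /phase !freq_kap trig_add /tensor /wave; ring.
Qed.

Lemma plane_minus b1 n1 n2 : (fun x => trig b1 (phase (Posz n1, - Posz n2) x)) =
  (fun x => - tsgn b1 * tensor n1 (~~ b1) n2 true x + tensor n1 b1 n2 false x).
Proof.
by apply/funext => x; rewrite /phase freq_kap freq_opp mulNr trig_sub /tensor /wave; ring.
Qed.

Lemma multiplier_plane m T S (n : int * int) (u v : R) : fourier_mult m T S -> m n = Complex u v ->
  forall b1, S (fun x => trig b1 (phase n x)) =
    u * T (fun x => trig b1 (phase n x)) - tsgn b1 * v * T (fun x => trig (~~ b1) (phase n x)).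
Proof.
move=> /(_ n) + e; rewrite e /fourier /trig /tsgn => /eqP; rewrite eq_complex /= => /andP[/eqP h1 /eqP h2].
by case; lra.
Qed.

(** The plane waves at the frequencies (n1, n2) and (n1, - n2) span the products
    of waves of frequency n1 in x_1 and n2 in x_2. *)
Lemma multiplier_tensor m T S n1 n2 (u v : R) :
  periodic_distribution T -> periodic_distribution S -> fourier_mult m T S ->
  m (Posz n1, Posz n2) = Complex u v -> m (Posz n1, - Posz n2) = Complex u v ->
  forall b1 b2, S (tensor n1 b1 n2 b2) =
    u * T (tensor n1 b1 n2 b2) - tsgn b1 * v * T (tensor n1 (~~ b1) n2 b2).
Proof.
move=> dT dS mTS e1 e2.
have tt b1 b2 : test (tensor n1 b1 n2 b2 : R * R -> R) by exact: test_tensor.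
have h1 b1 := multiplier_plane mTS e1 b1; have h2 b1 := multiplier_plane mTS e2 b1.
have g1 b1 : tsgn b1 * S (tensor n1 (~~ b1) n2 true) + S (tensor n1 b1 n2 false) =
    u * (tsgn b1 * T (tensor n1 (~~ b1) n2 true) + T (tensor n1 b1 n2 false)) -
    tsgn b1 * v * (tsgn (~~ b1) * T (tensor n1 (~~ ~~ b1) n2 true) + T (tensor n1 (~~ b1) n2 false)).
  by have := h1 b1; rewrite !plane_plus !(dist_linear dT) // !(dist_linear dS).
have g2 b1 : - tsgn b1 * S (tensor n1 (~~ b1) n2 true) + S (tensor n1 b1 n2 false) =
    u * (- tsgn b1 * T (tensor n1 (~~ b1) n2 true) + T (tensor n1 b1 n2 false)) -
    tsgn b1 * v * (- tsgn (~~ b1) * T (tensor n1 (~~ ~~ b1) n2 true) + T (tensor n1 (~~ b1) n2 false)).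
  by have := h2 b1; rewrite !plane_minus !(dist_linear dT) // !(dist_linear dS).
have := (g1 true, g1 false, g2 true, g2 false).
rewrite /tsgn /= => -[[[k1 k2] k3] k4].
by case; case; rewrite /=; lra.
Qed.

(** The sign of a product of waves in the expansion of a wave of s - t; see
    [wave_difference]. *)
Definition twist t1 b1 : R := if t1 then tsgn b1 else 1.

Definition moment G t1 t2 n1 b1 n2 b2 : R := twist t1 b1 * twist t2 b2 *
  I2 (fun y => G y * tensor n1 (t1 (+) b1) n2 (t2 (+) b2) y).

Lemma wave_difference t1 n1 (s t : R) :
  wave t1 n1 (s - t) = \sum_b1 twist t1 b1 * (wave b1 n1 s * wave (t1 (+) b1) n1 t).
Proof.
by rewrite big_bool /wave mulrBr trig_sub /twist /tsgn; case: t1 => /=; ring.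
Qed.

Lemma tconv_moment G t1 t2 n1 n2 x : continuous G ->
  tconv G (wave t1 n1) (wave t2 n2) x =
  \sum_(b : bool * bool) moment G t1 t2 n1 b.1 n2 b.2 * tensor n1 b.1 n2 b.2 x.
Proof.
move=> cG; have ct b1 b2 := @tensor_continuous R n1 b1 n2 b2.
rewrite /tconv (_ : (fun y => _) = fun y => \sum_(b : bool * bool)
    (twist t1 b.1 * twist t2 b.2 * tensor n1 b.1 n2 b.2 x) *
    (G y * tensor n1 (t1 (+) b.1) n2 (t2 (+) b.2) y)).
  rewrite I2_sum; last by move=> b; exact: continuous_mul.
  by apply: eq_bigr => b _; rewrite /moment; ring.
apply/funext => y; rewrite !wave_difference big_distrlr /= pair_big /= mulr_suml.
by apply: eq_bigr => b _; rewrite /tensor; ring.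
Qed.

(** The action on test functions of [c] times the operator with symbol
    k_1^a k_2^q / (k_1^3 + k_2^2) applied to [G]. *)
Definition response c G t1 t2 a q n1 b1 n2 b2 : R :=
  c * (kap n1 ^+ a * kap n2 ^+ q / symb (n1, n2) * moment G t1 t2 n1 b1 n2 b2).

Lemma pot_response c G t1 t2 a q j x : continuous G ->
  \sum_(k : modes j) amplitude k * response c G t1 t2 a q k.1.1 k.2.1 k.1.2 k.2.2 * mode k x =
  c * pot G t1 t2 a q j.+1 (tau j) x.
Proof.
move=> cG; transitivity (\sum_(k : 'I_j.+2 * 'I_j.+2) \sum_(d : bool * bool)
    amplitude ((k, d) : modes j) * response c G t1 t2 a q k.1 d.1 k.2 d.2 *
    mode ((k, d) : modes j) x).
  by rewrite pair_bigA; apply: eq_bigr => -[].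
rewrite /pot mulr_sumr; apply: eq_bigr => k _; rewrite tconv_moment //.
rewrite mulr_sumr mulr_suml mulr_sumr; apply: eq_bigr => d _.
by rewrite /amplitude /response /coef /mode /= !expr0; ring.
Qed.

Lemma reg_pot T c G t1 t2 a q c' G' t1' t2' a' q' j : periodic_distribution T ->
  continuous G -> continuous G' ->
  (forall n1 b1 n2 b2, T (tensor n1 b1 n2 b2) =
     response c G t1 t2 a q n1 b1 n2 b2 + response c' G' t1' t2' a' q' n1 b1 n2 b2) ->
  reg T j = fun x => c * pot G t1 t2 a q j.+1 (tau j) x + c' * pot G' t1' t2' a' q' j.+1 (tau j) x.
Proof.
move=> dT cG cG' TE; rewrite reg_expand //; apply/funext => x.
rewrite -!pot_response // -big_split; apply: eq_bigr => k _.
by rewrite /mode TE mulrDr mulrDl.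
Qed.

Lemma response0 c G t1 t2 a q b1 n2 b2 : (0 < a)%N -> response c G t1 t2 a q 0 b1 n2 b2 = 0.
Proof. by move=> a0; rewrite /response kap0 expr0n gtn_eqF // !mul0r mulr0. Qed.

(** The Hilbert transform in the first variable flips the parity there. *)
Lemma response_rotate c G t1 t2 a q n1 b1 n2 b2 :
  - tsgn b1 * response c G t1 t2 a q n1 (~~ b1) n2 b2 =
  response (c * tsgn t1) G (~~ t1) t2 a q n1 b1 n2 b2.
Proof.
by rewrite /response /moment /twist /tsgn; case: t1; case: b1 => /=; ring.
Qed.

Lemma I1_wave b1 n1 : (0 < n1)%N -> I1 (wave b1 n1) = 0 :> R.
Proof.
move=> n0; rewrite -(I1_shift 0); first by rewrite /wave I1_trig gtn_eqF.
  exact: wave_continuous.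
by move=> t; rewrite /wave trig_periodic.
Qed.

Section Pairings.
Variables (n1 n2 : nat) (b1 b2 : bool).
Notation phi := (tensor n1 b1 n2 b2 : R * R -> R).

Lemma pderiv_tensorZ i c : pderiv i (fun x => c * phi x) =
  (fun x => c * dtensor n1 b1 n2 b2 i x).
Proof.
by apply/funext => x; apply: pderivE; exact: (is_deriveZ c (is_derive_tensor n1 b1 n2 b2 i x)).
Qed.

Lemma pairing_cst c : (0 < n1)%N -> dist_of_fun (cst c) phi = 0.
Proof.
move=> n0; rewrite /dist_of_fun -/(I2 _).
have cw1 := @wave_continuous R b1 n1; have cw2 := @wave_continuous R b2 n2.
rewrite (I2Z c (@tensor_continuous R n1 b1 n2 b2)) (I2_tensor cw1 cw2).
by rewrite I1_wave // mul0r mulr0.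
Qed.

Lemma pairing_d1 G : continuous G ->
  dderiv true (dist_of_fun G) phi = - (kap n1 * moment G true false n1 b1 n2 b2).
Proof.
move=> cG; rewrite /dderiv /dist_of_fun -/(I2 _) pderiv_tensor /dtensor.
have ct := @tensor_continuous R n1 (~~ b1) n2 b2.
rewrite (_ : (fun x => _) = fun x => (tsgn b1 * kap n1) * (G x * tensor n1 (~~ b1) n2 b2 x)).
  by rewrite I2Z; [rewrite /moment /twist /=; ring|exact: continuous_mul].
by apply/funext => x; ring.
Qed.

Lemma pairing_d2 G : continuous G ->
  dderiv false (dist_of_fun G) phi = - (kap n2 * moment G false true n1 b1 n2 b2).
Proof.
move=> cG; rewrite /dderiv /dist_of_fun -/(I2 _) pderiv_tensor /dtensor.
have ct := @tensor_continuous R n1 b1 n2 (~~ b2).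
rewrite (_ : (fun x => _) = fun x => (tsgn b2 * kap n2) * (G x * tensor n1 b1 n2 (~~ b2) x)).
  by rewrite I2Z; [rewrite /moment /twist /=; ring|exact: continuous_mul].
by apply/funext => x; ring.
Qed.

End Pairings.

Lemma pairing_d11 G n1 b1 n2 b2 : continuous G ->
  dderiv true (dderiv true (dist_of_fun G)) (tensor n1 b1 n2 b2) =
  - (kap n1 ^+ 2 * moment G false false n1 b1 n2 b2).
Proof.
move=> cG; rewrite /dderiv /dist_of_fun -/(I2 _) pderiv_tensor /dtensor pderiv_tensorZ /dtensor negbK.
have ct := @tensor_continuous R n1 b1 n2 b2.
rewrite (_ : (fun x => _) = fun x => (- kap n1 ^+ 2) * (G x * tensor n1 b1 n2 b2 x)).
  by rewrite I2Z; [rewrite /moment /twist /=; ring|exact: continuous_mul].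
by apply/funext => x; rewrite /tsgn; case: (b1) => /=; ring.
Qed.

Section Operators.
Variables (f Rf Lf : (R * R -> R) -> R).
Hypotheses (df : periodic_distribution f) (dR : periodic_distribution Rf).
Hypothesis dL : periodic_distribution Lf.
Hypotheses (van : vanishing_x1_average f) (mR : fourier_mult symbol_R f Rf).
Hypothesis mL : fourier_mult symbol_L f Lf.

(** For n1 > 0 the symbol of R is i, which exchanges cosines and sines in x_1 up
    to signs; for n1 = 0 it vanishes, and so does f by assumption. *)
Lemma hilbert_tensor n1 b1 n2 b2 :
  Rf (tensor n1 b1 n2 b2) = - tsgn b1 * f (tensor n1 (~~ b1) n2 b2).
Proof.
have v0 d1 d2 : f (tensor 0 d1 n2 d2) = 0.
  apply: van => [|x y xy]; first exact: test_tensor.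
  by rewrite /tensor /wave !kap0 !mul0r xy.
case: n1 => [|n1].
  rewrite v0 mulr0 (multiplier_tensor df dR mR (u := 0) (v := 0)) //.
  by rewrite mul0r mulr0 mul0r subr0.
have e (n : int) : symbol_R (Posz n1.+1, n) = Complex 0 1 :> R[i].
  by rewrite /symbol_R /= freq_kap gtr0_sg // /kap !mulr_gt0 ?pi_gt0 ?ltr0n.
by rewrite (multiplier_tensor df dR mR (e _) (e _)) mul0r sub0r mulr1 mulNr.
Qed.

(** For n1 > 0 the symbol k_1^2 + k_2^2 / k_1 is [symb] divided by k_1. *)
Lemma inverse_tensor n1 b1 n2 b2 :
  f (tensor n1 b1 n2 b2) = kap n1 / symb (n1, n2) * Lf (tensor n1 b1 n2 b2).
Proof.
case: n1 => [|n1].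
  rewrite kap0 !mul0r; apply: van => [|x y xy]; first exact: test_tensor.
  by rewrite /tensor /wave !kap0 !mul0r xy.
have k0 : 0 < kap n1.+1 :> R by rewrite /kap !mulr_gt0 ?pi_gt0 ?ltr0n.
pose u : R := symb (n1.+1, n2) / kap n1.+1.
have s0 : 0 < symb (n1.+1, n2) :> R by rewrite ltr_wpDr ?sqr_ge0 // exprn_gt0.
have uE (r : R) : r ^+ 2 = kap n2 ^+ 2 ->
    kap n1.+1 ^+ 2 + `|kap n1.+1|^-1 * r ^+ 2 = u.
  move=> ->; rewrite gtr0_norm // /u /symb /= mulrDl; congr (_ + _); last by rewrite mulrC.
  by rewrite [in RHS]exprS mulrC mulKf // gt_eqF.
have e1 : symbol_L (Posz n1.+1, Posz n2) = Complex u 0 :> R[i].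
  by rewrite /symbol_L /= !freq_kap uE.
have e2 : symbol_L (Posz n1.+1, - Posz n2) = Complex u 0 :> R[i].
  by rewrite /symbol_L /= freq_kap freq_opp uE // sqrrN.
rewrite (multiplier_tensor df dL mL e1 e2) mulr0 mul0r subr0 mulrA /u.
by rewrite mulrA divfK ?gt_eqF // divff ?gt_eqF // mul1r.
Qed.

(** The constant [c] only meets the frequency n1 = 0, where both sides vanish. *)
Lemma spectrum_second_order c G H : continuous G -> continuous H ->
  eq_dist Lf (fun phi => dist_of_fun (cst c) phi
        + dderiv true (dderiv true (dist_of_fun G)) phi
        + dderiv false (dist_of_fun H) phi) ->
  forall n1 b1 n2 b2, f (tensor n1 b1 n2 b2) =
    response (-1) G false false 3 0 n1 b1 n2 b2 + response (-1) H false true 1 1 n1 b1 n2 b2.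
Proof.
move=> cG cH LE n1 b1 n2 b2; rewrite inverse_tensor.
case: n1 => [|n1]; first by rewrite kap0 !mul0r !response0 // addr0.
rewrite LE; last exact: test_tensor.
by rewrite pairing_cst // pairing_d11 // pairing_d2 // /response; ring.
Qed.

Lemma spectrum_first_order c G H : continuous G -> continuous H ->
  eq_dist Lf (fun phi => dist_of_fun (cst c) phi
        + dderiv true (dist_of_fun G) phi
        + dderiv false (dist_of_fun H) phi) ->
  forall n1 b1 n2 b2, f (tensor n1 b1 n2 b2) =
    response (-1) G true false 2 0 n1 b1 n2 b2 + response (-1) H false true 1 1 n1 b1 n2 b2.
Proof.
move=> cG cH LE n1 b1 n2 b2; rewrite inverse_tensor.
case: n1 => [|n1]; first by rewrite kap0 !mul0r !response0 // addr0.
rewrite LE; last exact: test_tensor.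
by rewrite pairing_cst // pairing_d1 // pairing_d2 // /response; ring.
Qed.

Lemma spectrum_hilbert c G t1 t2 a q c' G' t1' t2' a' q' :
  (forall n1 b1 n2 b2, f (tensor n1 b1 n2 b2) =
     response c G t1 t2 a q n1 b1 n2 b2 + response c' G' t1' t2' a' q' n1 b1 n2 b2) ->
  forall n1 b1 n2 b2, Rf (tensor n1 b1 n2 b2) =
     response (c * tsgn t1) G (~~ t1) t2 a q n1 b1 n2 b2 +
     response (c' * tsgn t1') G' (~~ t1') t2' a' q' n1 b1 n2 b2.
Proof.
by move=> fE n1 b1 n2 b2; rewrite hilbert_tensor fE mulrDr !response_rotate.
Qed.

End Operators.
End Spectrum.

(** * The estimate *)

Section Estimate.
Context {R : realType}.
Implicit Types (F G H D : R * R -> R) (x y : R * R) (T f : (R * R -> R) -> R).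
Implicit Types (j n a q : nat) (b t : bool) (c p N K alpha beta : R).

Lemma expansion_combine p c c' N N' F F' D D' :
  `|c| <= 1 -> `|c'| <= 1 -> expansion p N F D -> expansion p N' F' D' ->
  expansion p (N + N') (fun x => c * F x + c' * F' x) (fun x => c * D x + c' * D' x).
Proof.
move=> c1 c1' [h1 h2] [h1' h2'].
have le (d u v : R) : `|d| <= 1 -> `|u| <= v -> `|d * u| <= v.
  by move=> d1 uv; rewrite normrM (le_trans _ uv) // ler_piMl.
split=> x h; rewrite mulrDl.
- rewrite (_ : _ - _ = c * (F (x.1, x.2 + h) - F x) + c' * (F' (x.1, x.2 + h) - F' x)); last by ring.
  by rewrite (le_trans (ler_normD _ _)) // lerD // le.
- rewrite (_ : _ - _ = c * (F (x.1 + h, x.2) - F x - h * D x) +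
    c' * (F' (x.1 + h, x.2) - F' x - h * D' x)); last by ring.
  by rewrite (le_trans (ler_normD _ _)) // lerD // le.
Qed.

Lemma pot_expansion a q beta alpha : (0 < a)%N -> 0 < beta -> beta < 1 ->
  (beta - a%:R) / 3 - q%:R / 2 = alpha / 3 - 1 -> 1 / 2 < alpha -> alpha < 3 / 2 ->
  alpha <> 1 -> exists2 C : R, 0 < C & forall G N t1 t2 j,
  continuous G -> x1_holder N beta G -> 0 <= N -> (t2 -> (0 < q)%N) ->
  exists2 D, expansion alpha (C * N) (pot G t1 t2 a q j.+1 (tau j)) D &
    alpha < 1 -> forall x, D x = 0.
Proof.
move=> a0 b0 b1 hom al1 al2 al; have al0 : 0 < alpha by lra.
have [C2 C20 P2] := pot_x2_holder a0 b0 b1 hom al0 al2.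
have [C1 C10 P1] : exists2 C : R, 0 < C & forall G N t1 t2 j,
    continuous G -> x1_holder N beta G -> 0 <= N -> (t2 -> (0 < q)%N) ->
    exists2 D, (forall x h, `|pot G t1 t2 a q j.+1 (tau j) (x.1 + h, x.2) -
       pot G t1 t2 a q j.+1 (tau j) x - h * D x| <= C * N * `|h| `^ alpha) &
    alpha < 1 -> forall x, D x = 0.
  have [lt1|gt1|//] := ltgtP alpha 1.
    have [C C0 PC] := pot_x1_holder a0 b0 b1 hom al0 lt1.
    exists C => // G N t1 t2 j cG hG N0 tq; exists (fun=> 0) => // x h.
    by rewrite mulr0 subr0; apply: PC cG hG N0 tq (tau_gt0 j) (tau_admissible j) _ _.
  have al3 : alpha < 2 by lra.
  have [C C0 PC] := pot_x1_taylor a0 b0 b1 hom gt1 al3.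
  exists C => // G N t1 t2 j cG hG N0 tq.
  exists (fun x => tsgn t1 * pot G (~~ t1) t2 a.+1 q j.+1 (tau j) x) => // x h.
  exact: PC cG hG N0 tq (tau_gt0 j) (tau_admissible j) _ _.
exists (C2 + C1) => [|G N t1 t2 j cG hG N0 tq]; first exact: addr_gt0.
have [D hD D0] := P1 G N t1 t2 j cG hG N0 tq; exists D => //.
split=> x h; rewrite [(C2 + C1) * N]mulrDl [leRHS]mulrDl.
  apply: le_trans (P2 G N t1 t2 _ _ cG hG N0 tq (tau_gt0 j) (tau_admissible j) x h) _.
  by rewrite lerDl !mulr_ge0 ?powR_ge0 // ltW.
by rewrite (le_trans (hD x h)) // lerDr !mulr_ge0 ?powR_ge0 // ltW.
Qed.

Lemma holder_source p N G : 0 < p -> p < 1 -> 0 <= N -> periodic2 G ->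
  (holder p G <= N%:E)%E -> continuous G /\ x1_holder N p G.
Proof.
move=> p0 p1 N0 pG hG; have ex := holder_expansion p0 (ltW p1) hG; split.
  have b0 : 0 < 2 * p / 3 by rewrite divr_gt0 // mulr_gt0.
  have N20 : 0 <= 2 * N by rewrite mulr_ge0.
  apply: (sin_holder_continuous b0 N20).
  by apply: expansion_sin_holder pG N0 b0 _ _ ex; lra.
move=> s s' t; apply: (@periodic_sin_holder _ (fun r => G (r, t))) => // [||r h h2].
- exact: ltW.
- by move=> r; have [] := pG (r, t).
- by have [_ /(_ (r, t) h)] := ex; rewrite mulr0 subr0.
Qed.

Lemma holder_ge0 p F : (0 <= holder p F)%E.
Proof.
apply: le_trans (ereal_sup_ubound _); last first.
  exists (0, 0), (1, 0); split; last by [].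
  by apply/eqP => -[/esym/eqP]; rewrite oner_eq0.
by rewrite lee_fin divr_ge0 // powR_ge0.
Qed.

(** By [reg_pot] the regularizations are combinations of potentials, whose
    expansions are uniform in the starting time, so that [density_regularity]
    applies. The hypothesis on [T] is conditional on continuity, which follows
    from the finiteness of [r]. *)
Lemma response_regularity alpha a a' q q' beta beta' :
  (0 < a)%N -> 0 < beta -> beta < 1 -> (beta - a%:R) / 3 - q%:R / 2 = alpha / 3 - 1 ->
  (0 < a')%N -> 0 < beta' -> beta' < 1 -> (beta' - a'%:R) / 3 - q'%:R / 2 = alpha / 3 - 1 ->
  1 / 2 < alpha -> alpha < 3 / 2 -> alpha <> 1 ->
  exists2 C : R, 0 < C & forall T c c' G G' t1 t2 t1' t2' (r : \bar R),
  periodic_distribution T -> `|c| <= 1 -> `|c'| <= 1 ->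
  periodic2 G -> periodic2 G' -> (t2 -> (0 < q)%N) -> (t2' -> (0 < q')%N) ->
  (continuous G -> continuous G' -> forall n1 b1 n2 b2, T (tensor n1 b1 n2 b2) =
     response c G t1 t2 a q n1 b1 n2 b2 + response c' G' t1' t2' a' q' n1 b1 n2 b2) ->
  (holder beta G + holder beta' G' <= r)%E -> (r < +oo)%E ->
  represents alpha (density T) T /\ (holder alpha (density T) <= C%:E * r)%E.
Proof.
move=> a0 b0 b1 hom a0' b0' b1' hom' al1 al2 al.
have [C C0 PC] := pot_expansion a0 b0 b1 hom al1 al2 al.
have [C' C0' PC'] := pot_expansion a0' b0' b1' hom' al1 al2 al.
exists (2 * (C + C')) => [|T c c' G G' t1 t2 t1' t2' r dT c1 c1' pG pG' tq tq' TE le roo].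
  by rewrite mulr_gt0 // addr_gt0.
have h0 := holder_ge0 beta G; have h0' := holder_ge0 beta' G'.
have r0 : (0 <= r)%E by apply: le_trans le; exact: adde_ge0.
case: r roo r0 le => [r _|//|//]; rewrite lee_fin => r0 le.
pose N := fine (holder beta G); pose N' := fine (holder beta' G').
have fG : holder beta G = N%:E.
  rewrite /N fineK // ge0_fin_numE //; apply: le_lt_trans (ltry r).
  by apply: le_trans le; rewrite leeDl.
have fG' : holder beta' G' = N'%:E.
  rewrite /N' fineK // ge0_fin_numE //; apply: le_lt_trans (ltry r).
  by apply: le_trans le; rewrite leeDr.
rewrite fG lee_fin in h0; rewrite fG' lee_fin in h0'.
rewrite fG fG' -EFinD lee_fin in le.
have [|cG hG] := holder_source b0 b1 h0 pG; first by rewrite fG.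
have [|cG' hG'] := holder_source b0' b1' h0' pG'; first by rewrite fG'.
have K0 : 0 <= C * N + C' * N' by rewrite addr_ge0 // mulr_ge0 // ltW.
have [|rep hold] := density_regularity al1 al2 al K0 dT.
  move=> j; rewrite (reg_pot j dT cG cG' (TE cG cG')).
  have [D eD D0] := PC G N t1 t2 j cG hG h0 tq.
  have [D' eD' D0'] := PC' G' N' t1' t2' j cG' hG' h0' tq'.
  exists (fun x => c * D x + c' * D' x); first exact: expansion_combine.
  by move=> lt1 x; rewrite D0 // D0' // !mulr0 addr0.
split=> //; apply: (le_trans hold); rewrite -EFinM lee_fin -mulrA ler_pM2l //.
rewrite mulrDl; have rN : N <= r by lra.
have rN' : N' <= r by lra.
by rewrite lerD // ler_wpM2l // ltW.
Qed.

(** In the application [A] collects the sizes of the representations of a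
    distribution, on which [h] does not depend. *)
Lemma infimum_bound (A : set (\bar R)) (Q : Prop) (h : \bar R) C :
  0 < C -> (ereal_inf A < +oo)%E ->
  (forall r, A r -> (r < +oo)%E -> Q /\ (h <= C%:E * r)%E) ->
  Q /\ (h <= C%:E * ereal_inf A)%E.
Proof.
move=> C0 Aoo PA; have [r Ar roo] := ereal_inf_lt Aoo.
split; first by have [] := PA r Ar roo.
rewrite muleC -lee_pdivrMr //; apply: le_ereal_inf_tmp => s As.
rewrite lee_pdivrMr // muleC; have [soo|] := ltP s +oo%E; first by have [] := PA s As soo.
by rewrite leye_eq => /eqP ->; rewrite gt0_muley ?lte_fin // leey.
Qed.

End Estimate.

Theorem lemma5 (R : realType) (alpha : R) :
  1 / 2 < alpha -> alpha < 3 / 2 -> alpha <> 1 ->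
  exists2 C : R, 0 < C &
  forall f Rf Lf : (R * R -> R) -> R,
    periodic_distribution f -> periodic_distribution Rf -> periodic_distribution Lf ->
    vanishing_x1_average f ->
    fourier_mult symbol_R f Rf ->
    fourier_mult symbol_L f Lf ->
    (neg_holder (alpha - 2) Lf < +oo)%E ->
    (exists2 F : R * R -> R, represents alpha F Rf &
       (holder alpha F <= C%:E * neg_holder (alpha - 2) Lf)%E) /\
    (exists2 F : R * R -> R, represents alpha F f &
       (holder alpha F <= C%:E * neg_holder (alpha - 2) Lf)%E).
Proof.
move=> al1 al2 al.
have e32 : alpha - 2 + 3 / 2 = alpha - 1 / 2 by field.
have b0' : 0 < alpha - 1 / 2 by lra.
have b1' : alpha - 1 / 2 < 1 by lra.
(* H has regularity alpha - 1/2 and meets one derivative in each variable; G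
   has regularity alpha with three derivatives in x_1, or alpha - 1 with two.
   The resulting powers of the time agree. *)
have hom' : (alpha - 1 / 2 - 1%:R) / 3 - 1%:R / 2 = alpha / 3 - 1 by field.
have sum (c : R) (u v : \bar R) : (u + v <= `|c|%:E + u + v)%E.
  by rewrite -addeA leeDr // lee_fin.
have n1 (c : R) t : `|c| <= 1 -> `|c * tsgn t| <= 1.
  by rewrite normrM /tsgn; case: t; rewrite ?normrN normr1 mulr1.
have nN1 : `|-1| <= 1 :> R by rewrite normrN normr1.
have wrap (T : (R * R -> R) -> R) (C : R) (r : \bar R) :
    represents alpha (density T) T /\ (holder alpha (density T) <= C%:E * r)%E ->
    exists2 F : R * R -> R, represents alpha F T & (holder alpha F <= C%:E * r)%E.
  by move=> [rT hT]; exists (density T).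
have [lt1|gt1|//] := ltgtP alpha 1.
- have b0 : 0 < alpha by lra.
  have hom : (alpha - 3%:R) / 3 - 0%:R / 2 = alpha / 3 - 1 by field.
  have [C C0 PC] := response_regularity (isT : (0 < 3)%N) b0 lt1 hom
    (isT : (0 < 1)%N) b0' b1' hom' al1 al2 al.
  exists C => // f Rf Lf df dR dL van mR mL.
  rewrite /neg_holder; case: (ltP (-1) (alpha - 2)) => [h|_]; first by exfalso; lra.
  have e2 : alpha - 2 + 2 = alpha by ring.
  rewrite e32 e2 => fin; split; apply: wrap; apply: (infimum_bound C0 fin) =>
    r [c [G [H [pG pH LE ->]]]] roo.
    apply: (PC _ (-1 * tsgn false) (-1 * tsgn false) G H true false true true) => //;
      try exact: n1.
    move=> cG cH; apply: (spectrum_hilbert df dR van mR).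
    exact: (spectrum_second_order df dL van mL cG cH LE).
  apply: (PC _ (-1) (-1) G H false false false true) => //.
  by move=> cG cH; exact: (spectrum_second_order df dL van mL cG cH LE).
- have b0 : 0 < alpha - 1 by lra.
  have b1 : alpha - 1 < 1 by lra.
  have hom : (alpha - 1 - 2%:R) / 3 - 0%:R / 2 = alpha / 3 - 1 by field.
  have [C C0 PC] := response_regularity (isT : (0 < 2)%N) b0 b1 hom
    (isT : (0 < 1)%N) b0' b1' hom' al1 al2 al.
  exists C => // f Rf Lf df dR dL van mR mL.
  rewrite /neg_holder; case: (ltP (-1) (alpha - 2)) => [_|h]; last by exfalso; lra.
  have e2 : alpha - 2 + 1 = alpha - 1 by ring.
  rewrite e32 e2 => fin; split; apply: wrap; apply: (infimum_bound C0 fin) =>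
    r [c [G [H [pG pH LE ->]]]] roo.
    apply: (PC _ (-1 * tsgn true) (-1 * tsgn false) G H false false true true) => //;
      try exact: n1.
    move=> cG cH; apply: (spectrum_hilbert df dR van mR).
    exact: (spectrum_first_order df dL van mL cG cH LE).
  apply: (PC _ (-1) (-1) G H true false false true) => //.
  by move=> cG cH; exact: (spectrum_first_order df dL van mL cG cH LE).
Qed.
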